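(* Let $\mathcal N\in\mathrm{Ch}(A'B',AB)$ and regard $\mathcal N^{\otimes n}$ as a bipartite channel $A'^nB'^n\to A^nB^n$. Then \[ \lim_{\varepsilon\to0^+}\lim_{n\to\infty}\frac1nS^\varepsilon_\infty[A^n|B^n]_{\mathcal N^{\otimes n}}\le S^{\not\to}[A|B]_{\mathcal N}. \] If moreover $\mathcal N$ is no-signaling from $A'$ to $B$, then \[ \lim_{\varepsilon\to0^+}\lim_{n\to\infty}\frac1nS^\varepsilon_\infty[A^n|B^n]_{\mathcal N^{\otimes n}}\le S[A|B]_{\mathcal N},\qquad \lim_{n\to\infty}\frac1nS^\varepsilon_\infty[A^n|B^n]_{\mathcal N^{\otimes n}}\ge S[A|B]_{\mathcal N}\ \text{ for every }\varepsilon\in(0,1). \]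
   Context: All systems are finite-dimensional; $|X|$ denotes dimension; $\log$ base 2; $\mathrm{St}(X)$ density operators; $\mathrm{Ch}(X',X)$ quantum channels. $\mathcal R^{\mathbb 1}_{A'\to A}(X):=\operatorname{tr}(X)\mathbb 1_A$. $D(\rho\|\sigma)=\operatorname{tr}\rho(\log\rho-\log\sigma)$; $D_\infty(\rho\|\sigma):=\log\inf\{\lambda:\rho\le\lambda\sigma\}$; channel versions $\mathbf D[\mathcal M\|\mathcal M']:=\sup_{\rho\in\mathrm{St}(RX')}\mathbf D((\mathrm{id}_R\otimes\mathcal M)(\rho)\|(\mathrm{id}_R\otimes\mathcal M')(\rho))$. $S[A|B]_{\mathcal N}:=-\inf_{\mathcal Q\in\mathrm{Ch}(B',B)}D[\mathcal N\|\mathcal R^{\mathbb 1}_{A'\to A}\otimes\mathcal Q]$; $S^{\not\to}[A|B]_{\mathcal N}:=-D[\mathcal N\|\mathcal R^{\mathbb 1}_{A\to A}\circ\mathcal N]$, where $(\mathcal R^{\mathbb1}_{A\to A}\circ\mathcal N)(X)=\mathbb 1_A\otimes\operatorname{tr}_A\mathcal N(X)$. Purified distance of channels: $P[\mathcal M_1,\mathcal M_2]:=\sup_{\rho}\sqrt{1-F((\mathrm{id}\otimes\mathcal M_1)(\rho),(\mathrm{id}\otimes\mathcal M_2)(\rho))}$, $F(\rho,\sigma)=\|\sqrt\rho\sqrt\sigma\|_1^2$. Smoothed conditional channel min-entropy: $S^\varepsilon_\infty[A|B]_{\mathcal N}:=-\inf_{\mathcal Q\in\mathrm{Ch}(B',B)}\inf\{D_\infty[\widetilde{\mathcal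 N}\|\mathcal R^{\mathbb 1}_{A'\to A}\otimes\mathcal Q]:\widetilde{\mathcal N}\in\mathrm{Ch}(A'B',AB),\ P[\mathcal N,\widetilde{\mathcal N}]\le\varepsilon\}$. A channel $\mathcal N\in\mathrm{Ch}(A'B',AB)$ is no-signaling (semicausal) from $A'$ to $B$ if there is $\mathcal Q^{\mathcal N}\in\mathrm{Ch}(B',B)$ with $\operatorname{tr}_A\circ\mathcal N=\operatorname{tr}_{A'}\otimes\mathcal Q^{\mathcal N}$. *)

(* Defs.v *)
From HB Require Import structures.
From mathcomp Require Import all_boot all_order all_algebra.
From mathcomp Require Import all_classical all_reals.
From mathcomp Require Import ereal topology normedtype sequences exp.
From mathcomp Require Import complex mxtens.

Set Implicit Arguments.
Unset Strict Implicit.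
Unset Printing Implicit Defensive.

Import Order.TTheory GRing.Theory Num.Theory.
Local Open Scope ring_scope.
Local Open Scope classical_set_scope.

Section QuantumInfo.
Context {R : realType}.
Local Notation C := (complex R).

Definition adj {m n} (A : 'M[C]_(m, n)) : 'M[C]_(n, m) :=
  \matrix_(i, j) Num.conj (A j i).

Definition psd {d} (A : 'M[C]_d) : Prop :=
  adj A = A /\ forall v : 'cV[C]_d, 0 <= (adj v *m A *m v) 0 0.

Definition loewner_le {d} (A B : 'M[C]_d) : Prop := psd (B - A).

Definition is_state {d} (rho : 'M[C]_d) : Prop := psd rho /\ \tr rho = 1.

Definition unitary {d} (U : 'M[C]_d) : Prop := adj U *m U = 1%:M.

Definition spec_decomp {d} (A : 'M[C]_d) (Ul : 'M[C]_d * 'rV[R]_d) : Prop :=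
  unitary Ul.1 /\
  A = Ul.1 *m diag_mx (map_mx (fun x => Complex x 0) Ul.2) *m adj Ul.1.

(** functional calculus f(A) for Hermitian A (via a chosen spectral
    decomposition; for non-Hermitian A this is an irrelevant default) *)
Definition fun_mx (f : R -> R) {d} (A : 'M[C]_d) : 'M[C]_d :=
  let Ul := xget (1%:M, 0) (spec_decomp A) in
  Ul.1 *m diag_mx (map_mx (fun x => Complex (f x) 0) Ul.2) *m adj Ul.1.

Definition log2 (x : R) : R := ln x / ln 2.

Definition slog2 (x : R) : R := if 0 < x then log2 x else 0.

Definition trR {d} (X : 'M[C]_d) : R := complex.Re (\tr X).

Definition supp_le {d} (rho sigma : 'M[C]_d) : Prop :=
  forall v : 'cV[C]_d, sigma *m v = 0 -> rho *m v = 0.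

Definition relent {d} (rho sigma : 'M[C]_d) : \bar R :=
  if `[< supp_le rho sigma >] then
    (trR (rho *m (fun_mx slog2 rho - fun_mx slog2 sigma)))%:E
  else +oo%E.

Definition dmax {d} (rho sigma : 'M[C]_d) : \bar R :=
  ereal_inf [set (log2 l)%:E | l in [set l : R | 0 < l /\ loewner_le rho ((Complex l 0) *: sigma)]].

Definition trnorm {d} (X : 'M[C]_d) : R := trR (fun_mx Num.sqrt (adj X *m X)).
Definition fidelity {d} (rho sigma : 'M[C]_d) : R :=
  (trnorm (fun_mx Num.sqrt rho *m fun_mx Num.sqrt sigma)) ^+ 2.

Definition tensor_map {a1 a2 b1 b2}
  (M : 'M[C]_a1 -> 'M[C]_a2) (N : 'M[C]_b1 -> 'M[C]_b2) :
  'M[C]_(a1 * b1) -> 'M[C]_(a2 * b2) :=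
  fun X => \sum_(i < a1) \sum_(j < a1) \sum_(k < b1) \sum_(l < b1)
     X (mxtens_index (i, k)) (mxtens_index (j, l)) *:
       (M (delta_mx i j) *t N (delta_mx k l)).

Definition idtens (r : nat) {d1 d2} (M : 'M[C]_d1 -> 'M[C]_d2) :
  'M[C]_(r * d1) -> 'M[C]_(r * d2) := tensor_map (fun X : 'M[C]_r => X) M.
Arguments idtens r {d1 d2} M : rename.

Definition is_linear_map {d1 d2} (M : 'M[C]_d1 -> 'M[C]_d2) : Prop :=
  forall (c : C) (X Y : 'M[C]_d1), M (c *: X + Y) = c *: M X + M Y.

Definition compl_pos {d1 d2} (M : 'M[C]_d1 -> 'M[C]_d2) : Prop :=
  forall (r : nat) (X : 'M[C]_(r * d1)), psd X -> psd (idtens r M X).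

Definition trace_pres {d1 d2} (M : 'M[C]_d1 -> 'M[C]_d2) : Prop :=
  forall X : 'M[C]_d1, \tr (M X) = \tr X.

Definition channel {d1 d2} (M : 'M[C]_d1 -> 'M[C]_d2) : Prop :=
  [/\ is_linear_map M, compl_pos M & trace_pres M].

Definition chan_div (D : forall d, 'M[C]_d -> 'M[C]_d -> \bar R)
  {d1 d2} (M M' : 'M[C]_d1 -> 'M[C]_d2) : \bar R :=
  ereal_sup [set x | exists (r : nat) (rho : 'M[C]_(r * d1)),
     is_state rho /\ x = D _ (idtens r M rho) (idtens r M' rho)].

Definition pdist {d1 d2} (M1 M2 : 'M[C]_d1 -> 'M[C]_d2) : \bar R :=
  ereal_sup [set x | exists (r : nat) (rho : 'M[C]_(r * d1)),
     is_state rho /\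
     x = (Num.sqrt (1 - fidelity (idtens r M1 rho) (idtens r M2 rho)))%:E].

Definition replacer (d1 d2 : nat) : 'M[C]_d1 -> 'M[C]_d2 :=
  fun X => \tr X *: 1%:M.
Arguments replacer : clear implicits.

Definition ptr1 {a b} (Y : 'M[C]_(a * b)) : 'M[C]_b :=
  \matrix_(k, l) \sum_(i < a) Y (mxtens_index (i, k)) (mxtens_index (i, l)).

Definition cond_ent {a' b' a b} (N : 'M[C]_(a' * b') -> 'M[C]_(a * b)) : \bar R :=
  (- ereal_inf [set chan_div (@relent) N (tensor_map (replacer a' a) Q)
                | Q in [set Q : 'M[C]_b' -> 'M[C]_b | channel Q]])%E.

(** S^{not->}[A|B]_N = - D[N || R^1_{A->A} o N] *)
Definition cond_ent_ns {a' b' a b} (N : 'M[C]_(a' * b') -> 'M[C]_(a * b)) : \bar R :=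
  (- chan_div (@relent) N (fun X => (1%:M : 'M[C]_a) *t ptr1 (N X)))%E.

Definition smooth_minent (eps : R) {a' b' a b}
  (N : 'M[C]_(a' * b') -> 'M[C]_(a * b)) : \bar R :=
  (- ereal_inf [set x | exists (Q : 'M[C]_b' -> 'M[C]_b)
                       (Nt : 'M[C]_(a' * b') -> 'M[C]_(a * b)),
       [/\ channel Q, channel Nt, (pdist N Nt <= eps%:E)%E &
           x = chan_div (@dmax) Nt (tensor_map (replacer a' a) Q)]])%E.

Definition no_signaling {a' b' a b} (N : 'M[C]_(a' * b') -> 'M[C]_(a * b)) : Prop :=
  exists Q : 'M[C]_b' -> 'M[C]_b,
    channel Q /\ forall X : 'M[C]_(a' * b'), ptr1 (N X) = Q (ptr1 X).

Definition swap_mid (p q r s : nat) (k : 'I_((p * q) * (r * s))) : 'I_((p * r) * (q * s)) :=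
  let: (u, v) := mxtens_unindex k in
  let: (i, j) := mxtens_unindex u in
  let: (k', l) := mxtens_unindex v in
  mxtens_index (mxtens_index (i, k'), mxtens_index (j, l)).

Definition reidx {m n} (f : 'I_m -> 'I_n) (X : 'M[C]_n) : 'M[C]_m :=
  \matrix_(i, j) X (f i) (f j).

Definition btens {a1' b1' a1 b1 a2' b2' a2 b2}
  (N1 : 'M[C]_(a1' * b1') -> 'M[C]_(a1 * b1))
  (N2 : 'M[C]_(a2' * b2') -> 'M[C]_(a2 * b2)) :
  'M[C]_((a1' * a2') * (b1' * b2')) -> 'M[C]_((a1 * a2) * (b1 * b2)) :=
  fun X => reidx (@swap_mid a1 a2 b1 b2)
             (tensor_map N1 N2 (reidx (@swap_mid a1' b1' a2' b2') X)).

Fixpoint dpow (d n : nat) : nat := if n is n'.+1 then (d * dpow d n')%N else 1%N.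

Fixpoint bpow {a' b' a b} (N : 'M[C]_(a' * b') -> 'M[C]_(a * b)) (n : nat) :
  'M[C]_(dpow a' n * dpow b' n) -> 'M[C]_(dpow a n * dpow b n) :=
  match n return 'M[C]_(dpow a' n * dpow b' n) -> 'M[C]_(dpow a n * dpow b n) with
  | 0 => fun X => X
  | n'.+1 => btens N (@bpow a' b' a b N n')
  end.

Definition reg_minent (eps : R) {a' b' a b}
  (N : 'M[C]_(a' * b') -> 'M[C]_(a * b)) : nat -> \bar R :=
  fun n => (((n%:R)^-1 : R)%:E * smooth_minent eps (@bpow a' b' a b N n))%E.

Definition limsup_0plus (g : R -> \bar R) : \bar R :=
  ereal_inf [set ereal_sup [set g e | e in [set e : R | 0 < e < d]]
            | d in [set d : R | 0 < d]].

End QuantumInfo.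

Arguments bpow {R a' b' a b} N n _.

(* Main.v *)
Require Import Defs.
From HB Require Import structures.
From mathcomp Require Import all_boot all_order all_algebra.
From mathcomp Require Import all_classical all_reals.
From mathcomp Require Import ereal topology normedtype sequences exp.
From mathcomp Require Import complex mxtens.
From mathcomp Require Import perm cyclic separable cyclotomic.
From mathcomp Require Import ring lra.

Set Implicit Arguments.
Unset Strict Implicit.
Unset Printing Implicit Defensive.

Import Order.TTheory GRing.Theory Num.Theory.
Local Open Scope ring_scope.
Local Open Scope classical_set_scope.

(* Upper bounds.  Fix an input state, let w be the output on RAB and w_C its
   marginal on RB.  The test that first projects w_C^n onto eigenvalues at most
   e^(-n(S(w_C)-d)) and then w^n onto eigenvalues at least e^(-n(S(w)+d))
   accepts w^n with probability close to 1, while any state below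
   lam (1_A (x) xi) passes with probability at most lam e^(-n(S(w_C)-S(w)-2d));
   a channel close to N^n therefore needs log lam of order n(S(w_C) - S(w)),
   which is n times the relative entropy to the replaced output.
   For a no-signaling N the channel R o N is itself of the form R (x) Q.

   Lower bound.  Let V be a Stinespring isometry with outputs A, E, B.  Klein's
   inequality for purified inputs gives S(AE) - S(E) <= D[N || R (x) Q] =: D for
   every input.  Let w be the AE output of a universal permutation-invariant
   input state.  Sort the spectrum of w_E into bins of width e^(-nd), and inside
   the bin of eigenvalues near e^(-nxd) keep the part P of AE on which
   w >= e^(-n(D+4d+xd)).  The map X |-> tr_E (P V X V^* P) is then below
   (M+1) e^(n(D+4d)) (R o N^n) in the completely positive order, and it is close
   to N^n in fidelity as soon as 1 - V^* P V is small in operator norm.  That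
   operator commutes with permutations, so its norm is at most a polynomial times
   its expectations in i.i.d. states, which are exponentially small by Chernoff
   bounds and S(AE) - S(E) <= D.  The lost trace is returned as white noise. *)

(** * Matrices over an abstract complex field *)

(** A smoothed channel must be close to N^n on all inputs at once, entangled ones included, so
    typicality for one input state is not enough. Cutting on AE, away from the reference and from B,
    gives one operator that serves every reference; by purification S(AE) and S(E) are the entropies
    of RB and RAB, so S(AE) - S(E) <= D is the relative-entropy bound read on the environment side.
    A threshold on w alone would not do, since w has to be compared with 1_A (x) w_E, with which it
    need not commute: inside a bin w_E is nearly constant, and the number of bins does not grow with
    n, so that binning costs no rate. The bound for the universal input becomes an order of maps
    because that input has full rank, so that every other input can be filtered out of it. The
    channels Q in the infimum for S[A|B] need have no relation to N; such a Q yields only the number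
    D, while the smoothed channel is compared with the marginal channel of N, which exists by
    no-signaling. Entropies are in nats, and base 2 enters only where the channel quantities are
    evaluated. *)

Record cplx (R : realType) := Cplx {
  csort :> numClosedFieldType;
  rc : {rmorphism R -> csort};
  re : csort -> R;
  reD : {morph re : x y / x + y};
  rcK : cancel rc re;
  re_real : forall x : csort, x \is Num.real -> rc (re x) = x;
  reZ : forall a x, re (rc a * x) = a * re x;
  re_conj : forall x : csort, re (Num.conj x) = re x;
  rc_ge0 : forall a, (0 <= rc a) = (0 <= a) }.

Section Basics.
Context {R : realType} {K : cplx R}.
Local Notation rc := (rc K).

Lemma rc_inj : injective rc.
Proof. exact: can_inj (@rcK _ K). Qed.

Lemma rc_real (a : R) : rc a \is Num.real.
Proof. by rewrite realE -oppr_ge0 -rmorphN !rc_ge0 oppr_ge0; apply: le_total. Qed.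

Lemma conj_rc (a : R) : Num.conj (rc a) = rc a.
Proof. exact/CrealP/rc_real. Qed.

Lemma reN (x : K) : re (- x) = - re x.
Proof. by rewrite -[- x]mulN1r -(rmorphN1 rc) reZ mulN1r. Qed.

Lemma reB (x y : K) : re (x - y) = re x - re y.
Proof. by rewrite reD reN. Qed.

Lemma re0 : re (0 : K) = 0.
Proof. by rewrite -(rmorph0 rc) rcK. Qed.

Lemma re1 : re (1 : K) = 1.
Proof. by rewrite -(rmorph1 rc) rcK. Qed.

Lemma re_sum I (r : seq I) (P : pred I) (F : I -> K) :
  re (\sum_(i <- r | P i) F i) = \sum_(i <- r | P i) re (F i).
Proof. by apply: (big_morph _ (@reD _ K)); apply: re0. Qed.

Lemma re_ge0 (x : K) : 0 <= x -> 0 <= re x.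
Proof. by move=> x0; rewrite -(rc_ge0 K) re_real // ger0_real. Qed.

Lemma le_re (x y : K) : x <= y -> re x <= re y.
Proof. by rewrite -subr_ge0 => /re_ge0; rewrite reB subr_ge0. Qed.

Definition adjm {m n} (A : 'M[K]_(m, n)) : 'M[K]_(n, m) :=
  \matrix_(i, j) Num.conj (A j i).

Definition psdm {d} (A : 'M[K]_d) : Prop :=
  adjm A = A /\ forall v : 'cV[K]_d, 0 <= (adjm v *m A *m v) 0 0.

Definition lwle {d} (A B : 'M[K]_d) : Prop := psdm (B - A).

Definition unitm {d} (U : 'M[K]_d) : Prop := adjm U *m U = 1%:M.

Definition tre {d} (X : 'M[K]_d) : R := re (\tr X).

Lemma adjE m n (A : 'M[K]_(m, n)) i j : adjm A i j = Num.conj (A j i).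
Proof. by rewrite mxE. Qed.

Lemma adjK m n (A : 'M[K]_(m, n)) : adjm (adjm A) = A.
Proof. by apply/matrixP => i j; rewrite !adjE conjCK. Qed.

Lemma adjM m n p (A : 'M[K]_(m, n)) (B : 'M[K]_(n, p)) :
  adjm (A *m B) = adjm B *m adjm A.
Proof.
apply/matrixP => i j; rewrite adjE !mxE rmorph_sum; apply: eq_bigr => k _.
by rewrite rmorphM !adjE mulrC.
Qed.

Lemma adjD m n (A B : 'M[K]_(m, n)) : adjm (A + B) = adjm A + adjm B.
Proof. by apply/matrixP => i j; rewrite !(adjE, mxE) rmorphD. Qed.

Lemma adjN m n (A : 'M[K]_(m, n)) : adjm (- A) = - adjm A.
Proof. by apply/matrixP => i j; rewrite !(adjE, mxE) rmorphN. Qed.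

Lemma adjB m n (A B : 'M[K]_(m, n)) : adjm (A - B) = adjm A - adjm B.
Proof. by rewrite adjD adjN. Qed.

Lemma adjZ m n (c : K) (A : 'M[K]_(m, n)) : adjm (c *: A) = Num.conj c *: adjm A.
Proof. by apply/matrixP => i j; rewrite !(adjE, mxE) rmorphM. Qed.

Lemma adj0 m n : adjm (0 : 'M[K]_(m, n)) = 0.
Proof. by apply/matrixP => i j; rewrite !(adjE, mxE) rmorph0. Qed.

Lemma adj1 n : adjm (1%:M : 'M[K]_n) = 1%:M.
Proof. by apply/matrixP => i j; rewrite !(adjE, mxE) rmorph_nat eq_sym. Qed.

Lemma adj_sum m n I (r : seq I) (P : pred I) (F : I -> 'M[K]_(m, n)) :
  adjm (\sum_(i <- r | P i) F i) = \sum_(i <- r | P i) adjm (F i).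
Proof. by apply: (big_morph _ (@adjD m n)); apply: adj0. Qed.

Lemma adj_tens m n p q (A : 'M[K]_(m, n)) (B : 'M[K]_(p, q)) :
  adjm (A *t B) = adjm A *t adjm B.
Proof. by apply/matrixP => i j; rewrite !mxE rmorphM. Qed.

Lemma mxtrace_adj n (A : 'M[K]_n) : \tr (adjm A) = Num.conj (\tr A).
Proof. by rewrite /mxtrace rmorph_sum; apply: eq_bigr => i _; rewrite adjE. Qed.

Lemma psd_gram m n (A : 'M[K]_(m, n)) : psdm (adjm A *m A).
Proof.
split=> [|v]; first by rewrite adjM adjK.
rewrite mulmxA -adjM -mulmxA mxE sumr_ge0 // => i _.
by rewrite adjE mulrC mul_conjC_ge0.
Qed.

Lemma psd_gram' m n (A : 'M[K]_(m, n)) : psdm (A *m adjm A).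
Proof. by rewrite -{1}(adjK A); apply: psd_gram. Qed.

Lemma psd0 n : psdm (0 : 'M[K]_n).
Proof. by split=> [|v]; rewrite ?adj0 // mulmx0 mul0mx mxE. Qed.

Lemma psd1 n : psdm (1%:M : 'M[K]_n).
Proof. by have := psd_gram (1%:M : 'M[K]_n); rewrite mulmx1 adj1. Qed.

Lemma psdD n (A B : 'M[K]_n) : psdm A -> psdm B -> psdm (A + B).
Proof.
move=> [hA pA] [hB pB]; split=> [|v]; first by rewrite adjD hA hB.
by rewrite mulmxDr mulmxDl mxE addr_ge0.
Qed.

Lemma psdZ n (c : K) (A : 'M[K]_n) : 0 <= c -> psdm A -> psdm (c *: A).
Proof.
move=> c0 [hA pA]; split=> [|v].
  by rewrite adjZ hA; congr (_ *: _); apply/CrealP/ger0_real.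
by rewrite -scalemxAr -scalemxAl mxE mulr_ge0.
Qed.

Lemma psd_sum n I (r : seq I) (P : pred I) (F : I -> 'M[K]_n) :
  (forall i, P i -> psdm (F i)) -> psdm (\sum_(i <- r | P i) F i).
Proof. by move=> h; elim/big_ind: _ => //; [apply: psd0 | move=> *; apply: psdD]. Qed.

Lemma psd_conj m n (A : 'M[K]_n) (B : 'M[K]_(m, n)) :
  psdm A -> psdm (B *m A *m adjm B).
Proof.
move=> [hA pA]; split=> [|v]; first by rewrite !adjM adjK hA mulmxA.
by have := pA (adjm B *m v); rewrite adjM adjK !mulmxA.
Qed.

Lemma psd_conj' m n (A : 'M[K]_n) (B : 'M[K]_(n, m)) :
  psdm A -> psdm (adjm B *m A *m B).
Proof. by move=> /(psd_conj (adjm B)); rewrite adjK. Qed.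

Lemma psd_tr m n (A : 'M[K]_n) (B : 'M[K]_(n, m)) :
  psdm A -> 0 <= \tr (adjm B *m A *m B).
Proof.
move=> [_ pA]; rewrite /mxtrace sumr_ge0 // => i _.
have := pA (col i B); congr (0 <= _).
rewrite !mxE; apply: eq_bigr => k _; rewrite [col _ _ _ _]mxE; congr (_ * _).
by rewrite !mxE; apply: eq_bigr => l _; rewrite !mxE.
Qed.

Lemma psd_tr_ge0 n (A : 'M[K]_n) : psdm A -> 0 <= \tr A.
Proof. by move/(psd_tr 1%:M); rewrite adj1 mul1mx mulmx1. Qed.

Lemma psd_le_trans n (A B D : 'M[K]_n) :
  lwle A B -> lwle B D -> lwle A D.
Proof. by move=> h1 h2; rewrite /lwle -(subrKA B); apply: psdD. Qed.

Lemma trRD n (A B : 'M[K]_n) : tre (A + B) = tre A + tre B.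
Proof. by rewrite /tre mxtraceD reD. Qed.

Lemma trRN n (A : 'M[K]_n) : tre (- A) = - tre A.
Proof. by rewrite /tre -reN raddfN. Qed.

Lemma trRB n (A B : 'M[K]_n) : tre (A - B) = tre A - tre B.
Proof. by rewrite trRD trRN. Qed.

Lemma trRZ n (c : R) (A : 'M[K]_n) : tre (rc c *: A) = c * tre A.
Proof. by rewrite /tre mxtraceZ reZ. Qed.

Lemma trR_sum n I (r : seq I) (P : pred I) (F : I -> 'M[K]_n) :
  tre (\sum_(i <- r | P i) F i) = \sum_(i <- r | P i) tre (F i).
Proof. by rewrite /tre -re_sum; congr re; apply: raddf_sum. Qed.

Lemma trRC m n (A : 'M[K]_(m, n)) (B : 'M[K]_(n, m)) : tre (A *m B) = tre (B *m A).
Proof. by rewrite /tre mxtrace_mulC. Qed.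

Lemma trR_adj n (A : 'M[K]_n) : tre (adjm A) = tre A.
Proof. by rewrite /tre mxtrace_adj re_conj. Qed.

Lemma psd_trR n (A : 'M[K]_n) : psdm A -> 0 <= tre A.
Proof. by move=> /psd_tr_ge0 /re_ge0. Qed.

Definition rdiag n (d : 'I_n -> R) : 'M[K]_n := diag_mx (\row_i rc (d i)).

Lemma rdiagE n (d : 'I_n -> R) i j : rdiag d i j = rc (d i) *+ (i == j).
Proof. by rewrite !mxE. Qed.

Lemma adj_rdiag n (d : 'I_n -> R) : adjm (rdiag d) = rdiag d.
Proof.
apply/matrixP => i j; rewrite adjE !rdiagE eq_sym.
by case: eqVneq => [->|]; rewrite ?mulr1n ?conj_rc // mulr0n rmorph0.
Qed.

Lemma mul_rdiag_mx n m (d : 'I_n -> R) (A : 'M[K]_(n, m)) i j :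
  (rdiag d *m A) i j = rc (d i) * A i j.
Proof. by rewrite /rdiag mul_diag_mx !mxE. Qed.

Lemma mul_mx_rdiag n m (d : 'I_n -> R) (A : 'M[K]_(m, n)) i j :
  (A *m rdiag d) i j = A i j * rc (d j).
Proof. by rewrite /rdiag mul_mx_diag !mxE. Qed.

Lemma rdiagM n (d e : 'I_n -> R) : rdiag d *m rdiag e = rdiag (fun i => d i * e i).
Proof.
apply/matrixP => i j; rewrite mul_rdiag_mx !rdiagE.
by rewrite mulrnAr -rmorphM.
Qed.

Lemma rdiagD n (d e : 'I_n -> R) : rdiag d + rdiag e = rdiag (fun i => d i + e i).
Proof. by apply/matrixP => i j; rewrite [LHS]mxE !rdiagE -mulrnDl rmorphD. Qed.

Lemma rdiag1 n : rdiag (fun _ : 'I_n => 1) = 1%:M.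
Proof. by apply/matrixP => i j; rewrite rdiagE mxE rmorph1. Qed.

Lemma eq_rdiag n (d e : 'I_n -> R) : d =1 e -> rdiag d = rdiag e.
Proof. by move=> h; congr rdiag; apply/funext. Qed.

Lemma tr_rdiag n (d : 'I_n -> R) : \tr (rdiag d) = rc (\sum_i d i).
Proof. by rewrite /mxtrace rmorph_sum; apply: eq_bigr => i _; rewrite rdiagE eqxx. Qed.

Lemma psd_rdiag n (d : 'I_n -> R) : (forall i, 0 <= d i) -> psdm (rdiag d).
Proof.
move=> d0; have -> : rdiag d = adjm (rdiag (fun i => Num.sqrt (d i))) *m
    rdiag (fun i => Num.sqrt (d i)).
  rewrite adj_rdiag rdiagM; apply: eq_rdiag => i.
  by rewrite -expr2 sqr_sqrtr.
exact: psd_gram.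
Qed.

Lemma psd_rdiagE n (d : 'I_n -> R) i : psdm (rdiag d) -> 0 <= d i.
Proof.
move=> [_ /(_ (delta_mx i 0))]; have -> : adjm (delta_mx i 0 : 'cV[K]_n) = delta_mx 0 i.
  by apply/matrixP => k l; rewrite adjE !mxE rmorph_nat andbC.
by rewrite -rowE -colE !mxE eqxx mulr1n rc_ge0.
Qed.

Section Unitary.
Variables (n : nat) (U : 'M[K]_n).
Hypothesis uU : unitm U.

Lemma unitaryV : U *m adjm U = 1%:M.
Proof. exact: mulmx1C. Qed.

Lemma unitaryK m (A : 'M[K]_(m, n)) : A *m U *m adjm U = A.
Proof. by rewrite -mulmxA unitaryV mulmx1. Qed.

Lemma unitaryVK m (A : 'M[K]_(m, n)) : A *m adjm U *m U = A.
Proof. by rewrite -mulmxA uU mulmx1. Qed.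

End Unitary.

Definition spec n (A U : 'M[K]_n) (d : 'I_n -> R) :=
  unitm U /\ A = U *m rdiag d *m adjm U.

Lemma spec_exists n (A : 'M[K]_n) : adjm A = A -> exists U d, spec A U d.
Proof.
move=> hA; have hh : A \is hermsymmx.
  apply/is_hermitianmxP; rewrite expr0 scale1r -{1}hA.
  by apply/matrixP => i j; rewrite !mxE.
have /orthomx_spectralP eA := hermitian_normalmx hh.
have /mxOverP rd := hermitian_spectral_diag_real hh.
have uP := spectral_unitarymx A.
have adjP : invmx (spectralmx A) = adjm (spectralmx A).
  by rewrite invmx_unitary //; apply/matrixP => i j; rewrite !mxE.
exists (adjm (spectralmx A)), (fun i => re (spectral_diag A 0 i)); split.
  by rewrite /unitm adjK -adjP mulmxV // spectral_unit.
rewrite adjK {1}eA adjP; congr (_ *m _ *m _); congr diag_mx; apply/rowP => i.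
by rewrite !mxE re_real // rd.
Qed.

Lemma spec_herm n (A U : 'M[K]_n) d : spec A U d -> adjm A = A.
Proof. by move=> [_ ->]; rewrite !adjM adjK adj_rdiag mulmxA. Qed.

Definition feig n (A : 'M[K]_n) :=
  let Ul := xget (1%:M, 0 : 'rV[R]_n) [set Ul : 'M[K]_n * 'rV[R]_n | spec A Ul.1 (Ul.2 0)] in
  (Ul.1, Ul.2 0).

Lemma feig_spec n (A : 'M[K]_n) : adjm A = A -> spec A (feig A).1 (feig A).2.
Proof.
move=> /spec_exists [U [d sA]].
have : spec A U ((\row_i d i : 'rV[R]_n) 0).
  by move: sA; congr spec; apply/funext => i; rewrite mxE.
by rewrite /feig; case: xgetP => [[V e] -> h _|h /(h (U, _))].
Qed.

End Basics.

(** Locked, so that rewriting never unfolds the chosen eigenbasis. *)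
HB.lock Definition fcalc {R : realType} {K : cplx R} {n} (f : R -> R) (A : 'M[K]_n) :
  'M[K]_n := (feig A).1 *m rdiag (fun i => f ((feig A).2 i)) *m adjm (feig A).1.

Section FunctionalCalculus.
Context {R : realType} {K : cplx R}.
Local Notation rc := (rc K).

Lemma fcalcE n (A : 'M[K]_n) f :
  fcalc f A = (feig A).1 *m rdiag (fun i => f ((feig A).2 i)) *m adjm (feig A).1.
Proof. by rewrite fcalc.unlock. Qed.

(* The entry (i, j) of [adjm U *m B *m V] can be nonzero only if the i-th
   eigenvalue of A equals the j-th eigenvalue of A'. *)
Lemma spec_intertwine m n (A U : 'M[K]_m) d (A' V : 'M[K]_n) e (B : 'M[K]_(m, n)) f :
  spec A U d -> spec A' V e -> A *m B = B *m A' ->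
  U *m rdiag (fun i => f (d i)) *m adjm U *m B =
  B *m (V *m rdiag (fun i => f (e i)) *m adjm V).
Proof.
move=> [uU eA] [uV eA'] AB.
pose X := adjm U *m B *m V.
have hX : rdiag d *m X = X *m rdiag e.
  have e1 : rdiag d *m adjm U = adjm U *m A by rewrite eA !mulmxA uU mul1mx.
  have e2 : V *m rdiag e = A' *m V by rewrite eA' unitaryVK.
  by rewrite /X -[in RHS]mulmxA e2 !mulmxA e1 -[adjm U *m A *m B]mulmxA AB !mulmxA.
have fX : rdiag (fun i => f (d i)) *m X = X *m rdiag (fun i => f (e i)).
  apply/matrixP => i j; move/matrixP: hX => /(_ i j).
  rewrite !(mul_rdiag_mx, mul_mx_rdiag) ![X i j * _]mulrC => /eqP.
  rewrite -subr_eq0 -mulrBl mulf_eq0 => /orP[|/eqP->]; last by rewrite !mulr0.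
  by rewrite subr_eq0 => /eqP/rc_inj ->.
have -> : B = U *m X *m adjm V by rewrite /X !mulmxA unitaryV // mul1mx unitaryK.
rewrite !mulmxA unitaryVK // [RHS](_ : _ = U *m (X *m rdiag (fun i => f (e i))) *m adjm V).
  by rewrite -fX !mulmxA.
by rewrite !mulmxA unitaryVK.
Qed.

(** The identity as intertwiner shows that the result does not depend on the eigenbasis chosen by
    [feig]. *)
Lemma fcalc_spec n (A U : 'M[K]_n) d f :
  spec A U d -> fcalc f A = U *m rdiag (fun i => f (d i)) *m adjm U.
Proof.
move=> sA; have := spec_intertwine f (feig_spec (spec_herm sA)) sA.
by move=> /(_ 1%:M); rewrite !mulmx1 !mul1mx fcalcE; apply.
Qed.

Lemma fcalc_intertwine m n (A : 'M[K]_m) (A' : 'M[K]_n) (B : 'M[K]_(m, n)) f :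
  adjm A = A -> adjm A' = A' -> A *m B = B *m A' ->
  fcalc f A *m B = B *m fcalc f A'.
Proof.
by move=> hA hA'; rewrite !fcalcE; apply: spec_intertwine; apply: feig_spec.
Qed.

Lemma fcalc_id n (A : 'M[K]_n) : adjm A = A -> fcalc id A = A.
Proof. by move=> hA; rewrite fcalcE; case: (feig_spec hA). Qed.

Lemma fcalc_cst n (A : 'M[K]_n) : adjm A = A -> fcalc (fun=> 1) A = 1%:M.
Proof.
by move=> /feig_spec[u _]; rewrite fcalcE rdiag1 mulmx1 unitaryV.
Qed.

Lemma fcalc_adj n (A : 'M[K]_n) f : adjm (fcalc f A) = fcalc f A.
Proof. by rewrite !fcalcE !adjM adjK adj_rdiag mulmxA. Qed.

Lemma fcalcM n (A : 'M[K]_n) f g : adjm A = A ->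
  fcalc f A *m fcalc g A = fcalc (fun x => f x * g x) A.
Proof.
move=> /feig_spec[u _]; rewrite !fcalcE.
by rewrite !mulmxA unitaryVK // -[_ *m rdiag _ *m rdiag _]mulmxA rdiagM.
Qed.

Lemma fcalcD n (A : 'M[K]_n) f g :
  fcalc f A + fcalc g A = fcalc (fun x => f x + g x) A.
Proof. by rewrite !fcalcE -mulmxDl -mulmxDr rdiagD. Qed.

Lemma fcalcZ n (A : 'M[K]_n) f c : rc c *: fcalc f A = fcalc (fun x => c * f x) A.
Proof.
rewrite !fcalcE scalemxAl scalemxAr; congr (_ *m _ *m _).
by apply/matrixP => i j; rewrite mxE !rdiagE mulrnAr -rmorphM.
Qed.

Lemma fcalc_comm n (A B : 'M[K]_n) f : adjm A = A -> A *m B = B *m A ->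
  fcalc f A *m B = B *m fcalc f A.
Proof. by move=> hA; apply: fcalc_intertwine. Qed.

Lemma trR_spec n (A U : 'M[K]_n) d f :
  spec A U d -> tre (fcalc f A) = \sum_i f (d i).
Proof.
move=> sA; rewrite (fcalc_spec _ sA) trRC mulmxA.
by have [u _] := sA; rewrite u mul1mx /tre tr_rdiag rcK.
Qed.

Lemma spec_ge0 n (A U : 'M[K]_n) d i : psdm A -> spec A U d -> 0 <= d i.
Proof.
move=> pA [u eA]; apply: (@psd_rdiagE _ K); have := psd_conj' U pA.
by rewrite eA !mulmxA u mul1mx unitaryVK.
Qed.

Lemma eq_fcalc n (A : 'M[K]_n) f g : psdm A ->
  (forall x, 0 <= x -> f x = g x) -> fcalc f A = fcalc g A.
Proof.
move=> pA fg; rewrite !fcalcE; congr (_ *m _ *m _); apply: eq_rdiag => i.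
by apply: fg; apply: spec_ge0 (feig_spec _) => //; case: pA.
Qed.

Lemma fcalc_psd n (A : 'M[K]_n) f : psdm A ->
  (forall x, 0 <= x -> 0 <= f x) -> psdm (fcalc f A).
Proof.
move=> pA f0; rewrite fcalcE; apply/psd_conj/psd_rdiag => i; apply: f0.
by apply: spec_ge0 (feig_spec _) => //; case: pA.
Qed.

Lemma fcalc_le n (A : 'M[K]_n) f g : psdm A ->
  (forall x, 0 <= x -> f x <= g x) -> lwle (fcalc f A) (fcalc g A).
Proof.
move=> pA fg; rewrite /lwle.
have -> : - fcalc f A = fcalc (fun x => -1 * f x) A.
  by rewrite -fcalcZ rmorphN1 scaleN1r.
by rewrite fcalcD; apply: fcalc_psd => // x x0; rewrite mulN1r subr_ge0 fg.
Qed.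

Lemma psd_factor n (A : 'M[K]_n) : psdm A -> exists G : 'M[K]_n, A = G *m adjm G.
Proof.
move=> pA; exists (fcalc Num.sqrt A); rewrite fcalc_adj fcalcM; last by case: pA.
rewrite -{1}[A]fcalc_id; last by case: pA.
by apply: eq_fcalc => // x x0; rewrite -expr2 sqr_sqrtr.
Qed.

Lemma psd_trM n (A B : 'M[K]_n) : psdm A -> psdm B -> 0 <= \tr (A *m B).
Proof.
move=> pA /psd_factor[G ->]; rewrite mulmxA mxtrace_mulC mulmxA.
exact: psd_tr.
Qed.

Lemma psd_trRM n (A B : 'M[K]_n) : psdm A -> psdm B -> 0 <= tre (A *m B).
Proof. by move=> pA pB; apply: re_ge0; apply: psd_trM. Qed.

Lemma le_trRM n (A B D : 'M[K]_n) : psdm A -> lwle B D ->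
  tre (A *m B) <= tre (A *m D).
Proof. by move=> pA BD; rewrite -subr_ge0 -trRB -mulmxBr psd_trRM. Qed.

Lemma psd_ker n (A : 'M[K]_n) (v : 'cV[K]_n) : psdm A ->
  (adjm v *m A *m v) 0 0 = 0 -> A *m v = 0.
Proof.
move=> /psd_factor[G ->]; rewrite mulmxA -mulmxA.
rewrite -[adjm v *m G]adjK adjM adjK mxE => h.
suff -> : G *m adjm G *m v = 0 by [].
rewrite -mulmxA; suff -> : adjm G *m v = 0 by rewrite mulmx0.
apply/matrixP => i j; rewrite ord1 {j}.
have h0 k : true -> 0 <= adjm (adjm G *m v) 0 k * (adjm G *m v) k 0.
  by move=> _; rewrite adjE mulrC mul_conjC_ge0.
have /eqP := psumr_eq0P h0 h (erefl : xpredT i).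
by rewrite adjE mulrC mul_conjC_eq0 [RHS]mxE => /eqP.
Qed.

Lemma unitary_normal_form n (A : 'M[K]_n) : psdm A ->
  exists U d, spec A U d /\ forall i, 0 <= d i.
Proof.
move=> pA; have [U [d s]] := spec_exists (proj1 pA).
by exists U, d; split=> // i; apply: spec_ge0 s.
Qed.

End FunctionalCalculus.

(** * Fidelity and entropy *)

Section Fidelity.
Context {R : realType} {K : cplx R}.
Local Notation rc := (rc K).

Lemma quad_discr (a b s : R) : 0 <= a -> 0 <= b ->
  (forall t, 0 <= b - 2 * t * s + t ^+ 2 * a) -> s <= Num.sqrt a * Num.sqrt b.
Proof.
move=> a0 b0 h; have h2 : s ^+ 2 <= a * b.
  have [a_gt0|] := ltP 0 a.
    have := h (s / a); rewrite -(pmulr_rge0 _ a_gt0).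
    have -> : a * (b - 2 * (s / a) * s + (s / a) ^+ 2 * a) = a * b - s ^+ 2.
      by field; rewrite gt_eqF.
    by rewrite subr_ge0.
  move=> a_le0; have a_0 : a = 0 by apply/le_anti; rewrite a_le0 a0.
  rewrite a_0 in h *; rewrite mul0r; have [->|s0] := eqVneq s 0; first by rewrite expr0n.
  (* With [a = 0] the form is affine in [t]; this [t] makes it equal to -1, so a nonzero [s] is
     impossible. *)
  have := h ((b + 1) / s / 2); suff -> : b - 2 * ((b + 1) / s / 2) * s + ((b + 1) / s / 2) ^+ 2 * 0 = -1.
    by rewrite ler0N1.
  by field.
rewrite -sqrtrM //; apply: le_trans (ler_norm s) _.
by rewrite -sqrtr_sqr ler_sqrt // mulr_ge0.
Qed.

Lemma trR_CS m n (A : 'M[K]_(m, n)) (B : 'M[K]_(n, m)) :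
  tre (A *m B) <= Num.sqrt (tre (A *m adjm A)) * Num.sqrt (tre (adjm B *m B)).
Proof.
apply: quad_discr; try by apply/psd_trR/psd_gram'; try by apply/psd_trR/psd_gram.
  by apply/psd_trR/psd_gram.
move=> t; have := psd_trR (psd_gram (B - rc t *: adjm A)).
rewrite adjB adjZ adjK conj_rc mulmxBl !mulmxBr -!scalemxAl -!scalemxAr scalerA.
have : tre (A *m B) = tre (adjm B *m adjm A) by rewrite -adjM trR_adj.
move: (adjm B *m B) (adjm B *m adjm A) (A *m B) (A *m adjm A) => X Y Z W e.
have -> : tre (X - rc t *: Y - (rc t *: Z - (rc t * rc t) *: W)) =
    tre X - t * tre Y - (t * tre Z - t * (t * tre W)).
  by rewrite -scalerA; move: (rc t *: W) (trRZ t W) => W' <-; rewrite 3!trRB !trRZ.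
by rewrite e; congr (0 <= _); ring.
Qed.

Lemma trR_CS_psd m n (A : 'M[K]_(m, n)) (T : 'M[K]_n) (B : 'M[K]_(n, m)) : psdm T ->
  tre (A *m T *m B) <= Num.sqrt (tre (A *m T *m adjm A)) * Num.sqrt (tre (adjm B *m T *m B)).
Proof.
move=> /psd_factor[G ->]; have := trR_CS (A *m G) (adjm G *m B).
by rewrite !adjM !adjK !mulmxA.
Qed.

Lemma loewner_quad n (A B : 'M[K]_n) (v : 'cV[K]_n) : lwle A B ->
  re ((adjm v *m A *m v) 0 0) <= re ((adjm v *m B *m v) 0 0).
Proof.
move=> [_ /(_ v)]; rewrite mulmxBr mulmxBl [X in 0 <= X]mxE [X in _ + X]mxE subr_ge0.
exact: le_re.
Qed.

Lemma loewner_conj m n (A B : 'M[K]_n) (D : 'M[K]_(m, n)) : lwle A B ->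
  lwle (D *m A *m adjm D) (D *m B *m adjm D).
Proof. by rewrite /lwle -mulmxBl -mulmxBr; apply: psd_conj. Qed.

Lemma loewner_conj' m n (A B : 'M[K]_n) (D : 'M[K]_(n, m)) : lwle A B ->
  lwle (adjm D *m A *m D) (adjm D *m B *m D).
Proof. by move=> /(loewner_conj (adjm D)); rewrite adjK. Qed.

Lemma loewner_tr n (A B : 'M[K]_n) : lwle A B -> tre A <= tre B.
Proof. by move=> /psd_trR; rewrite trRB subr_ge0. Qed.

Lemma loewner_diag n (A B : 'M[K]_n) i : lwle A B ->
  re (A i i) <= re (B i i).
Proof.
move=> /(loewner_quad (delta_mx i 0)).
have -> : adjm (delta_mx i 0 : 'cV[K]_n) = delta_mx 0 i.
  by apply/matrixP => k l; rewrite adjE !mxE rmorph_nat andbC.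
by rewrite -!rowE -!colE !mxE.
Qed.

Lemma proj_le1 n (P : 'M[K]_n) : adjm P = P -> P *m P = P -> lwle P 1%:M.
Proof.
move=> hP iP; have := psd_gram (1%:M - P).
by rewrite adjB adj1 hP mulmxBl mul1mx mulmxBr mulmx1 iP subrr subr0.
Qed.

Definition tnorm n (X : 'M[K]_n) : R := tre (fcalc Num.sqrt (adjm X *m X)).

Lemma trnormE n (X W : 'M[K]_n) d : spec (adjm X *m X) W d ->
  tnorm X = \sum_i Num.sqrt (d i).
Proof. by move=> s; rewrite /tnorm (trR_spec _ s). Qed.

Lemma trnorm_ge0 n (X : 'M[K]_n) : 0 <= tnorm X.
Proof.
have [W [d [s _]]] := unitary_normal_form (psd_gram X).
by rewrite (trnormE s) sumr_ge0 // => i _; rewrite sqrtr_ge0.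
Qed.

Lemma row_gram m n (A : 'M[K]_(m, n)) i :
  (row i A *m adjm (row i A)) 0 0 = (A *m adjm A) i i.
Proof. by rewrite mxE [RHS]mxE; apply: eq_bigr => j _; rewrite !adjE ![row _ _ _ _]mxE. Qed.

(** In the right singular basis [W] of [X] the trace splits into products of a row of [W^* Q] with
    the image of a column of [X W] under [P^*]; contractivity bounds the two norms by 1 and by a
    singular value. Rectangular [P] and [Q] allow Gram factors with any number of columns. *)
Lemma trnorm_ub n k (X : 'M[K]_n) (P Q : 'M[K]_(n, k)) :
  lwle (P *m adjm P) 1%:M -> lwle (Q *m adjm Q) 1%:M ->
  tre (adjm P *m X *m Q) <= tnorm X.
Proof.
move=> cP cQ; have [W [d [s d0]]] := unitary_normal_form (psd_gram X).
rewrite (trnormE s); have [uW eX] := s.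
have eY : adjm (X *m W) *m (X *m W) = rdiag d.
  by rewrite adjM !mulmxA -[_ *m X]mulmxA eX !mulmxA uW mul1mx unitaryVK.
have -> : tre (adjm P *m X *m Q) = \sum_i
    tre (row i (adjm W *m Q) *m (adjm P *m col i (X *m W))).
  transitivity (tre ((adjm P *m (X *m W)) *m (adjm W *m Q))).
    by rewrite !mulmxA unitaryK.
  rewrite trRC [in LHS]/tre /mxtrace re_sum; apply: eq_bigr => i _.
  rewrite /tre /mxtrace big_ord1; congr re.
  rewrite mxE [RHS]mxE; apply: eq_bigr => j _; rewrite [in RHS]mxE; congr (_ * _).
  by rewrite mxE [RHS]mxE; apply: eq_bigr => l _; rewrite [col _ _ _ _]mxE.
apply: ler_sum => i _; apply: le_trans (trR_CS _ _) _.
rewrite -[X in _ <= X]mul1r; apply: ler_pM; rewrite ?sqrtr_ge0 //.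
  rewrite -(@sqrtr1 R) ler_sqrt //.
  rewrite /tre /mxtrace big_ord1.
  have -> : (row i (adjm W *m Q) *m adjm (row i (adjm W *m Q))) 0 0 =
      (adjm W *m (Q *m adjm Q) *m W) i i.
    transitivity ((adjm W *m Q *m adjm (adjm W *m Q)) i i); last by rewrite adjM adjK !mulmxA.
    exact: row_gram.
  have := loewner_diag i (loewner_conj' W cQ).
  by rewrite mulmx1 uW [1%:M i i]mxE eqxx re1.
rewrite ler_sqrt //.
rewrite /tre /mxtrace big_ord1 adjM adjK !mulmxA.
have /le_trans := loewner_quad (col i (X *m W)) cP.
rewrite !mulmxA; apply; rewrite mulmx1.
have -> : d i = re ((adjm (X *m W) *m (X *m W)) i i) by rewrite eY rdiagE eqxx rcK.
rewrite [X in _ <= X](_ : _ = re ((adjm (col i (X *m W)) *m col i (X *m W)) 0 0)) //.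
by congr re; rewrite mxE [RHS]mxE; apply: eq_bigr => j _; rewrite !adjE ![col _ _ _ _]mxE.
Qed.

(** The witness is the adjoint of the polar part of [X]. As the inverse of 0 is 0, it is only a
    partial isometry, hence a contraction instead of a unitary. *)
Lemma trnorm_attained n (X : 'M[K]_n) :
  exists U : 'M[K]_n, lwle (adjm U *m U) 1%:M /\ tre (U *m X) = tnorm X.
Proof.
have [W [d [s d0]]] := unitary_normal_form (psd_gram X).
rewrite (trnormE s); have [uW eX] := s.
have eY : adjm (X *m W) *m (X *m W) = rdiag d.
  by rewrite adjM !mulmxA -[_ *m X]mulmxA eX !mulmxA uW mul1mx unitaryVK.
pose e i := (Num.sqrt (d i))^-1.
have ed i : e i * e i * d i * (e i * e i) = e i * e i.
  rewrite /e; have [->|di] := eqVneq (d i) 0; first by rewrite sqrtr0 invr0 !mulr0.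
  rewrite -{3}[d i]sqr_sqrtr //; have : Num.sqrt (d i) != 0.
    by rewrite sqrtr_eq0 -ltNge lt_neqAle eq_sym di d0.
  by move=> h; field.
exists (W *m rdiag e *m adjm (X *m W)); split.
  move: (X *m W) eY => Y eY; rewrite !adjM adjK adj_rdiag !mulmxA unitaryVK //.
  rewrite -[_ *m rdiag e *m rdiag e]mulmxA rdiagM.
  apply: proj_le1; first by rewrite !adjM adjK adj_rdiag mulmxA.
  rewrite !mulmxA -[_ *m adjm Y *m Y]mulmxA eY.
  rewrite -[Y *m _ *m rdiag d]mulmxA rdiagM -[Y *m _ *m rdiag _]mulmxA rdiagM.
  by congr (_ *m _ *m _); apply: eq_rdiag => i.
rewrite trRC !mulmxA trRC mulmxA [X in tre X](_ : _ = rdiag d *m rdiag e); last first.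
  by rewrite -eY !mulmxA.
rewrite rdiagM /tre tr_rdiag rcK; apply: eq_bigr => i _; rewrite /e.
have [->|di] := eqVneq (d i) 0; first by rewrite sqrtr0 mul0r.
rewrite -{1}[d i]sqr_sqrtr // expr2 mulfK //.
by rewrite sqrtr_eq0 -ltNge lt_neqAle eq_sym di d0.
Qed.

Definition sqf n (rho sigma : 'M[K]_n) :=
  tnorm (fcalc Num.sqrt rho *m fcalc Num.sqrt sigma).

Lemma fun_sqrtM n (A : 'M[K]_n) : psdm A -> fcalc Num.sqrt A *m fcalc Num.sqrt A = A.
Proof.
move=> pA; have hA := proj1 pA; rewrite fcalcM // -[RHS]fcalc_id //.
by apply: eq_fcalc => // x x0; rewrite -expr2 sqr_sqrtr.
Qed.

Lemma trR_cycle n (a b c d e : 'M[K]_n) :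
  tre (a *m b *m c *m (d *m e)) = tre (b *m c *m d *m (e *m a)).
Proof. by rewrite -!mulmxA trRC -!mulmxA. Qed.

(** Data processing for a two-outcome test: [T + (1 - T)] is inserted between the square roots, and
    Cauchy-Schwarz with the operator attaining the trace norm bounds each summand by the geometric
    mean of the outcome probabilities. *)
Lemma sqf_test n (rho sigma T : 'M[K]_n) : psdm rho -> psdm sigma -> psdm T ->
  lwle T 1%:M ->
  sqf rho sigma <=
  Num.sqrt (tre (T *m rho)) * Num.sqrt (tre (T *m sigma)) +
  Num.sqrt (tre ((1%:M - T) *m rho)) * Num.sqrt (tre ((1%:M - T) *m sigma)).
Proof.
move=> pr ps pT T1; rewrite /sqf.
set r := fcalc Num.sqrt rho; set s := fcalc Num.sqrt sigma.
have [U [cU <-]] := trnorm_attained (r *m s).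
have -> : U *m (r *m s) = (U *m r) *m T *m s + (U *m r) *m (1%:M - T) *m s.
  by rewrite -mulmxDl -mulmxDr addrC subrK mulmx1 mulmxA.
have key (S : 'M[K]_n) : psdm S -> tre ((U *m r) *m S *m s) <=
    Num.sqrt (tre (S *m rho)) * Num.sqrt (tre (S *m sigma)).
  move=> pS; apply: le_trans (trR_CS_psd _ _ pS) _.
  apply: ler_pM; rewrite ?sqrtr_ge0 //; last first.
    rewrite /s fcalc_adj ler_sqrt; last by apply: psd_trRM.
    by rewrite trRC mulmxA fun_sqrtM // trRC.
  rewrite ler_sqrt; last by apply: psd_trRM.
  rewrite -(fun_sqrtM pr) -/r [X in _ <= X]trRC.
  rewrite [X in X <= _](_ : _ = tre ((r *m S *m r) *m (adjm U *m U))); last first.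
    by rewrite adjM fcalc_adj -/r trR_cycle.
  apply: le_trans (le_trRM _ cU) _.
    by have := psd_conj r pS; rewrite fcalc_adj.
  by rewrite mulmx1 -[r *m r *m S]mulmxA [X in _ <= X]trRC.
by rewrite trRD lerD // key.
Qed.

(** [P] is [rho^(-1/2) A], the inverse being taken on the support of [rho]. *)
Lemma gram_polar n k (rho : 'M[K]_n) (A : 'M[K]_(n, k)) : rho = A *m adjm A ->
  exists P, A = fcalc Num.sqrt rho *m P /\ lwle (P *m adjm P) 1%:M.
Proof.
move=> e; have pr : psdm rho by rewrite e; apply: psd_gram'.
have hr := proj1 pr.
exists (fcalc (fun x => (Num.sqrt x)^-1) rho *m A); split; last first.
  rewrite adjM fcalc_adj !mulmxA -[_ *m A *m adjm A]mulmxA -e.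
  rewrite -{2}[rho]fcalc_id // !fcalcM // -(fcalc_cst hr); apply: fcalc_le => // x x0.
  have [->|x1] := eqVneq x 0; first by rewrite sqrtr0 invr0 mul0r mul0r.
  have xs : Num.sqrt x != 0 by rewrite sqrtr_eq0 -ltNge lt_neqAle eq_sym x1 x0.
  by rewrite -{2}[x]sqr_sqrtr // expr2 mulrA mulVf // mul1r divff.
rewrite mulmxA fcalcM //.
set f := fun x => _; pose g (x : R) := (1 : R) + (-1) * f x.
(* On nonnegative arguments [g] is the indicator of 0, so that [g(rho)] projects onto the kernel of
   [rho]; it kills [A] because it kills [A A^*]. *)
have gA : fcalc g rho *m A = 0.
  have h : fcalc g rho *m A *m adjm (fcalc g rho *m A) = 0.
    rewrite adjM fcalc_adj !mulmxA -[_ *m A *m adjm A]mulmxA -e.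
    rewrite -{2}[rho]fcalc_id // !fcalcM // (@eq_fcalc _ _ _ _ _ (fun=> 0 * 1)) //.
      by rewrite -fcalcZ rmorph0 scale0r.
    move=> x x0; rewrite /g /f mul0r.
    have [->|x1] := eqVneq x 0; first by rewrite mulr0 mul0r.
    have xs : Num.sqrt x != 0 by rewrite sqrtr_eq0 -ltNge lt_neqAle eq_sym x1 x0.
    by rewrite divff // mulr1 subrr !mul0r.
  apply/matrixP => i j; move/matrixP: h => /(_ i i); rewrite mxE [RHS]mxE => h.
  have h0 l : true -> 0 <= (fcalc g rho *m A) i l * adjm (fcalc g rho *m A) l i.
    by move=> _; rewrite adjE mul_conjC_ge0.
  have /eqP := psumr_eq0P h0 h (erefl : xpredT j).
  by rewrite adjE mul_conjC_eq0 [RHS]mxE => /eqP.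
have e1 : fcalc g rho = 1%:M - fcalc f rho.
  by rewrite -fcalcD -fcalcZ fcalc_cst // rmorphN1 scaleN1r.
by apply/eqP; rewrite -subr_eq0 -{1}[A]mul1mx -mulmxBl -e1 gA.
Qed.

(** The easy direction of Uhlmann's theorem: the overlap of any two purifications is a lower
    bound. *)
Lemma sqf_ge n k (A B : 'M[K]_(n, k)) :
  tre (adjm A *m B) <= sqf (A *m adjm A) (B *m adjm B).
Proof.
have [P [eP cP]] := gram_polar (erefl (A *m adjm A)).
have [Q [eQ cQ]] := gram_polar (erefl (B *m adjm B)).
rewrite {1}eP {1}eQ adjM fcalc_adj -!mulmxA mulmxA.
rewrite mulmxA -[_ *m _ *m _ *m Q]mulmxA -[adjm P *m _ *m _ ]mulmxA mulmxA.
rewrite [X in tre X](_ : _ = adjm P *m (fcalc Num.sqrt (A *m adjm A) *m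
   fcalc Num.sqrt (B *m adjm B)) *m Q); last by rewrite !mulmxA.
exact: trnorm_ub.
Qed.

Lemma adj_row_mx m n1 n2 (A : 'M[K]_(m, n1)) (B : 'M[K]_(m, n2)) :
  adjm (row_mx A B) = col_mx (adjm A) (adjm B).
Proof.
by apply/matrixP => i j; rewrite adjE [RHS]mxE mxE; case: splitP => k _; rewrite adjE.
Qed.

(** Appending to [B] a factor of [sigma - B B^*], and zeros to [A], leaves the overlap unchanged.
    Thus a purification of a part of [sigma] is enough. *)
Lemma sqf_ge_le n k (A B : 'M[K]_(n, k)) sigma : lwle (B *m adjm B) sigma ->
  tre (adjm A *m B) <= sqf (A *m adjm A) sigma.
Proof.
move=> /psd_factor[D eD].
have -> : sigma = row_mx B D *m adjm (row_mx B D).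
  by rewrite adj_row_mx mul_row_col -eD addrC subrK.
have -> : A *m adjm A = row_mx A (0 : 'M_(n, n)) *m adjm (row_mx A 0).
  by rewrite adj_row_mx mul_row_col mul0mx addr0.
apply: le_trans (sqf_ge _ _).
rewrite adj_row_mx mul_col_row adj0 !mul0mx /tre mxtrace_block mxtrace0 addr0.
exact: lexx.
Qed.

End Fidelity.

Section Entropy.
Context {R : realType} {K : cplx R}.
Local Notation rc := (rc K).

Definition is_st n (A : 'M[K]_n) := psdm A /\ tre A = 1.

Definition ent n (A : 'M[K]_n) : R := - tre (fcalc (fun x => x * ln x) A).

Lemma ent_spec n (A U : 'M[K]_n) d : spec A U d -> ent A = - \sum_i d i * ln (d i).
Proof. by move=> s; rewrite /ent (trR_spec _ s). Qed.

Lemma st_spec n (A : 'M[K]_n) : is_st A -> exists U d,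
  [/\ spec A U d, forall i, 0 <= d i & \sum_i d i = 1].
Proof.
move=> [pA t1]; have [U [d [s d0]]] := unitary_normal_form pA.
exists U, d; split=> //; rewrite -t1 -[in RHS](fcalc_id (proj1 pA)).
by rewrite (trR_spec _ s).
Qed.

(** [X] intertwines [X X^*] with [X^* X], hence also functions of them; no spectra have to be
    matched. *)
Lemma ent_gram m n (X : 'M[K]_(m, n)) : ent (X *m adjm X) = ent (adjm X *m X).
Proof.
have h1 := proj1 (psd_gram' X); have h2 := proj1 (psd_gram X).
rewrite /ent -!fcalcM // !fcalc_id //; congr (- _).
rewrite trRC mulmxA (fcalc_intertwine _ h1 h2); last by rewrite mulmxA.
by rewrite trRC mulmxA.
Qed.

Lemma ent_tr n (A : 'M[K]_n) : adjm A = A -> ent A^T = ent A.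
Proof.
move=> /spec_exists[U [d s]]; rewrite (ent_spec s).
apply: (@ent_spec n A^T (adjm U)^T); case: s => u eA; split.
  rewrite /unitm; have -> : adjm (adjm U)^T = U^T.
    by apply/matrixP => i j; rewrite !mxE conjCK.
  by rewrite -trmx_mul u trmx1.
have -> : adjm (adjm U)^T = U^T.
  by apply/matrixP => i j; rewrite !mxE conjCK.
rewrite {1}eA !trmx_mul mulmxA; congr (_ *m _ *m _).
by apply/matrixP => i j; rewrite mxE !rdiagE eq_sym; case: eqVneq => [->|].
Qed.

(** The crude bound from [ln x <= x], instead of the logarithm of the dimension, is enough to fix
    the number of bins later. *)
Lemma ent_ub n (A : 'M[K]_n) : is_st A -> ent A <= n%:R.
Proof.
move=> /st_spec[U [d [s d0 d1]]]; rewrite (ent_spec s) -sumrN.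
have -> : n%:R = \sum_(i < n) (1 : R) by rewrite sumr_const card_ord.
apply: ler_sum => i _; have [->|di] := eqVneq (d i) 0; first by rewrite mul0r oppr0 ler01.
have dp : 0 < d i by rewrite lt_neqAle eq_sym di d0.
rewrite -mulrN -lnV; last by rewrite posrE.
have := @ln_sublinear R (d i)^-1; rewrite invr_gt0 => /(_ dp) h.
by rewrite -(@mulfV _ (d i)) // ler_pM2l // ltW.
Qed.

Lemma kl_term (p q : R) : 0 < p -> 0 < q -> p - q <= p * (ln p - ln q).
Proof.
move=> p0 q0; have qp : 0 < q / p by rewrite divr_gt0.
have := @le_ln1Dx R (q / p - 1); rewrite ltrBrDl subrr => /(_ qp).
rewrite addrC subrK ln_div ?posrE // => h.
have -> : p - q = p * - (q / p - 1) by field; rewrite gt_eqF.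
by rewrite ler_pM2l // lerNl opprB.
Qed.

(** The squared overlaps of the two eigenbases form a doubly stochastic matrix [w]. Averaged over
    it, the claim reduces to [p (ln p - ln q) >= p - q], whose right side sums to zero. *)
Lemma klein n (rho xi : 'M[K]_n) : is_st rho -> is_st xi ->
  (forall v : 'cV[K]_n, xi *m v = 0 -> rho *m v = 0) ->
  ent rho <= - tre (rho *m fcalc (@ln R) xi).
Proof.
move=> sr sx supp.
have [U [p [s1 p0 p1]]] := st_spec sr; have [V [q [s2 q0 q1]]] := st_spec sx.
pose w i j := re (`|(adjm U *m V) i j| ^+ 2).
have wE i j : rc (w i j) = (adjm U *m V) i j * Num.conj ((adjm U *m V) i j).
  by rewrite -normCK /w re_real // ger0_real // exprn_ge0.
have w0 i j : 0 <= w i j by apply: re_ge0; rewrite exprn_ge0.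
have [u1 e1] := s1; have [u2 e2] := s2.
have wr i : \sum_j w i j = 1.
  apply: (@rc_inj _ K); rewrite rmorph_sum rmorph1.
  transitivity ((adjm U *m V *m adjm (adjm U *m V)) i i).
    by rewrite mxE; apply: eq_bigr => j _; rewrite wE adjE.
  by rewrite adjM adjK mulmxA unitaryK // u1 mxE eqxx.
have wc j : \sum_i w i j = 1.
  apply: (@rc_inj _ K); rewrite rmorph_sum rmorph1.
  transitivity ((adjm (adjm U *m V) *m (adjm U *m V)) j j).
    by rewrite mxE; apply: eq_bigr => i _; rewrite wE adjE mulrC.
  by rewrite adjM adjK mulmxA -[_ *m U *m adjm U]mulmxA unitaryV // mulmx1 u2 mxE eqxx.
have cross : tre (rho *m fcalc (@ln R) xi) = \sum_i \sum_j w i j * (p i * ln (q j)).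
  rewrite (fcalc_spec _ s2) e1.
  transitivity (tre (rdiag p *m (adjm U *m V) *m rdiag (fun j => ln (q j)) *m adjm (adjm U *m V))).
    by rewrite adjM adjK -!mulmxA trRC !mulmxA.
  rewrite /tre /mxtrace re_sum; apply: eq_bigr => i _.
  rewrite mxE re_sum; apply: eq_bigr => j _.
  rewrite mul_mx_rdiag mul_rdiag_mx adjE -(rcK K (w i j * _)).
  by congr re; rewrite !rmorphM /= wE; ring.
(* the support condition kills the overlaps with the kernel of xi *)
have w00 i j : 0 < p i -> q j = 0 -> w i j = 0.
  move=> pi qj; apply: (@rc_inj _ K); rewrite wE rmorph0.
  have h : rho *m col j V = 0.
    apply: supp; rewrite colE mulmxA e2 unitaryVK // -colE.
    by apply/matrixP => a b; rewrite mxE mul_mx_rdiag qj rmorph0 mulr0 mxE.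
  have : (adjm U *m (rho *m col j V)) i 0 = 0 by rewrite h mulmx0 mxE.
  rewrite e1 !mulmxA u1 mul1mx -mulmxA mul_rdiag_mx colE mulmxA -colE [col _ _ _ _]mxE.
  move=> /eqP; rewrite mulf_eq0 => /orP[/eqP h0|/eqP ->]; last by rewrite mul0r.
  by move: pi; rewrite -(rcK K (p i)) h0 re0 ltxx.
rewrite (ent_spec s1) cross lerN2 -subr_ge0.
have -> : \sum_i p i * ln (p i) = \sum_i \sum_j w i j * (p i * ln (p i)).
  by apply: eq_bigr => i _; rewrite -mulr_suml wr mul1r.
rewrite -sumrB; apply: (@le_trans _ _ (\sum_i \sum_j w i j * (p i - q j))).
  under eq_bigr do under eq_bigr do rewrite mulrBr.
  under eq_bigr do rewrite sumrB.
  rewrite sumrB subr_ge0 exchange_big /=.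
  under eq_bigr do rewrite -mulr_suml wc mul1r.
  by under [X in _ <= X]eq_bigr do rewrite -mulr_suml wr mul1r; rewrite p1 q1.
apply: ler_sum => i _; rewrite -sumrB; apply: ler_sum => j _.
rewrite -mulrBr; have [wz|wn] := eqVneq (w i j) 0; first by rewrite wz !mul0r.
apply: ler_wpM2l => //; rewrite -mulrBr.
have [pz|pn] := eqVneq (p i) 0; first by rewrite pz mul0r sub0r oppr_le0.
have pp : 0 < p i by rewrite lt_neqAle eq_sym pn p0.
apply: kl_term => //; rewrite lt_neqAle eq_sym q0 andbT.
by apply: contra_neq wn => /(w00 _ _ pp).
Qed.

End Entropy.

Local Notation "i ## j" := (mxtens_index (i, j)) (at level 40, no associativity).

Lemma sum_tens (V : nmodType) a b (F : 'I_(a * b) -> V) :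
  \sum_k F k = \sum_i \sum_j F (i ## j).
Proof.
rewrite (reindex (@mxtens_index a b)) /=; last first.
  by exists (@mxtens_unindex a b) => k _; rewrite (mxtens_indexK, mxtens_unindexK).
by rewrite pair_big /=; apply: eq_bigr => -[].
Qed.

Lemma tens_matrixP (T : Type) a b c d (A B : 'M[T]_(a * b, c * d)) :
  (forall i j k l, A (i ## j) (k ## l) = B (i ## j) (k ## l)) -> A = B.
Proof.
move=> h; apply/matrixP => u v.
by case: (mxtens_indexP u) => i j; case: (mxtens_indexP v) => k l; apply: h.
Qed.

(** * Tensor powers and tail bounds *)

Section Labels.

Fixpoint dig d n : 'I_(dpow d n) -> 'I_n -> 'I_d :=
  match n return 'I_(dpow d n) -> 'I_n -> 'I_d with
  | 0 => fun _ i => False_rect _ (notF (ltn_ord i))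
  | n'.+1 => fun k i =>
      if unlift ord0 i is Some j then @dig d n' (mxtens_unindex k).2 j
      else (mxtens_unindex k).1
  end.

Fixpoint undig d n : ('I_n -> 'I_d) -> 'I_(dpow d n) :=
  match n return ('I_n -> 'I_d) -> 'I_(dpow d n) with
  | 0 => fun _ => ord0
  | n'.+1 => fun f => f ord0 ## @undig d n' (fun j => f (lift ord0 j))
  end.

Lemma digS d n (k : 'I_(dpow d n.+1)) i :
  dig k i = if unlift ord0 i is Some j then dig (mxtens_unindex k).2 j
            else (mxtens_unindex k).1.
Proof. by []. Qed.

Lemma digS0 d n (i : 'I_d) (j : 'I_(dpow d n)) : @dig d n.+1 (i ## j) ord0 = i.
Proof. by rewrite digS unlift_none mxtens_indexK. Qed.

Lemma digSl d n (i : 'I_d) (j : 'I_(dpow d n)) m :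
  @dig d n.+1 (i ## j) (lift ord0 m) = dig j m.
Proof. by rewrite digS liftK mxtens_indexK. Qed.

Lemma undigS d n (f : 'I_n.+1 -> 'I_d) :
  undig f = f ord0 ## undig (fun j => f (lift ord0 j)).
Proof. by []. Qed.

(* A labeling identifies the index set of a tensor power with the words of length n. *)
Definition labeling D d n (l : 'I_D -> 'I_n -> 'I_d) (l' : ('I_n -> 'I_d) -> 'I_D) :=
  cancel l l' /\ cancel l' l.

Lemma dig_labeling d n : labeling (@dig d n) (@undig d n).
Proof.
split; elim: n => [|n IHn].
- by move=> k; rewrite [k]ord1.
- move=> k; case: (mxtens_indexP k) => i j; rewrite undigS digS0.
  by congr (_ ## _); rewrite -[RHS]IHn; congr undig; apply/funext => m; rewrite digSl.
- by move=> f; apply/funext => -[].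
- move=> f; apply/funext => i; rewrite undigS.
  by case: (unliftP ord0 i) => [j ->|->]; rewrite (digS0, digSl) ?IHn.
Qed.

(** Reads an index of [A^n (x) B^n] as a word over the letters of [A (x) B], so that powers of
    bipartite operators need no rearrangement of tensor factors. *)
Definition lprod D1 d1 D2 d2 n (l1 : 'I_D1 -> 'I_n -> 'I_d1) (l2 : 'I_D2 -> 'I_n -> 'I_d2)
  (k : 'I_(D1 * D2)) (i : 'I_n) : 'I_(d1 * d2) :=
  l1 (mxtens_unindex k).1 i ## l2 (mxtens_unindex k).2 i.

Definition unlprod D1 d1 D2 d2 n (l1 : ('I_n -> 'I_d1) -> 'I_D1) (l2 : ('I_n -> 'I_d2) -> 'I_D2)
  (f : 'I_n -> 'I_(d1 * d2)) : 'I_(D1 * D2) :=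
  l1 (fun i => (mxtens_unindex (f i)).1) ## l2 (fun i => (mxtens_unindex (f i)).2).

Lemma lprod_labeling D1 d1 D2 d2 n l1 l1' l2 l2' :
  @labeling D1 d1 n l1 l1' -> @labeling D2 d2 n l2 l2' ->
  labeling (lprod l1 l2) (unlprod l1' l2').
Proof.
move=> [c1 c1'] [c2 c2']; split=> [k|f].
  rewrite /unlprod; case: (mxtens_indexP k) => i j.
  have e m : mxtens_unindex (lprod l1 l2 (i ## j) m) = (l1 i m, l2 j m).
    by rewrite /lprod !mxtens_indexK.
  rewrite (_ : (fun m => _.1) = l1 i); last by apply/funext => m; rewrite e.
  rewrite (_ : (fun m => _.2) = l2 j); last by apply/funext => m; rewrite e.
  by rewrite c1 c2.
by apply/funext => i; rewrite /lprod /unlprod mxtens_indexK /= c1' c2' -[RHS]mxtens_unindexK.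
Qed.

Lemma lprodE D1 d1 D2 d2 n (l1 : 'I_D1 -> 'I_n -> 'I_d1) (l2 : 'I_D2 -> 'I_n -> 'I_d2) k1 k2 i :
  lprod l1 l2 (k1 ## k2) i = l1 k1 i ## l2 k2 i.
Proof. by rewrite /lprod mxtens_indexK. Qed.

Lemma sum_labeling (V : nmodType) D d n l l' (F : {ffun 'I_n -> 'I_d} -> V) :
  @labeling D d n l l' -> \sum_k F [ffun i => l k i] = \sum_f F f.
Proof.
move=> [c c']; rewrite [RHS](reindex (fun k => [ffun i => l k i])) //.
exists (fun f : {ffun 'I_n -> 'I_d} => l' f) => [k _|f _].
  by rewrite -[RHS]c; congr l'; apply/funext => i; rewrite ffunE.
by apply/ffunP => i; rewrite ffunE c'.
Qed.

Lemma sum_prod_labeling (K : comNzRingType) D d n l l' (F : 'I_n -> 'I_d -> K) :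
  @labeling D d n l l' -> \sum_k \prod_i F i (l k i) = \prod_i \sum_j F i j.
Proof.
move=> hl; rewrite bigA_distr_bigA -(sum_labeling _ hl) /=.
by apply: eq_bigr => k _; apply: eq_bigr => i _; rewrite ffunE.
Qed.

Lemma labeling_inj D d n l l' : @labeling D d n l l' ->
  forall j k, (l j =1 l k) -> j = k.
Proof. by move=> [c _] j k h; rewrite -[j]c -[k]c; congr l'; apply/funext. Qed.

End Labels.

Section TensorPower.
Context {R : realType} {K : cplx R}.
Local Notation rc := (rc K).

Definition tpow D D' d d' n (l : 'I_D -> 'I_n -> 'I_d) (m : 'I_D' -> 'I_n -> 'I_d')
  (A : 'M[K]_(d, d')) : 'M[K]_(D, D') := \matrix_(j, k) \prod_i A (l j i) (m k i).

Lemma tpowM D D' D'' d d' d'' n (l : 'I_D -> 'I_n -> 'I_d) (m : 'I_D' -> 'I_n -> 'I_d') m'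
  (p : 'I_D'' -> 'I_n -> 'I_d'') (A : 'M[K]_(d, d')) (B : 'M[K]_(d', d'')) :
  labeling m m' -> tpow l p (A *m B) = tpow l m A *m tpow m p B.
Proof.
move=> hm; apply/matrixP => j k; rewrite !mxE.
under eq_bigr do rewrite mxE.
rewrite -(sum_prod_labeling _ hm); apply: eq_bigr => a _.
by rewrite !mxE big_split.
Qed.

Lemma tpow_rdiag D d n (l : 'I_D -> 'I_n -> 'I_d) l' (p : 'I_d -> R) : labeling l l' ->
  tpow l l (rdiag p : 'M[K]_d) = rdiag (fun k => \prod_i p (l k i)).
Proof.
move=> hl; apply/matrixP => j k; rewrite mxE rdiagE rmorph_prod.
case: eqVneq => [->|jk].
  by rewrite mulr1n; apply: eq_bigr => i _; rewrite rdiagE eqxx.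
have [i ne] : exists i, l j i != l k i.
  apply: contrapT => h; case/eqP: jk; apply: (labeling_inj hl) => i.
  by apply/eqP/negPn/negP => ne; apply: h; exists i.
by rewrite (bigD1 i) //= rdiagE (negPf ne) mulr0n mul0r.
Qed.

Lemma tpow1 D d n (l : 'I_D -> 'I_n -> 'I_d) l' : labeling l l' ->
  tpow l l (1%:M : 'M[K]_d) = 1%:M.
Proof.
move=> hl; rewrite -rdiag1 (tpow_rdiag _ hl) -rdiag1; apply: eq_rdiag => k.
by rewrite big1.
Qed.

Lemma adj_tpow D D' d d' n (l : 'I_D -> 'I_n -> 'I_d) (m : 'I_D' -> 'I_n -> 'I_d')
  (A : 'M[K]_(d, d')) : adjm (tpow l m A) = tpow m l (adjm A).
Proof.
apply/matrixP => j k; rewrite !mxE rmorph_prod.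
by apply: eq_bigr => i _; rewrite adjE.
Qed.

Lemma tr_tpow D d n (l : 'I_D -> 'I_n -> 'I_d) l' (A : 'M[K]_d) : labeling l l' ->
  \tr (tpow l l A) = (\tr A) ^+ n.
Proof.
move=> hl; rewrite /mxtrace; under eq_bigr do rewrite mxE.
rewrite (sum_prod_labeling (fun=> fun j => A j j) hl).
by rewrite prodr_const card_ord.
Qed.

Lemma spec_tpow D d n (l : 'I_D -> 'I_n -> 'I_d) l' (A U : 'M[K]_d) p : labeling l l' ->
  spec A U p -> spec (tpow l l A) (tpow l l U) (fun k => \prod_i p (l k i)).
Proof.
move=> hl [u ->]; split.
  by rewrite /unitm adj_tpow -(tpowM _ _ _ _ hl) u (tpow1 hl).
by rewrite -(tpow_rdiag _ hl) adj_tpow -!(tpowM _ _ _ _ hl).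
Qed.

Lemma psd_tpow D d n (l : 'I_D -> 'I_n -> 'I_d) l' (A : 'M[K]_d) : labeling l l' ->
  psdm A -> psdm (tpow l l A).
Proof.
move=> hl /psd_factor[G ->]; rewrite (tpowM _ _ _ _ hl) -adj_tpow.
exact: psd_gram'.
Qed.

Lemma st_tr n (A : 'M[K]_n) : is_st A -> \tr A = 1.
Proof.
move=> [pA t1]; rewrite -[LHS](re_real) ?ger0_real ?psd_tr_ge0 //.
by rewrite -/(tre A) t1 rmorph1.
Qed.

Lemma st_tpow D d n (l : 'I_D -> 'I_n -> 'I_d) l' (A : 'M[K]_d) : labeling l l' ->
  is_st A -> is_st (tpow l l A).
Proof.
move=> hl sA; split; first by apply: psd_tpow hl _; case: sA.
by rewrite /tre (tr_tpow _ hl) (st_tr sA) expr1n re1.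
Qed.

(* The linear map with matrix entries [k s s' y y']: it sends [delta_mx s s']
   to the matrix [k s s']. *)
Definition kmap d d' (k : 'I_d -> 'I_d -> 'I_d' -> 'I_d' -> K) (X : 'M[K]_d) : 'M[K]_d' :=
  \matrix_(y, y') \sum_s \sum_s' X s s' * k s s' y y'.

Definition kpow D D' d d' n (l : 'I_D -> 'I_n -> 'I_d) (m : 'I_D' -> 'I_n -> 'I_d')
  (k : 'I_d -> 'I_d -> 'I_d' -> 'I_d' -> K) (s s' : 'I_D) (y y' : 'I_D') : K :=
  \prod_i k (l s i) (l s' i) (m y i) (m y' i).

End TensorPower.

(** * Chernoff bounds for the spectrum of an i.i.d. state *)

Section Chernoff.
Context {R : realType}.

Lemma expR_quad (u : R) : expR u <= 1 + u + u ^+ 2 * expR `|u|.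
Proof.
have [u0|u0] := leP 0 u.
  rewrite ger0_norm // expr2.
  have h : expR u - 1 <= u * expR u.
    have := expR_ge1Dx (- u); rewrite expRN => h.
    have := ler_wpM2r (expR_ge0 u) h; rewrite mulVf ?gt_eqF ?expR_gt0 // mulrBl mul1r.
    by lra.
  have := ler_wpM2l u0 h; rewrite mulrBr mulr1 mulrA; lra.
pose v := - u; have v0 : 0 < v by rewrite oppr_gt0.
have -> : u = - v by rewrite opprK.
rewrite normrN gtr0_norm // expRN sqrrN.
have e1 : 1 + v <= expR v by apply: expR_ge1Dx.
have vp : 0 < expR v by apply: expR_gt0.
rewrite -(ler_pM2r vp) mulVf ?gt_eqF // .
have h2 : 0 <= v ^+ 2 by rewrite sqr_ge0.
have e2 : 1 <= expR v by lra.
have h3 : v ^+ 2 <= v ^+ 2 * expR v by rewrite ler_peMr.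
have h4 : 0 <= 1 - v + v ^+ 2 by nra.
have h5 : 1 - v + v ^+ 2 <= 1 - v + v ^+ 2 * expR v by lra.
(* Multiplied by [1 + v <= expR v], the polynomial [1 - v + v^2] becomes [1 + v^3], which is at
   least 1. *)
apply: le_trans (_ : (1 - v + v ^+ 2) * (1 + v) <= _).
  have -> : (1 - v + v ^+ 2) * (1 + v) = 1 + v ^+ 3 by ring.
  by rewrite lerDl exprn_ge0 // ltW.
by apply: ler_pM => //; lra.
Qed.

Lemma sqr_le_expR (x : R) : 0 <= x -> x ^+ 2 <= 16 * expR (x / 2).
Proof.
move=> x0; have h : x / 4 <= expR (x / 4) by have := expR_ge1Dx (x / 4); lra.
have : (x / 4) ^+ 2 <= (expR (x / 4)) ^+ 2.
  by rewrite ler_pXn2r // ?nnegrE ?expR_ge0 // divr_ge0.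
have -> : (expR (x / 4)) ^+ 2 = expR (x / 2).
  by rewrite expr2 -expRD; congr expR; field.
by rewrite exprMn; lra.
Qed.

(** With [x = - ln p] the second-order remainder is at most [t^2 x^2 e^(-x/2)], because [|t| <= 1/2]
    spends only half of the factor [p = e^(-x)]. The bound is thus uniform in [p], also near 0. *)
Lemma mgf_term (p t : R) : 0 <= p <= 1 -> `|t| <= 1 / 2 ->
  p * expR (- t * ln p) <= p + t * (- (p * ln p)) + 16 * t ^+ 2.
Proof.
move=> /andP[p0 p1] ht; have [->|pn] := eqVneq p 0.
  by rewrite !mul0r oppr0 mulr0 !add0r mulr_ge0 // sqr_ge0.
have pp : 0 < p by rewrite lt_neqAle eq_sym pn p0.
pose x := - ln p; have x0 : 0 <= x by rewrite oppr_ge0 ln_le0.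
have pe : p = expR (- x) by rewrite opprK lnK ?posrE.
have -> : - t * ln p = t * x by rewrite /x mulrN mulNr.
have -> : - (p * ln p) = p * x by rewrite /x mulrN.
have := expR_quad (t * x); rewrite -(ler_pM2l pp) => /le_trans; apply.
rewrite !mulrDr mulr1 [p * (t * x)]mulrCA lerD2l.
rewrite exprMn -mulrA mulrCA [X in _ <= X]mulrC ler_wpM2l ?sqr_ge0 //.
rewrite mulrCA pe -expRD.
apply: le_trans (_ : x ^+ 2 * expR (- (x / 2)) <= _).
  apply: ler_wpM2l; first by rewrite sqr_ge0.
  rewrite ler_expR normrM (ger0_norm x0).
  by have := ler_wpM2r x0 ht; lra.
by rewrite expRN ler_pdivrMr ?expR_gt0 // sqr_le_expR.
Qed.

Section Tail.
Variables (d n D : nat) (l : 'I_D -> 'I_n -> 'I_d) (l' : ('I_n -> 'I_d) -> 'I_D).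
Hypothesis hl : labeling l l'.
Variable p : 'I_d -> R.
Hypotheses (p0 : forall i, 0 <= p i) (p1 : \sum_i p i = 1).
Let P k := \prod_i p (l k i).
Let H := - \sum_i p i * ln (p i).

Lemma dist_le1 i : p i <= 1.
Proof. by rewrite -p1 (bigD1 i) //= lerDl sumr_ge0. Qed.

Lemma mgf_bound (t : R) : `|t| <= 1 / 2 ->
  \sum_k \prod_i (p (l k i) * expR (- t * ln (p (l k i)))) <=
  expR (n%:R * (t * H + 16 * d%:R * t ^+ 2)).
Proof.
move=> ht; rewrite (sum_prod_labeling (fun=> fun j => p j * expR (- t * ln (p j))) hl).
rewrite prodr_const card_ord expRM_natl.
have h0 : 0 <= \sum_j p j * expR (- t * ln (p j)).
  by apply: sumr_ge0 => j _; rewrite mulr_ge0 // expR_ge0.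
apply: lerXn2r; rewrite ?nnegrE ?expR_ge0 //.
apply: le_trans (expR_ge1Dx _).
apply: le_trans (_ : \sum_j (p j + t * (- (p j * ln (p j))) + 16 * t ^+ 2) <= _).
  by apply: ler_sum => j _; apply: mgf_term => //; rewrite p0 dist_le1.
rewrite !big_split /= p1 -mulr_sumr sumrN sumr_const card_ord -/H.
by rewrite -mulr_natl; lra.
Qed.

(** Markov's inequality for [P^(-t)]; the two signs of [t] give the two tails. The condition is
    asked only where [P k] is positive, since [ln 0] is a default value. *)
Lemma tail_gen (t c : R) (Q : pred 'I_D) : `|t| <= 1 / 2 ->
  (forall k, Q k -> 0 < P k -> c <= - t * ln (P k)) ->
  \sum_(k | Q k) P k <= expR (n%:R * (t * H + 16 * d%:R * t ^+ 2) - c).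
Proof.
move=> ht hQ; rewrite expRD.
apply: le_trans (ler_wpM2r (expR_ge0 _) (mgf_bound ht)); rewrite mulr_suml.
have P0 k : 0 <= P k by apply: prodr_ge0.
have M0 k : 0 <= \prod_i (p (l k i) * expR (- t * ln (p (l k i)))).
  by apply: prodr_ge0 => i _; rewrite mulr_ge0 // expR_ge0.
rewrite big_mkcond /=; apply: ler_sum => k _.
case: ifPn => [Qk|_]; last by rewrite mulr_ge0 // expR_ge0.
have [Pz|Pn] := eqVneq (P k) 0; first by rewrite Pz mulr_ge0 // expR_ge0.
have Pp : 0 < P k by rewrite lt_neqAle eq_sym Pn P0.
have pp i : 0 < p (l k i).
  rewrite lt_neqAle p0 andbT eq_sym; apply: contra_neq Pn => pz.
  by rewrite /P (bigD1 i) //= pz mul0r.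
have -> : \prod_i (p (l k i) * expR (- t * ln (p (l k i)))) = P k * expR (- t * ln (P k)).
  rewrite big_split /=; congr (_ * _).
  suff [_ ->] : 0 < P k /\ \prod_(i < n) expR (- t * ln (p (l k i))) = expR (- t * ln (P k)) by [].
  rewrite /P; apply: (big_ind2 (fun x y => 0 < x /\ y = expR (- t * ln x))).
  - by rewrite ltr01 ln1 mulr0 expR0.
  - move=> x1 x2 y1 y2 [h1 ->] [h2 ->]; rewrite mulr_gt0 //; split=> //.
    by rewrite lnM ?posrE // mulrDr expRD.
  - by move=> i _; split.
rewrite -mulrA ler_peMr // -expRD -expR0 ler_expR subr_ge0.
exact: hQ.
Qed.

(** The exponent [16 d s^2 - s delta] is minimal at [s = delta / (32 d)]. The cap 1/2 is the range
    of the moment bound, and in both cases at least half of [s delta] survives. *)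
Definition rate (d : nat) (delta : R) : R :=
  let s := Num.min (delta / (32 * d%:R)) (1 / 2) in s * delta / 2.

Lemma dim_gt0 : (0 < d)%N.
Proof.
case: (posnP d) => // dz; have := oner_eq0 R; rewrite -p1 big1 ?eqxx // => i _.
by have := ltn_ord i; rewrite {2}dz.
Qed.

Lemma rate_params (delta : R) : 0 < delta ->
  let s := Num.min (delta / (32 * d%:R)) (1 / 2) in
  [/\ 0 < s, s <= 1 / 2 & 16 * d%:R * s ^+ 2 <= s * delta / 2].
Proof.
move=> d0; have dp : 0 < d%:R :> R by rewrite ltr0n dim_gt0.
have h1 : 0 < delta / (32 * d%:R) by rewrite divr_gt0 // mulr_gt0.
move=> s; have sp : 0 < s by rewrite /s lt_min h1 /= divr_gt0.
split=> //; first by rewrite /s ge_min lexx orbT.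
have : s <= delta / (32 * d%:R) by rewrite /s ge_min lexx.
rewrite ler_pdivlMr; last by rewrite mulr_gt0.
move=> h; have := ler_wpM2l (ltW sp) h; rewrite expr2; lra.
Qed.

Lemma upper_tail (delta : R) : 0 < delta ->
  \sum_(k | P k < expR (- (n%:R * (H + delta)))) P k <= expR (- (n%:R * rate d delta)).
Proof.
move=> d0; have [sp s2 s3] := rate_params d0; rewrite /rate.
set s := Num.min _ _ in sp s2 s3 *.
apply: le_trans (tail_gen (t := s) (c := s * (n%:R * (H + delta))) _ _) _.
- by rewrite gtr0_norm.
- move=> k hk Pp; rewrite mulNr -mulrN ler_wpM2l ?(ltW sp) //.
  by rewrite lerNr -ler_expR lnK ?posrE // ltW.
rewrite ler_expR; have n0 : 0 <= n%:R :> R by [].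
by have := ler_wpM2l n0 s3; lra.
Qed.

Lemma lower_tail (delta : R) : 0 < delta ->
  \sum_(k | expR (- (n%:R * (H - delta))) < P k) P k <= expR (- (n%:R * rate d delta)).
Proof.
move=> d0; have [sp s2 s3] := rate_params d0; rewrite /rate.
set s := Num.min _ _ in sp s2 s3 *.
apply: le_trans (tail_gen (t := - s) (c := s * - (n%:R * (H - delta))) _ _) _.
- by rewrite normrN gtr0_norm.
- move=> k hk Pp; rewrite opprK ler_wpM2l ?(ltW sp) //.
  by rewrite -ler_expR lnK ?posrE // ltW.
rewrite ler_expR; have n0 : 0 <= n%:R :> R by [].
by have := ler_wpM2l n0 s3; rewrite sqrrN; lra.
Qed.

End Tail.

End Chernoff.

(** * Overlaps of a projection with a spectrum *)

Section Typical.
Context {R : realType} {K : cplx R}.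
Local Notation rc := (rc K).

Lemma tre_spec n (T S U : 'M[K]_n) P f : spec S U P ->
  tre (T *m fcalc f S) = \sum_k f (P k) * re ((adjm U *m T *m U) k k).
Proof.
move=> s; rewrite (fcalc_spec _ s) mulmxA trRC mulmxA.
rewrite /tre /mxtrace re_sum; apply: eq_bigr => k _.
by rewrite mulmxA mul_mx_rdiag mulrC reZ.
Qed.

Lemma tre_spec1 n (T S U : 'M[K]_n) P : spec S U P ->
  tre (T *m S) = \sum_k P k * re ((adjm U *m T *m U) k k).
Proof. by move=> s; rewrite -[S in LHS](fcalc_id (spec_herm s)) (tre_spec _ _ s). Qed.

Lemma re_scalemx m n (a : R) (A : 'M[K]_(m, n)) i j :
  re ((rc a *: A) i j) = a * re (A i j).
Proof. by rewrite mxE reZ. Qed.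

Lemma re_mul_normsq (x : K) (a : R) : re (x * rc a * Num.conj x) = a * re (`|x| ^+ 2).
Proof. by rewrite mulrAC -normCK mulrC reZ. Qed.

Lemma diag_ge0 n (A : 'M[K]_n) i : psdm A -> 0 <= re (A i i).
Proof.
move=> pA; have := @loewner_diag _ _ _ 0 A i; rewrite /lwle subr0 mxE re0.
by apply.
Qed.

(** For the eigenvector [k] put [t = <k|T|k>]. The hypothesis gives [P k t^2 <= b t], so each
    eigenvector contributes at most [b], and at most [1/c] eigenvalues reach [c]. *)
Lemma proj_tre_le n (T S U : 'M[K]_n) P (b c : R) : spec S U P ->
  (forall k, 0 <= P k) -> \sum_k P k <= 1 ->
  adjm T = T -> T *m T = T -> 0 <= b -> 0 < c -> lwle (T *m S *m T) (rc b *: T) ->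
  tre (T *m S) <= \sum_(k | P k < c) P k + b / c.
Proof.
move=> s P0 P1 hT iT b0 c0 hb; have [u eS] := s.
rewrite (tre_spec1 _ s).
set t := fun k => re ((adjm U *m T *m U) k k).
have t0 k : 0 <= t k by apply/diag_ge0/psd_conj'; rewrite -iT -{1}hT; apply: psd_gram.
have t1 k : t k <= 1.
  have := loewner_diag k (loewner_conj' U (proj_le1 hT iT)).
  by rewrite mulmx1 u [1%:M k k]mxE eqxx re1.
have tb k : P k * t k <= b.
  have [->|tn] := eqVneq (t k) 0; first by rewrite mulr0.
  have tp : 0 < t k by rewrite lt_neqAle eq_sym tn t0.
  rewrite -(ler_pM2r tp); have := loewner_diag k (loewner_conj' U hb).
  rewrite -scalemxAr -scalemxAl re_scalemx -/(t k); apply: le_trans.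
  have -> : adjm U *m (T *m S *m T) *m U =
      (adjm U *m T *m U) *m rdiag P *m adjm (adjm U *m T *m U).
    by rewrite eS !adjM adjK hT !mulmxA.
  rewrite mxE re_sum (bigD1 k) //= -[X in X <= _]addr0 lerD //.
    rewrite mul_mx_rdiag adjE re_mul_normsq -mulrA ler_wpM2l //.
    have tr : (adjm U *m T *m U) k k = rc (t k).
      rewrite /t re_real //; apply/CrealP; rewrite -adjE.
      by congr (_ k k); rewrite !adjM adjK hT mulmxA.
    by rewrite tr ger0_norm ?rc_ge0 // -rmorphXn rcK expr2.
  apply: sumr_ge0 => j _.
  rewrite mul_mx_rdiag adjE re_mul_normsq.
  by rewrite mulr_ge0 // re_ge0 // exprn_ge0.
rewrite (bigID (fun k => P k < c)) /= lerD //.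
  by apply: ler_sum => k _; apply: ler_piMr => //; apply: t1.
apply: le_trans (_ : \sum_(k | ~~ (P k < c)) b * (P k / c) <= _).
  apply: ler_sum => k; rewrite -leNgt => h; apply: le_trans (tb k) _.
  by rewrite ler_peMr // ler_pdivlMr // mul1r.
rewrite -mulr_sumr ler_wpM2l // -mulr_suml -[X in _ <= X]mul1r ler_pM2r ?invr_gt0 //.
apply: le_trans P1; rewrite [X in _ <= X](bigID (fun k => P k < c)) /= lerDr.
exact: sumr_ge0.
Qed.

Lemma small_tre_le n (T S U : 'M[K]_n) P (c m : R) : spec S U P ->
  (forall k, 0 <= P k) -> psdm T -> lwle T 1%:M -> 0 <= c -> tre T <= m ->
  tre (T *m S) <= \sum_(k | c < P k) P k + c * m.
Proof.
move=> s P0 pT T1 c0 Tm; have [u eS] := s.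
rewrite (tre_spec1 _ s).
set t := fun k => re ((adjm U *m T *m U) k k).
have t0 k : 0 <= t k by apply/diag_ge0/psd_conj'.
have t1 k : t k <= 1.
  have := loewner_diag k (loewner_conj' U T1).
  by rewrite mulmx1 u [1%:M k k]mxE eqxx re1.
have tm : \sum_k t k <= m.
  apply: le_trans Tm; rewrite -re_sum /tre.
  by have := trRC (adjm U *m T) U; rewrite /tre => ->; rewrite mulmxA unitaryV // mul1mx.
rewrite (bigID (fun k => c < P k)) /= lerD //.
  by apply: ler_sum => k _; apply: ler_piMr => //; apply: t1.
apply: le_trans (ler_wpM2l c0 tm); rewrite mulr_sumr.
rewrite [X in _ <= X](bigID (fun k => c < P k)) /= -[X in X <= _]add0r lerD //.
  by apply: sumr_ge0 => k _; rewrite mulr_ge0.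
by apply: ler_sum => k; rewrite -leNgt => h; apply: ler_wpM2r => //; apply: t0.
Qed.

End Typical.

(** * The typical-subspace test *)

Section Amplification.
Context {R : realType} {K : cplx R}.
Local Notation rc := (rc K).

(* Block isometries onto the copies of 'C^M in 'C^N = 'C^a (x) 'C^M, in any
   order of the tensor factors: [amp] is tensoring with the identity on 'C^a
   and [ptr] is its dual, the partial trace over 'C^a. *)
Definition blocks a N M (J : 'I_a -> 'M[K]_(N, M)) :=
  (forall i j, adjm (J i) *m J j = (i == j)%:R%:M) /\ \sum_i J i *m adjm (J i) = 1%:M.

Definition amp a N M (J : 'I_a -> 'M[K]_(N, M)) (Y : 'M[K]_M) : 'M[K]_N :=
  \sum_i J i *m Y *m adjm (J i).

Definition ptr a N M (J : 'I_a -> 'M[K]_(N, M)) (X : 'M[K]_N) : 'M[K]_M :=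
  \sum_i adjm (J i) *m X *m J i.

Section Blocks.
Variables (a N M : nat) (J : 'I_a -> 'M[K]_(N, M)).
Hypothesis bJ : blocks J.

Lemma amp_J Y i : amp J Y *m J i = J i *m Y.
Proof.
rewrite /amp mulmx_suml (bigD1 i) //= big1 => [|j ji].
  by rewrite -mulmxA (proj1 bJ) eqxx mulmx1 addr0.
by rewrite -mulmxA (proj1 bJ) (negPf ji) mul_mx_scalar scale0r.
Qed.

Lemma ampM Y Z : amp J Y *m amp J Z = amp J (Y *m Z).
Proof.
rewrite [amp J Z]/amp mulmx_sumr; apply: eq_bigr => i _.
by rewrite !mulmxA amp_J.
Qed.

Lemma amp1 : amp J 1%:M = 1%:M.
Proof. by rewrite -(proj2 bJ); apply: eq_bigr => i _; rewrite mulmx1. Qed.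

Lemma adj_amp Y : adjm (amp J Y) = amp J (adjm Y).
Proof. by rewrite adj_sum; apply: eq_bigr => i _; rewrite !adjM adjK mulmxA. Qed.

Lemma ampB Y Z : amp J (Y - Z) = amp J Y - amp J Z.
Proof. by rewrite -sumrB; apply: eq_bigr => i _; rewrite mulmxBr mulmxBl. Qed.

Lemma psd_amp Y : psdm Y -> psdm (amp J Y).
Proof. by move=> pY; apply: psd_sum => i _; apply: psd_conj. Qed.

Lemma psd_ptr X : psdm X -> psdm (ptr J X).
Proof. by move=> pX; apply: psd_sum => i _; apply: psd_conj'. Qed.

Lemma tr_amp X Y : \tr (X *m amp J Y) = \tr (ptr J X *m Y).
Proof.
rewrite /amp /ptr mulmx_sumr mulmx_suml !raddf_sum /=; apply: eq_bigr => i _.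
by rewrite -!mulmxA [RHS]mxtrace_mulC !mulmxA mxtrace_mulC !mulmxA.
Qed.

Lemma tre_amp X Y : tre (X *m amp J Y) = tre (ptr J X *m Y).
Proof. by rewrite /tre tr_amp. Qed.

Lemma st_ptr X : is_st X -> is_st (ptr J X).
Proof.
move=> [pX t1]; split; first exact: psd_ptr.
by rewrite -[ptr J X]mulmx1 -tre_amp amp1 mulmx1.
Qed.

Lemma fcalc_amp f Y : adjm Y = Y -> fcalc f (amp J Y) = amp J (fcalc f Y).
Proof.
move=> hY; have hA : adjm (amp J Y) = amp J Y by rewrite adj_amp hY.
rewrite -[LHS]mulmx1 -(proj2 bJ) mulmx_sumr /amp; apply: eq_bigr => i _.
by rewrite mulmxA (fcalc_intertwine f hA hY (amp_J Y i)).
Qed.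

Section TypicalTest.
Variables (w t : 'M[K]_N) (xi : 'M[K]_M) (lam c1 c2 : R).
Hypotheses (sw : is_st w) (st : is_st t) (sxi : is_st xi).
Hypotheses (lam0 : 0 <= lam) (c10 : 0 < c1) (c20 : 0 <= c2).
Hypothesis t_le : lwle t (rc lam *: amp J xi).

Let eta1 := tre (fcalc (fun x => x * (x < c1)%R%:R) w).
Let eta2 := tre (fcalc (fun x => x * (c2 < x)%R%:R) (ptr J w)).
Let chi := fcalc (fun x => (c1 <= x)%R%:R) w.
Let pi := fcalc (fun x => (x <= c2)%R%:R) (ptr J w).

(** Since [c1 chi <= w], the test accepts [amp J xi] with probability at most [1/c1] times the trace
    of [pi xi pi] against the marginal of [w], where [pi] caps the eigenvalues at [c2]. On [w] there
    is no square-root loss as for general measurements: [chi] commutes with [w], so each of the two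
    cross terms costs only [eta2]. *)
Lemma typical_test_bound :
  sqf w t <= Num.sqrt (lam * c2 / c1) + Num.sqrt (eta1 + 2 * eta2).
Proof.
have [pw tw] := sw; have hw := proj1 pw.
have [pC tC] := st_ptr sw; have hC := proj1 pC.
have hchi : adjm chi = chi by rewrite fcalc_adj.
have hpi : adjm pi = pi by rewrite fcalc_adj.
have ichi : chi *m chi = chi.
  by rewrite fcalcM //; congr fcalc; apply/funext => x; case: (_ <= _); rewrite !(mulr1, mulr0).
have ipi : pi *m pi = pi.
  by rewrite fcalcM //; congr fcalc; apply/funext => x; case: (_ <= _); rewrite !(mulr1, mulr0).
have chi1 := proj_le1 hchi ichi; have pi1 := proj_le1 hpi ipi.
have pchi : psdm chi by rewrite -ichi -{1}hchi; apply: psd_gram.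
pose Q := amp J pi.
have hQ : adjm Q = Q by rewrite adj_amp hpi.
have iQ : Q *m Q = Q by rewrite ampM ipi.
have Q1 := proj_le1 hQ iQ.
pose T := Q *m chi *m Q.
have pT : psdm T by rewrite /T -{2}hQ; apply: psd_conj.
have T1 : lwle T 1%:M.
  apply: psd_le_trans Q1; have := loewner_conj Q chi1.
  by rewrite hQ mulmx1 iQ.
have Tt0 : 0 <= tre (T *m t) by apply: psd_trRM => //; case: st.
have Tw0 : 0 <= tre (T *m w) by apply: psd_trRM.
have Tw1 : tre (T *m w) <= 1.
  by rewrite trRC -tw -[X in _ <= tre X]mulmx1; apply: le_trRM.
have chiw : chi *m w = fcalc (fun x => (c1 <= x)%R%:R * x) w.
  by rewrite -[w in chi *m w]fcalc_id // fcalcM.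
have e1 : tre (chi *m w) = 1 - eta1.
  apply/eqP; rewrite eq_sym subr_eq -tw -{1}[w]fcalc_id // chiw /eta1 -trRD fcalcD.
  apply/eqP; congr (tre (fcalc _ _)); apply/funext => x.
  by case: leP => _; rewrite !(mulr0, mulr1, mul1r, mul0r, addr0, add0r).
have e2 : tre ((1%:M - Q) *m w) = eta2.
  have -> : 1%:M - Q = amp J (1%:M - pi) by rewrite ampB amp1.
  rewrite trRC tre_amp /eta2; congr tre.
  rewrite -(fcalc_cst hC) /pi -[X in _ - X](@scale1r K) -(rmorph1 rc) -scaleN1r scalerA mulN1r.
  rewrite -rmorphN fcalcZ fcalcD -{1}[ptr J w](fcalc_id hC) fcalcM //.
  congr fcalc; apply/funext => x.
  by case: leP => _; rewrite !(mulr0, mulr1, addr0, subrr, mulN1r).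
have e3 : tre ((1%:M - Q) *m (chi *m w)) <= eta2.
  rewrite -e2; apply: le_trRM.
    have := psd_gram (1%:M - Q).
    by rewrite adjB adj1 hQ mulmxBl mul1mx mulmxBr mulmx1 iQ subrr subr0.
  rewrite chiw -{2}[w]fcalc_id //; apply: fcalc_le => // x x0.
  by case: (c1 <= x); rewrite /= ?mul1r ?mul0r.
have cw : chi *m w = w *m chi by apply: fcalc_comm.
pose P := 1%:M - Q; have hP : adjm P = P by rewrite adjB adj1 hQ.
have QP : Q = 1%:M - P by rewrite subKr.
have pbound : 1 - tre (T *m w) <= eta1 + 2 * eta2.
  have h0 : 0 <= tre (P *m chi *m P *m w).
    by apply: psd_trRM => //; rewrite -{2}hP; apply: psd_conj.
  have eT : tre (T *m w) = tre (chi *m w) - tre (P *m chi *m w) -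
      (tre (chi *m P *m w) - tre (P *m chi *m P *m w)).
    rewrite /T QP; move: P chi {h0 hP QP hchi ichi chi1 pchi T pT T1 Tt0 Tw0 Tw1 chiw e1 e2 e3 cw}.
    move=> X Y; rewrite mulmxBl mul1mx mulmxBr mulmx1 mulmxBl !trRB.
    by rewrite !mulmxBl !trRB.
  have e4 : tre (chi *m P *m w) = tre (P *m (chi *m w)).
    by rewrite trRC mulmxA -cw trRC.
  by move: e3; rewrite -/P mulmxA => e3'; rewrite eT e4 mulmxA; lra.
have qbound : tre (T *m t) <= lam * c2 / c1.
  apply: le_trans (le_trRM pT t_le) _.
  rewrite -scalemxAr trRZ -mulrA ler_wpM2l //.
  have -> : tre (T *m amp J xi) = tre (amp J (pi *m xi *m pi) *m chi).
    by rewrite -!ampM -/Q /T -!mulmxA trRC -!mulmxA trRC -!mulmxA trRC !mulmxA.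
  have pxi : psdm (pi *m xi *m pi) by rewrite -{2}hpi; apply: psd_conj; case: sxi.
  apply: le_trans (_ : tre (amp J (pi *m xi *m pi) *m (rc c1^-1 *: w)) <= _).
    apply: le_trRM; first exact: psd_amp.
    rewrite -[X in lwle _ (_ *: X)]fcalc_id // fcalcZ; apply: fcalc_le => // x x0.
    case: (leP c1 x) => [h|_] /=; last by rewrite mulr_ge0 // invr_ge0 ltW.
    by rewrite mulrC ler_pdivlMr // mul1r.
  rewrite -scalemxAr trRZ mulrC ler_wpM2r ?invr_ge0 ?(ltW c10) // trRC tre_amp.
  have -> : tre (ptr J w *m (pi *m xi *m pi)) = tre (xi *m (pi *m ptr J w *m pi)).
    by rewrite trRC -!mulmxA trRC !mulmxA.
  apply: le_trans (_ : tre (xi *m (rc c2 *: 1%:M)) <= _).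
    apply: le_trRM; first by case: sxi.
    rewrite -{1}[ptr J w]fcalc_id // !fcalcM // -(fcalc_cst hC) fcalcZ.
    apply: fcalc_le => // x x0; case: (leP x c2) => /= h; rewrite ?mul1r ?mulr1 ?mul0r //.
  by rewrite -scalemxAr mulmx1 trRZ (proj2 sxi) mulr1.
apply: le_trans (sqf_test pw (proj1 st) pT T1) _.
have T'1 (X : 'M_N) : is_st X -> tre ((1%:M - T) *m X) = 1 - tre (T *m X).
  by case=> _ X1; rewrite mulmxBl mul1mx trRB X1.
rewrite !T'1 //; apply: lerD.
  rewrite -[X in _ <= X]mul1r; apply: ler_pM; rewrite ?sqrtr_ge0 //.
    by rewrite -(@sqrtr1 R) ler_sqrt.
  by rewrite ler_wsqrtr.
rewrite -[X in _ <= X]mulr1; apply: ler_pM; rewrite ?sqrtr_ge0 //.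
  by rewrite ler_wsqrtr.
by rewrite -[X in _ <= X]sqrtr1 ler_wsqrtr // gerBl.
Qed.

End TypicalTest.
End Blocks.
End Amplification.

(** * Permutation-invariant operators *)

Section Counting.
Variables (n : nat) (T : finType).

Definition cnt (f : 'I_n -> T) (x : T) : nat := #|[pred i | f i == x]|.

Lemma cnt_le f x : (cnt f x <= n)%N.
Proof. by apply: leq_trans (max_card _) _; rewrite card_ord. Qed.

Definition typ (f : 'I_n -> T) : {ffun T -> 'I_n.+1} := [ffun x => inord (cnt f x)].

Lemma typE f x : typ f x = cnt f x :> nat.
Proof. by rewrite ffunE inordK // ltnS cnt_le. Qed.

Lemma sum_cnt f : (\sum_x cnt f x = n)%N.
Proof.
rewrite -[RHS](card_ord n) -sum1_card (partition_big f xpredT) //=.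
by apply: eq_bigr => x _; rewrite /cnt -sum1_card; apply: eq_bigl.
Qed.

Lemma prod_cnt (S : comNzRingType) (f : 'I_n -> T) (w : T -> S) :
  \prod_i w (f i) = \prod_x w x ^+ cnt f x.
Proof.
rewrite (partition_big f xpredT) //=; apply: eq_bigr => x _.
rewrite /cnt -prodr_const; apply: eq_big => [i|i /eqP->//].
by rewrite inE.
Qed.

Lemma typ_perm (f g : 'I_n -> T) : typ f = typ g ->
  exists s : 'S_n, forall i, g i = f (s i).
Proof.
move=> h; have : perm_eq [tuple g i | i < n] [tuple f i | i < n].
  apply/allP => x _ /=; rewrite !count_map; apply/eqP.
  have e (u : 'I_n -> T) : count (preim u (pred1 x)) (Finite.enum 'I_n) = cnt u x.
    by rewrite /cnt cardE /enum_mem size_filter; apply: eq_count.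
  by rewrite !e -!typE h.
case/tuple_permP => s /val_inj /= e; exists s => i.
by move/(congr1 (fun t => tnth t i)): e; rewrite !tnth_mktuple.
Qed.

(** If [m >= l], the quotient of the factorials consists of [m - l] factors that are at least [l];
    otherwise its inverse consists of [l - m] factors that are at most [l]. *)
Lemma fact_expn_le l m : (l`! * l ^ m <= m`! * l ^ l)%N.
Proof.
have up a k : (a`! * a ^ k <= (a + k)`!)%N.
  elim: k => [|k IH]; first by rewrite addn0 muln1.
  rewrite expnSr mulnA addnS factS mulnC.
  by apply: leq_mul => //; rewrite ltnW // ltnS leq_addr.
have dn k a : ((a + k)`! <= a`! * (a + k) ^ k)%N.
  elim: k a => [|k IH] a; first by rewrite addn0 muln1.
  rewrite addnS -addSn; apply: leq_trans (IH a.+1) _.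
  rewrite factS [(a.+1 * _)%N]mulnC -mulnA leq_mul2l expnS leq_mul2r.
  by rewrite leq_addr !orbT.
have [lm|ml] := leqP l m.
  rewrite -(subnKC lm); move: (m - l)%N => k.
  by rewrite expnD mulnCA [X in (_ <= X)%N]mulnC leq_mul2l up orbT.
rewrite -(subnKC (ltnW ml)); move: (l - m)%N => k.
by rewrite expnD [X in (_ <= X)%N]mulnCA [X in (X <= _)%N]mulnC leq_mul2l dn orbT.
Qed.

End Counting.

(** * Multinomial coefficients and the likeliest type *)

Section Multinomial.
Variable T : finType.

Definition Nt n (t : T -> nat) : nat := #|[pred f : {ffun 'I_n -> T} | [forall x, cnt f x == t x]]|.

Lemma cntS n (f : 'I_n.+1 -> T) x :
  cnt f x = ((f ord0 == x) + cnt (fun i => f (lift ord0 i)) x)%N.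
Proof.
rewrite /cnt -!sum1_card big_mkcond big_ord_recl /= inE; congr (_ + _)%N.
by rewrite [RHS]big_mkcond; apply: eq_bigr => i _; rewrite !inE.
Qed.

Lemma Nt_fact n (t : T -> nat) : (\sum_x t x = n)%N ->
  (Nt n t * \prod_x (t x)`! = n`!)%N.
Proof.
elim: n t => [|n IH] t st.
  have t0 x : t x = 0%N by apply/eqP; move/eqP: st; rewrite sum_nat_eq0 => /forallP /(_ x).
  rewrite /Nt big1 => [|x _]; last by rewrite t0.
  rewrite muln1 fact0 (eq_card (B := predT)) ?card_ffun ?card_ord ?expn0 // => f.
  by rewrite !inE; apply/forallP => x; rewrite t0 -leqn0 cnt_le.
(* Deleting the first letter [x] lowers the composition by one at [x], which is the recursion of the
   multinomial coefficients. *)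
have step : Nt n.+1 t = (\sum_(x | t x > 0) Nt n (fun y => t y - (y == x)))%N.
  rewrite /Nt -sum1_card (partition_big (fun f : {ffun 'I_n.+1 -> T} => f ord0) (fun x => t x > 0)%N) /=; last first.
    by move=> f; rewrite inE => /forallP /(_ (f ord0)) /eqP <-; rewrite cntS eqxx.
  apply: eq_bigr => x tx; rewrite -sum1_card.
  pose g (f : {ffun 'I_n -> T}) : {ffun 'I_n.+1 -> T} :=
    [ffun i => if unlift ord0 i is Some j then f j else x].
  pose g' (f : {ffun 'I_n.+1 -> T}) : {ffun 'I_n -> T} := [ffun j => f (lift ord0 j)].
  have gE f y : cnt (g f) y = ((x == y) + cnt f y)%N.
    rewrite cntS ffunE unlift_none; congr (_ + _)%N.
    by congr (cnt _ _); apply/funext => j; rewrite ffunE liftK.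
  rewrite (reindex g) /=; last first.
    exists g' => [f _|f].
      by apply/ffunP => j; rewrite !ffunE liftK.
    rewrite inE => /andP[_ /eqP fx]; apply/ffunP => i; rewrite !ffunE.
    by case: unliftP => [j ->|->]; rewrite ?ffunE // fx.
  apply: eq_bigl => f; rewrite !inE ffunE unlift_none eqxx andbT.
  apply: eq_forallb => y; rewrite gE [y == x]eq_sym.
  case: (eqVneq x y) => [<-|_]; last by rewrite add0n subn0.
  by rewrite add1n -(prednK tx) eqSS subn1.
rewrite step big_distrl /= factS -{1}st big_distrl /= [RHS](bigID (fun x => t x > 0)%N) /=.
rewrite [X in (_ = _ + X)%N]big1 ?addn0 => [|x]; last by rewrite -eqn0Ngt => /eqP->.
apply: eq_bigr => x tx.
rewrite -(IH (fun y => t y - (y == x))%N); last first.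
  apply: succn_inj; rewrite -st (bigD1 x) //= [in RHS](bigD1 x) //= eqxx -add1n addnA subnKC //.
  by congr (_ + _)%N; apply: eq_bigr => y /negPf->; rewrite subn0.
rewrite [RHS]mulnCA; congr (_ * _)%N.
have e : ((t x)`! = t x * (t x).-1`!)%N by rewrite -{1}(prednK tx) factS prednK.
rewrite (bigD1 x) //= [in RHS](bigD1 x) //= eqxx subn1 mulnA e.
by congr (_ * _)%N; apply: eq_bigr => y /negPf->; rewrite subn0.
Qed.

(* The type t is the most likely one under the product of the distribution t / n. *)
Lemma Nt_mode n (t t' : T -> nat) : (\sum_x t x = n)%N -> (\sum_x t' x = n)%N ->
  (Nt n t' * \prod_x t x ^ t' x <= Nt n t * \prod_x t x ^ t x)%N.
Proof.
move=> st st'.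
have f0 (u : T -> nat) : (0 < \prod_x (u x)`!)%N by apply: prodn_gt0 => x; apply: fact_gt0.
rewrite -(leq_pmul2r (f0 t')) -(leq_pmul2r (f0 t)).
have -> : (Nt n t' * \prod_x t x ^ t' x * \prod_x (t' x)`! * \prod_x (t x)`! =
   n`! * \prod_x ((t x)`! * t x ^ t' x))%N.
  by rewrite -(Nt_fact st') big_split /=; ring.
have -> : (Nt n t * \prod_x t x ^ t x * \prod_x (t' x)`! * \prod_x (t x)`! =
   n`! * \prod_x ((t' x)`! * t x ^ t x))%N.
  by rewrite -(Nt_fact st) big_split /=; ring.
by rewrite leq_mul2l; apply/orP; right; apply: leq_prod => x _; apply: fact_expn_le.
Qed.

End Multinomial.

(** * Roots of unity as separating phases *)

Section RootOfUnity.
Variable F : numClosedFieldType.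

Lemma prim_root_ex n : (0 < n)%N -> exists z : F, n.-primitive_root z.
Proof.
move=> n0; pose p : {poly F} := 'X^n - 1.
have [r Dp] := closed_field_poly_normal p.
have p1 : lead_coef p = 1 by apply/eqP; rewrite -[_ == _]/(p \is monic) monicXnsubC.
have szp : size p = n.+1 by rewrite size_XnsubC.
rewrite p1 scale1r in Dp.
have rn1 : all n.-unity_root r.
  apply/allP => z; rewrite -root_prod_XsubC -Dp /p /root !hornerE subr_eq0.
  by move=> h; apply/unity_rootP/eqP.
have sz_r : (n < (size r).+1)%N by rewrite -(size_prod_XsubC r id) -Dp szp.
have [|z] := hasP (has_prim_root n0 rn1 _ sz_r); last by exists z.
rewrite -separable_prod_XsubC -Dp separable_Xn_sub_1 // pnatr_eq0 -lt0n.
exact: n0.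
Qed.

Lemma prim_root_conj n (z : F) : (0 < n)%N -> n.-primitive_root z -> Num.conj z = z^-1.
Proof.
move=> n0 pz; have zn : z ^+ n = 1 by apply: prim_expr_order.
have z1 : `|z| = 1.
  by apply/eqP; rewrite -(@pexpr_eq1 _ _ n) ?normr_ge0 // -normrX zn normr1.
have z0 : z != 0 by rewrite -normr_eq0 z1 oner_eq0.
by apply: (mulfI z0); rewrite -normCK z1 expr1n divff.
Qed.

(** Letter counts range over 0..n, so roots of order [n + 1] separate them. *)
Lemma sum_root_orth n (z : F) (a b : 'I_n.+1) : n.+1.-primitive_root z ->
  \sum_(k < n.+1) z ^+ (k * a) * Num.conj (z ^+ (k * b)) = n.+1%:R *+ (a == b).
Proof.
move=> pz; have n0 : (0 < n.+1)%N by [].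
have z0 : z != 0.
  by apply/eqP => z0; have := prim_expr_order pz; rewrite z0 expr0n /= => /eqP; rewrite eq_sym oner_eq0.
pose w := z ^+ a * (z ^+ b)^-1.
have e (k : 'I_n.+1) : z ^+ (k * a) * Num.conj (z ^+ (k * b)) = w ^+ k.
  rewrite rmorphXn /= (prim_root_conj n0 pz) /w exprMn mulnC exprM; congr (_ * _).
  by rewrite mulnC exprM -!exprVn.
under eq_bigr do rewrite e.
case: eqVneq => [ab|ab].
  rewrite /w ab divff ?expf_neq0 //; under eq_bigr do rewrite expr1n.
  by rewrite sumr_const card_ord mulr1n.
have w1 : w != 1.
  apply: contra_neq ab => /(canRL (divfK (expf_neq0 b z0))); rewrite mul1r => /eqP.
  rewrite (eq_prim_root_expr pz) !modn_small // => /eqP h.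
  exact: val_inj.
have wn : w ^+ n.+1 = 1.
  have e1 (c : nat) : (z ^+ c) ^+ n.+1 = 1 by rewrite exprAC (prim_expr_order pz) expr1n.
  by rewrite /w exprMn exprVn !e1 divr1.
apply/eqP; rewrite mulr0n -(mulrI_eq0 _ (lregP (_ : w - 1 != 0))) ?subr_eq0 //.
by rewrite -subrX1 wn subrr.
Qed.

End RootOfUnity.

Section QuadForm.
Context {R : realType} {K : cplx R}.
Local Notation rc := (rc K).
Variables (D : nat) (Z : 'M[K]_D).
Hypothesis pZ : psdm Z.

Definition qf m (A : 'M[K]_(D, m)) : R := tre (adjm A *m Z *m A).

Lemma qf_ge0 m (A : 'M[K]_(D, m)) : 0 <= qf A.
Proof. by apply: psd_trR; apply: psd_conj'. Qed.

Lemma qfZ m c (A : 'M[K]_(D, m)) : qf (c *: A) = re (`|c| ^+ 2) * qf A.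
Proof.
rewrite /qf adjZ -!scalemxAl -scalemxAr scalerA mulrC -normCK.
by rewrite -trRZ re_real // ger0_real // exprn_ge0.
Qed.

(** Cauchy-Schwarz, in the form that the [qf (A i - A j)] have a nonnegative sum over all pairs. *)
Lemma qf_sum (I : finType) m (A : I -> 'M[K]_(D, m)) :
  qf (\sum_i A i) <= #|I|%:R * \sum_i qf (A i).
Proof.
pose s B E : R := tre (adjm B *m Z *m (E : 'M[K]_(D, m))).
have qB B E : qf (B - E) = qf B - s B E - (s E B - qf E).
  by rewrite /qf /s adjB mulmxBl !mulmxBr !mulmxBl !trRB; lra.
have : 0 <= \sum_i \sum_j qf (A i - A j).
  by apply: sumr_ge0 => i _; apply: sumr_ge0 => j _; apply: qf_ge0.
under eq_bigr do under eq_bigr do rewrite qB.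
have sl E : \sum_j s E (A j) = s E (\sum_j A j).
  by rewrite /s mulmx_sumr trR_sum.
have sr E : \sum_j s (A j) E = s (\sum_j A j) E.
  by rewrite /s adj_sum !mulmx_suml trR_sum.
under eq_bigr do rewrite !sumrB sl sr sumr_const.
rewrite !sumrB sumr_const sr sl.
rewrite -[s _ _]/(qf (\sum_i A i)) sumrMnl !mulr_natl.
by move: (qf _) (_ *+ _) => x y; lra.
Qed.

End QuadForm.

Section Invariance.
Context {R : realType} {K : cplx R}.

(** Invariance is commutation with a permutation matrix, which functions of [A] inherit. *)
Lemma fcalc_inv D (f : 'I_D -> 'I_D) h (A : 'M[K]_D) : injective f -> adjm A = A ->
  (forall j k, A (f j) (f k) = A j k) -> forall j k, fcalc h A (f j) (f k) = fcalc h A j k.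
Proof.
move=> fI hA iA; pose B : 'M[K]_D := \matrix_(j, k) (f j == k)%:R.
have BX (X : 'M[K]_D) j k : (B *m X) j k = X (f j) k.
  rewrite mxE (bigD1 (f j)) //= mxE eqxx mul1r big1 ?addr0 // => m /negPf mf.
  by rewrite mxE eq_sym mf mul0r.
have XB (X : 'M[K]_D) j k : (X *m B) j (f k) = X j k.
  rewrite mxE (bigD1 k) //= mxE eqxx mulr1 big1 ?addr0 // => m /negPf mk.
  by rewrite mxE (inj_eq fI) mk mulr0.
have AB : A *m B = B *m A.
  have [g gK fgK] := injF_bij fI.
  by apply/matrixP => j k; rewrite -(fgK k) XB BX iA.
by move=> j k; rewrite -BX -(fcalc_comm h hA AB) XB.
Qed.

End Invariance.

(** * A polynomial i.i.d. bound for invariant quadratic forms *)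

Section Universal.
Context {R : realType} {K : cplx R}.
Local Notation rc := (rc K).
Variables (d n D : nat) (l : 'I_D -> 'I_n -> 'I_d) (l' : ('I_n -> 'I_d) -> 'I_D).
Hypothesis hl : labeling l l'.
Local Notation T := ('I_d * 'I_d)%type.
Local Notation Ty := {ffun T -> 'I_n.+1}.

Definition relab (s : 'S_n) (j : 'I_D) : 'I_D := l' (fun i => l j (s i)).

Lemma relabE s j i : l (relab s j) i = l j (s i).
Proof. by rewrite /relab (proj2 hl). Qed.

Lemma relabM s s' j : relab s (relab s' j) = relab (s * s')%g j.
Proof. by apply: (labeling_inj hl) => i; rewrite !relabE permM. Qed.

Lemma relab_inj s : injective (relab s).
Proof.
move=> j k e; apply: (labeling_inj hl) => i.
by rewrite -(permKV s i) -!relabE e.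
Qed.

Definition pr (j k : 'I_D) (i : 'I_n) : T := (l j i, l k i).
Definition ty j k : Ty := typ (pr j k).

Lemma ty_relab j k j' k' : ty j k = ty j' k' ->
  exists s, j' = relab s j /\ k' = relab s k.
Proof.
move=> /typ_perm[s h]; exists s.
by split; apply: (labeling_inj hl) => i; rewrite relabE; case: (h i).
Qed.

(** Indicator of one orbit of index pairs under permutations of the copies; these matrices span the
    invariant ones. *)
Definition Mt (t : Ty) : 'M[K]_D := \matrix_(j, k) (ty j k == t)%:R.

Lemma sum_Mt (c : Ty -> K) j k : (\sum_t c t *: Mt t) j k = c (ty j k).
Proof.
rewrite summxE (bigD1 (ty j k)) //= !mxE eqxx mulr1 big1 ?addr0 // => t.
by rewrite !mxE eq_sym => /negPf->; rewrite mulr0.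
Qed.

Lemma inv_decomp (H : 'M[K]_D) : (forall s j k, H (relab s j) (relab s k) = H j k) ->
  exists c : Ty -> K, H = \sum_t c t *: Mt t.
Proof.
move=> iH; exists (fun t => if [pick jk | ty jk.1 jk.2 == t] is Some jk then H jk.1 jk.2 else 0).
apply/matrixP => j k; rewrite sum_Mt.
case: pickP => [[j' k'] /= /eqP /ty_relab[s [-> ->]]|/(_ (j, k))]; first by rewrite iH.
by rewrite /= eqxx.
Qed.

Definition ntyp (t : Ty) : nat := #|[pred jk | ty jk.1 jk.2 == t]|.

Lemma sum_pairs (V : nmodType) (F : {ffun 'I_n -> T} -> V) :
  \sum_j \sum_k F [ffun i => pr j k i] = \sum_f F f.
Proof.
rewrite pair_big /= [RHS](reindex (fun jk => [ffun i => pr jk.1 jk.2 i])) //.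
exists (fun f : {ffun 'I_n -> T} => (l' (fun i => (f i).1), l' (fun i => (f i).2))) => [[j k] _|f _] /=.
  by congr (_, _); apply: (labeling_inj hl) => i; rewrite (proj2 hl) ffunE.
by apply/ffunP => i; rewrite ffunE /pr !(proj2 hl); case: (f i).
Qed.

Lemma ntypE (t : Ty) : ntyp t = Nt n (fun x => t x).
Proof.
rewrite /ntyp /Nt -!sum1_card.
transitivity (\sum_j \sum_k (if ty j k == t then 1 else 0))%N.
  by rewrite pair_big /= big_mkcond; apply: eq_bigr => -[j k] _; rewrite inE.
rewrite [RHS]big_mkcond -sum_pairs; apply: eq_bigr => j _; apply: eq_bigr => k _.
rewrite !inE /=; congr (if _ then _ else _).
have e x : cnt [ffun i => pr j k i] x = cnt (pr j k) x.
  by congr (cnt _ x); apply/funext => i; rewrite ffunE.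
apply/eqP/forallP => [<- x|h]; first by rewrite e typE.
by apply/ffunP => x; apply: val_inj; rewrite /= typE -e (eqP (h x)).
Qed.

Lemma ntyp0 (t : Ty) : (\sum_x t x)%N != n -> Mt t = 0.
Proof.
move=> h; apply/matrixP => j k; rewrite !mxE.
have [e|//] := eqVneq (ty j k) t; case/eqP: h; rewrite -e -[RHS](sum_cnt (pr j k)).
by apply: eq_bigr => x _; rewrite typE.
Qed.

Lemma sum_by_type (V : nmodType) (F : Ty -> V) :
  \sum_j \sum_k F (ty j k) = \sum_t F t *+ ntyp t.
Proof.
rewrite pair_big /= (partition_big (fun jk => ty jk.1 jk.2) xpredT) //=.
apply: eq_bigr => t _; rewrite -sumr_const; apply: eq_big => [jk|jk /eqP->//].
by rewrite inE.
Qed.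

Lemma tpow_types (w : T -> K) :
  tpow l l (\matrix_(x, y) w (x, y)) = \sum_(t : Ty) (\prod_x w x ^+ t x) *: Mt t.
Proof.
apply/matrixP => j k; rewrite sum_Mt mxE.
under eq_bigr do rewrite mxE.
rewrite (prod_cnt (pr j k)); apply: eq_bigr => x _.
by rewrite typE.
Qed.

Lemma sum_multinomial (p : T -> R) :
  \sum_(t : Ty) (\prod_x p x ^+ t x) *+ ntyp t = (\sum_x p x) ^+ n.
Proof.
rewrite -sum_by_type.
transitivity (\sum_j \sum_k \prod_i p (l j i, l k i)).
  apply: eq_bigr => j _; apply: eq_bigr => k _; rewrite (prod_cnt (pr j k)).
  by apply: eq_bigr => x _; rewrite typE.
under eq_bigr do rewrite (sum_prod_labeling (fun i => fun y => p (_, y)) hl).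
rewrite (sum_prod_labeling (fun=> fun x => \sum_y p (x, y)) hl) prodr_const card_ord.
by rewrite pair_big; congr (_ ^+ _); apply: eq_bigr => -[].
Qed.

Lemma card_Ty : #|{: Ty}| = ((n.+1) ^ (d * d))%N.
Proof. by rewrite card_ffun card_ord card_prod card_ord. Qed.

(** Under the distribution [t / n] the class of [t] is the likeliest one, by [Nt_mode], so its mass
    is at least one over the number of types. The power of [n] clears denominators. *)
Lemma type_mass (t : Ty) : (\sum_x t x)%N = n ->
  (n%:R ^+ n <= #|{: Ty}|%:R * ((\prod_x (t x)%:R ^+ t x) *+ ntyp t) :> R).
Proof.
move=> st; rewrite -{1}st natr_sum -sum_multinomial mulr_natl -sumr_const.
apply: ler_sum => t' _; have [st'|/ntyp0 h] := eqVneq (\sum_x t' x)%N n; last first.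
  suff -> : ntyp t' = 0%N by rewrite mulr0n mulrn_wge0 // prodr_ge0.
  apply: eq_card0 => -[j k]; apply/negbTE; rewrite inE /=; apply/negP => e.
  by move/matrixP: h => /(_ j k); rewrite !mxE e => /eqP; rewrite oner_eq0.
rewrite -[X in X <= _]mulr_natl -[X in _ <= X]mulr_natl !ntypE.
have e (u : Ty) : \prod_x (t x)%:R ^+ u x = (\prod_x t x ^ u x)%N%:R :> R.
  by rewrite natr_prod; apply: eq_bigr => x _; rewrite natrX.
by rewrite !e -!natrM ler_nat; apply: Nt_mode.
Qed.

Section Family.
Variables (z : K) (Z : 'M[K]_D).
Hypotheses (pz : n.+1.-primitive_root z) (pZ : psdm Z) (n0 : (0 < n)%N).

Definition amp_of (t : Ty) (x : T) : R := Num.sqrt ((t x)%:R / n%:R).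

(** Read as a vector on two copies of the system, a pure state with squared amplitudes [t / n] and
    freely chosen phases. *)
Definition wmx (t ph : Ty) : 'M[K]_d :=
  \matrix_(x, y) (rc (amp_of t (x, y)) * z ^+ ph (x, y)).

Let c t (ph t' : Ty) : K := \prod_x (rc (amp_of t x) * z ^+ ph x) ^+ t' x.
Let a t (t' : Ty) : R := \prod_x amp_of t x ^+ t' x.

Lemma sum_phases t (t1 t2 : Ty) : \sum_(ph : Ty) Num.conj (c t ph t1) * c t ph t2 =
  rc (a t t1 * a t t2 * (n.+1 ^ #|{: T}|)%:R) *+ (t1 == t2).
Proof.
have cE ph t' : c t ph t' = rc (a t t') * \prod_x z ^+ (ph x * t' x).
  rewrite /c /a rmorph_prod -big_split; apply: eq_bigr => x _.
  by rewrite exprMn -exprM rmorphXn.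
transitivity (rc (a t t1 * a t t2) *
    \sum_(ph : Ty) \prod_x (z ^+ (ph x * t2 x) * Num.conj (z ^+ (ph x * t1 x)))).
  rewrite mulr_sumr; apply: eq_bigr => ph _.
  rewrite !cE big_split /= -(rmorph_prod Num.conj) (rmorphM Num.conj) /= conj_rc (rmorphM rc).
  by ring.
rewrite -(bigA_distr_bigA (fun (x : T) (k : 'I_n.+1) => z ^+ (k * t2 x) * Num.conj (z ^+ (k * t1 x)))).
under eq_bigr do rewrite (sum_root_orth _ _ pz).
have [->|ne] := eqVneq t1 t2.
  under eq_bigr do rewrite eqxx mulr1n.
  by rewrite prodr_const mulr1n natrX !rmorphM rmorphXn rmorph_nat.
have [x nx] : exists x, t2 x != t1 x.
  apply: contrapT => h; case/eqP: ne; apply/ffunP => x.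
  by apply/eqP/negPn/negP => ne; apply: h; exists x; rewrite eq_sym.
by rewrite (bigD1 x) //= (negPf nx) mulr0n mul0r mulr0.
Qed.

(** Summing over the phases removes the cross terms between types; of the remaining nonnegative
    terms only that of [t] is kept. *)
Lemma qf_type_le (t : Ty) :
  (\prod_x ((t x)%:R / n%:R) ^+ t x) * qf Z (Mt t) <= \sum_ph qf Z (tpow l l (wmx t ph)).
Proof.
have e ph : tpow l l (wmx t ph) = \sum_t' c t ph t' *: Mt t'.
  by rewrite -(tpow_types (fun x => rc (amp_of t x) * z ^+ ph x)).
have eq ph : qf Z (tpow l l (wmx t ph)) = re (\sum_t1 \sum_t2
    Num.conj (c t ph t1) * c t ph t2 * \tr (adjm (Mt t1) *m Z *m Mt t2)).
  rewrite /qf e /tre adj_sum mulmx_suml mulmx_suml raddf_sum /=; congr re.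
  apply: eq_bigr => t1 _; rewrite mulmx_sumr raddf_sum /=; apply: eq_bigr => t2 _.
  by rewrite adjZ -!scalemxAl -scalemxAr scalerA mxtraceZ.
under [X in _ <= X]eq_bigr do rewrite eq.
rewrite -re_sum exchange_big /=.
have -> : \sum_t1 \sum_(ph : Ty) \sum_t2
     Num.conj (c t ph t1) * c t ph t2 * \tr (adjm (Mt t1) *m Z *m Mt t2) =
   \sum_t1 rc (a t t1 * a t t1 * (n.+1 ^ #|{: T}|)%:R) * \tr (adjm (Mt t1) *m Z *m Mt t1).
  apply: eq_bigr => t1 _; rewrite exchange_big (bigD1 t1) //= -mulr_suml sum_phases eqxx mulr1n.
  rewrite big1 ?addr0 // => t2 ne; rewrite -mulr_suml sum_phases eq_sym (negPf ne).
  by rewrite mulr0n mul0r.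
rewrite re_sum (bigD1 t) //= -[X in X <= _]addr0; apply: lerD; last first.
  by apply: sumr_ge0 => t1 _; rewrite reZ mulr_ge0 ?qf_ge0 // mulr_ge0 // -expr2 sqr_ge0.
rewrite reZ -/(tre _) -/(qf Z (Mt t)); apply: ler_wpM2r; first exact: qf_ge0.
have -> : \prod_x ((t x)%:R / n%:R : R) ^+ t x = a t t * a t t.
  rewrite -big_split /=; apply: eq_bigr => x _.
  by rewrite -expr2 exprAC sqr_sqrtr // divr_ge0.
by rewrite ler_peMr // -?expr2 ?sqr_ge0 // ler1n expn_gt0.
Qed.

Lemma wmx_st (t ph : Ty) : (\sum_x t x)%N = n -> is_st (wmx t ph *m adjm (wmx t ph)).
Proof.
move=> st; split; first exact: psd_gram'.
rewrite /tre /mxtrace re_sum.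
transitivity (\sum_x \sum_y (t (x, y))%:R / n%:R : R).
  apply: eq_bigr => x _; rewrite mxE re_sum; apply: eq_bigr => y _.
  have z1 : `|z| = 1.
    apply/eqP; rewrite -(@pexpr_eq1 _ _ n.+1) ?normr_ge0 //.
    by rewrite -normrX (prim_expr_order pz) normr1.
  rewrite adjE -normCK mxE normrM normrX z1 expr1n mulr1 ger0_norm ?rc_ge0 ?sqrtr_ge0 //.
  by rewrite -rmorphXn rcK sqr_sqrtr // divr_ge0.
rewrite pair_big /= -mulr_suml.
have -> : \sum_p (t (p.1, p.2))%:R = n%:R :> R.
  by rewrite -[in RHS]st natr_sum; apply: eq_bigr => -[].
by rewrite divff // pnatr_eq0 -lt0n.
Qed.

(** Cauchy-Schwarz over the types costs one factor [#|Ty|] and the mass of a type class the other.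
    The orbit size that comes with the latter is absorbed by the Hilbert-Schmidt norm of [H]. *)
Lemma qf_inv_le (H : 'M[K]_D) : (forall s j k, H (relab s j) (relab s k) = H j k) ->
  qf Z H <= #|{: Ty}|%:R ^+ 2 * tre (adjm H *m H) *
    \sum_(t : Ty | (\sum_x t x)%N == n) \sum_ph qf Z (tpow l l (wmx t ph)).
Proof.
move=> /inv_decomp[cf eH].
have normH : tre (adjm H *m H) = \sum_t re (`|cf t| ^+ 2) *+ ntyp t.
  rewrite -sum_by_type exchange_big /tre /mxtrace re_sum; apply: eq_bigr => k _.
  rewrite mxE re_sum; apply: eq_bigr => j _.
  by rewrite adjE eH sum_Mt mulrC -normCK.
rewrite eH; apply: le_trans (qf_sum pZ _) _; rewrite -eH.
rewrite expr2 -!mulrA; apply: ler_wpM2l => //.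
rewrite (bigID (fun t : Ty => (\sum_x t x)%N == n)) /= [X in _ + X]big1 ?addr0; last first.
  by move=> t ht; rewrite ntyp0 // scaler0 /qf mulmx0 /tre mxtrace0 re0.
rewrite mulr_sumr mulr_sumr; apply: ler_sum => t /eqP st.
rewrite qfZ //; have tm := type_mass st.
set S := \sum_ph _; have S0 : 0 <= S by apply: sumr_ge0 => ph _; apply: qf_ge0.
have q0 := qf_ge0 pZ (Mt t).
have c0 : 0 <= re (`|cf t| ^+ 2) by rewrite re_ge0 // exprn_ge0.
have nn : 0 < (n%:R : R) ^+ n by rewrite exprn_gt0 // ltr0n.
have h1 : qf Z (Mt t) <= #|{: Ty}|%:R * (ntyp t)%:R * S.
  rewrite -(ler_pM2l nn); have h2 := qf_type_le t.
  apply: le_trans (ler_wpM2r q0 tm) _; rewrite -[_ *+ ntyp t]mulr_natr.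
  have -> : n%:R ^+ n * (#|{: Ty}|%:R * (ntyp t)%:R * S) =
     #|{: Ty}|%:R * (ntyp t)%:R * (n%:R ^+ n * S) by ring.
  rewrite (_ : _ * qf Z (Mt t) = #|{: Ty}|%:R * (ntyp t)%:R *
      (\prod_x (t x)%:R ^+ t x * qf Z (Mt t))); last by ring.
  apply: ler_wpM2l; first by rewrite mulr_ge0.
  have -> : \prod_x (t x)%:R ^+ t x = n%:R ^+ n * \prod_x ((t x)%:R / n%:R : R) ^+ t x.
    have -> : (n%:R : R) ^+ n = \prod_x (n%:R : R) ^+ t x by rewrite prodrXr st.
    rewrite -big_split /=; apply: eq_bigr => x _.
    by rewrite -exprMn mulrC divfK // pnatr_eq0 -lt0n.
  by rewrite -mulrA; apply: ler_wpM2l => //; apply: ltW.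
apply: le_trans (ler_wpM2l c0 h1) _.
have h3 : re (`|cf t| ^+ 2) * (ntyp t)%:R <= tre (adjm H *m H).
  rewrite normH (bigD1 t) //= mulr_natr lerDl; apply: sumr_ge0 => t' _.
  by rewrite mulrn_wge0 // re_ge0 // exprn_ge0.
rewrite [X in X <= _](_ : _ = #|{: Ty}|%:R * (re (`|cf t| ^+ 2) * (ntyp t)%:R * S)); last by ring.
by apply: ler_wpM2l => //; apply: ler_wpM2r.
Qed.

End Family.

(* Types replace the symmetric group: on an invariant vector [Z] is bounded by its
   values on orbit sums, and each orbit sum is a phase average of powers [wmx^n]. *)
Lemma universal_family : (0 < n)%N -> exists (F : finType) (sigma : F -> 'M[K]_d),
  [/\ (#|F| <= (n.+1 ^ (d * d)) ^ 2)%N, forall k, is_st (sigma k) &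
   forall (Z : 'M[K]_D) (chi : 'cV[K]_D), psdm Z ->
     (forall s j k, Z (relab s j) (relab s k) = Z j k) ->
     qf Z chi <= (n.+1 ^ (d * d))%:R ^+ 2 * qf 1%:M chi *
       \sum_k tre (Z *m tpow l l (sigma k))].
Proof.
move=> n0; have [z pz] := prim_root_ex K (ltn0Sn n).
pose A : pred (Ty * Ty) := [pred tp : Ty * Ty | (\sum_x tp.1 x)%N == n].
pose W (tp : Ty * Ty) := wmx z tp.1 tp.2.
exists 'I_#|A|, (fun k => W (enum_val k) *m adjm (W (enum_val k))).
split.
- rewrite card_ord; apply: leq_trans (max_card _) _.
  by rewrite card_prod card_Ty expnS expn1.
- by move=> k; apply: (wmx_st pz) => //; apply/eqP; have := enum_valP k.
move=> Z chi pZ iZ.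
pose ch s : 'cV[K]_D := \col_j chi (relab s j) 0.
pose rho : 'M[K]_D := \sum_(s : 'S_n) rc (n`!%:R)^-1 *: (ch s *m adjm (ch s)).
have prho : psdm rho.
  by apply: psd_sum => s _; apply: psdZ; [rewrite rc_ge0 invr_ge0|apply: psd_gram'].
have irho s j k : rho (relab s j) (relab s k) = rho j k.
  rewrite !summxE [RHS](reindex_inj (mulIg s)) /=; apply: eq_bigr => s' _.
  rewrite !mxE !big_ord1 !mxE; congr (_ * (_ * Num.conj _)); by rewrite relabM.
(* The root of the twirl of [chi] is an invariant matrix on which every invariant form takes the
   same value as on [chi]; as a vector it is a symmetric purification of the twirl. *)
pose H := fcalc Num.sqrt rho.
have hH : adjm H = H by apply: fcalc_adj.
have HH : H *m H = rho by apply: fun_sqrtM.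
have iH s j k : H (relab s j) (relab s k) = H j k.
  by apply: fcalc_inv; [apply: relab_inj|case: prho|move=> *; apply: irho].
have qch s (Y : 'M[K]_D) : (forall s j k, Y (relab s j) (relab s k) = Y j k) ->
    qf Y (ch s) = qf Y chi.
  move=> iY; rewrite /qf /tre /mxtrace !big_ord1; congr re.
  rewrite !mxE [RHS](reindex_inj (relab_inj (s := s))); apply: eq_bigr => k _ /=.
  rewrite !mxE [in RHS](reindex_inj (relab_inj (s := s))) /=; congr (_ * _).
  by apply: eq_bigr => j _; rewrite !mxE iY.
have avg (Y : 'M[K]_D) : (forall s j k, Y (relab s j) (relab s k) = Y j k) ->
    tre (Y *m rho) = qf Y chi.
  move=> iY; rewrite /rho mulmx_sumr trR_sum.
  under eq_bigr do rewrite -scalemxAr trRZ mulmxA trRC mulmxA -/(qf Y (ch _)) qch //.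
  by rewrite sumr_const card_Sn -mulrnAl -(mulr_natr _ n`!) mulVf ?mul1r // pnatr_eq0 -lt0n fact_gt0.
have qH : qf Z H = qf Z chi by rewrite -(avg _ iZ) -HH /qf hH trRC mulmxA [RHS]trRC.
have i1 s j k : (1%:M : 'M[K]_D) (relab s j) (relab s k) = (1%:M : 'M[K]_D) j k.
  by rewrite !mxE (inj_eq (relab_inj (s := s))).
have q1 : tre (adjm H *m H) = qf 1%:M chi by rewrite -(avg _ i1) mul1mx hH HH.
have := qf_inv_le pz pZ n0 iH; rewrite qH q1 card_Ty => /le_trans; apply.
rewrite ler_wpM2l // ?mulr_ge0 ?qf_ge0 ?exprn_ge0 //; first exact: psd1.
rewrite pair_big_dep /= -(big_enum_val (fun tp => tre (Z *m tpow l l (W tp *m adjm (W tp))))) /=.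
rewrite (eq_bigl (mem A)) => [|tp]; last by rewrite andbT.
by apply: ler_sum => tp _; rewrite (tpowM _ _ _ _ hl) -adj_tpow /qf -mulmxA trRC mulmxA lexx.
Qed.

End Universal.

(** * Cutting a Stinespring dilation *)

Section OneShot.
Context {R : realType} {K : cplx R}.
Local Notation rc := (rc K).

Definition nsq m p (A : 'M[K]_(m, p)) : R := tre (adjm A *m A).

Lemma nsq_ge0 m p (A : 'M[K]_(m, p)) : 0 <= nsq A.
Proof. exact/psd_trR/psd_gram. Qed.

Lemma tre_le_conj m p (A B : 'M[K]_m) (u : 'M[K]_(m, p)) : lwle A B ->
  tre (adjm u *m A *m u) <= tre (adjm u *m B *m u).
Proof. by move=> h; apply/loewner_tr/loewner_conj'. Qed.

Lemma nsq_sum_orth (X : finType) m p (Pi : X -> 'M[K]_m) (z : X -> 'M[K]_(m, p)) :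
  (forall x, adjm (Pi x) = Pi x) -> (forall x y, Pi x *m Pi y = if x == y then Pi x else 0) ->
  nsq (\sum_x Pi x *m z x) = \sum_x nsq (Pi x *m z x).
Proof.
move=> hP oP; rewrite /nsq adj_sum mulmx_suml trR_sum; apply: eq_bigr => x _.
rewrite mulmx_sumr trR_sum (bigD1 x) //= big1 ?addr0 // => y yx.
by rewrite adjM hP -mulmxA [Pi x *m _]mulmxA oP eq_sym (negPf yx) mul0mx mulmx0 /tre mxtrace0 re0.
Qed.

(** With [q] the sum on the left, expand the nonnegative sum of [nsq (th w_i - A_i^* q)]. This
    stands in for the operator norm of a row of blocks. *)
Lemma nsq_row_le a m k p (A : 'I_a -> 'M[K]_(m, k)) (w : 'I_a -> 'M[K]_(k, p)) (th : R) :
  0 < th -> lwle (\sum_i A i *m adjm (A i)) (rc th *: 1%:M) ->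
  nsq (\sum_i A i *m w i) <= th * \sum_i nsq (w i).
Proof.
move=> th0 hA; set q := \sum_i _.
have e1 : \sum_i tre (adjm q *m (A i *m w i)) = nsq q.
  by rewrite -trR_sum -mulmx_sumr.
have e2 : \sum_i nsq (adjm (A i) *m q) <= th * nsq q.
  have -> : \sum_i nsq (adjm (A i) *m q) = tre (adjm q *m (\sum_i A i *m adjm (A i)) *m q).
    rewrite mulmx_sumr mulmx_suml trR_sum; apply: eq_bigr => i _.
    by rewrite /nsq adjM adjK !mulmxA.
  apply: le_trans (tre_le_conj _ hA) _.
  by rewrite -scalemxAr mulmx1 -scalemxAl trRZ.
have : 0 <= \sum_i nsq (rc th *: w i - adjm (A i) *m q).
  by apply: sumr_ge0 => i _; apply: nsq_ge0.
have -> : \sum_i nsq (rc th *: w i - adjm (A i) *m q) =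
    th ^+ 2 * \sum_i nsq (w i) - 2 * th * \sum_i tre (adjm q *m (A i *m w i)) +
    \sum_i nsq (adjm (A i) *m q).
  rewrite !mulr_sumr -sumrB -big_split; apply: eq_bigr => i _ /=.
  rewrite /nsq adjB adjZ conj_rc adjM adjK mulmxBl !mulmxBr !trRB -!scalemxAl -!scalemxAr.
  rewrite !trRZ; have -> : tre (adjm (w i) *m (adjm (A i) *m q)) = tre (adjm q *m (A i *m w i)).
    by rewrite -trR_adj !adjM !adjK mulmxA.
  by rewrite !mulmxA; lra.
rewrite e1 => h; rewrite -(ler_pM2l th0); move: e2 h; rewrite expr2; lra.
Qed.

Section Star.
Variables (a N e m : nat) (J : 'I_a -> 'M[K]_(N, e)) (Om : 'M[K]_(N, m)) (X : finType).
Variables (Pi : X -> 'M[K]_e) (T : X -> 'M[K]_N) (th y : X -> R).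
Hypothesis bJ : blocks J.
Let w := Om *m adjm Om.
Hypotheses (hPi : forall x, adjm (Pi x) = Pi x)
  (oPi : forall x x', Pi x *m Pi x' = if x == x' then Pi x else 0)
  (hT : forall x, adjm (T x) = T x) (TwT : forall x, T x *m w *m T x = T x)
  (Ty : forall x, lwle (T x) (rc (y x) *: 1%:M)) (th0 : forall x, 0 < th x)
  (Pith : forall x, lwle (Pi x *m ptr J w *m Pi x) (rc (th x) *: 1%:M)).

(** One factor of [w = Om Om^*] goes to the left, where the block row [Pi x J_i^* Om] has Gram sum
    [Pi x (ptr J w) Pi x]; the other goes to the right, where [T w T = T] leaves only the weight
    [T x]. Orthogonality of the [Pi x] makes the bins add up without cross terms. *)
Lemma star_bound p (u : 'I_a -> 'M[K]_(m, p)) :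
  nsq (\sum_i adjm (J i) *m (\sum_x amp J (Pi x) *m w *m T x) *m Om *m u i) <=
  (\sum_x th x * y x) * \sum_i nsq (Om *m u i).
Proof.
have JA i x : adjm (J i) *m amp J (Pi x) = Pi x *m adjm (J i).
  have := congr1 adjm (amp_J bJ (Pi x) i).
  by rewrite !adjM adj_amp hPi.
have -> : \sum_i adjm (J i) *m (\sum_x amp J (Pi x) *m w *m T x) *m Om *m u i =
    \sum_x Pi x *m (\sum_i adjm (J i) *m Om *m (adjm Om *m T x *m Om *m u i)).
  under eq_bigr do rewrite mulmx_sumr !mulmx_suml.
  rewrite exchange_big; apply: eq_bigr => x _; rewrite mulmx_sumr; apply: eq_bigr => i _.
  by rewrite /w !mulmxA JA ?mulmxA.
rewrite nsq_sum_orth // mulr_suml; apply: ler_sum => x _.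
rewrite mulmx_sumr; under eq_bigr do rewrite mulmxA.
rewrite -[th x * y x * _]mulrA.
apply: le_trans (nsq_row_le (A := fun i => Pi x *m (adjm (J i) *m Om))
  (fun i => adjm Om *m T x *m Om *m u i) (th0 x) _) _.
  have -> : \sum_i Pi x *m (adjm (J i) *m Om) *m adjm (Pi x *m (adjm (J i) *m Om)) =
     Pi x *m ptr J w *m Pi x; last exact: Pith.
  rewrite /ptr mulmx_sumr mulmx_suml; apply: eq_bigr => i _.
  by rewrite !adjM adjK hPi /w !mulmxA.
apply: ler_wpM2l; first exact: ltW.
rewrite mulr_sumr; apply: ler_sum => i _.
rewrite {1}/nsq.
have -> : adjm (adjm Om *m T x *m Om *m u i) *m (adjm Om *m T x *m Om *m u i) =
    adjm (Om *m u i) *m T x *m (Om *m u i).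
  by rewrite -[in RHS](TwT x) /w !adjM adjK hT !mulmxA.
apply: le_trans (tre_le_conj _ (Ty x)) _.
by rewrite -scalemxAr mulmx1 -scalemxAl trRZ.
Qed.

End Star.

Section Cut.
Variables (N : nat) (w Q : 'M[K]_N) (z0 : R).
Hypotheses (pw : psdm w) (hQ : adjm Q = Q) (iQ : Q *m Q = Q) (z0p : 0 < z0).
Let Zm := Q *m w *m Q.
(** The inverse of the compression [Zm] above the threshold. Then [Q w cutT] is the projection
    [cutP], so that the cut contains a factor [w], as [star_bound] needs. *)
Definition cutT := fcalc (fun z => if z0 <= z then z^-1 else 0) Zm.
Definition cutP := fcalc (fun z => (z0 <= z)%R%:R) Zm.

Lemma pZm : psdm Zm. Proof. by rewrite /Zm -{2}hQ; apply: psd_conj. Qed.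
Let hZ := proj1 pZm.
Let nz (z : R) : z0 <= z -> z != 0.
Proof. by move=> h; rewrite gt_eqF // (lt_le_trans z0p). Qed.

(** A function vanishing at 0 contains a factor [Zm], and with it a factor [Q]. *)
Lemma cut_f (f : R -> R) : f 0 = 0 -> Q *m fcalc f Zm = fcalc f Zm.
Proof.
move=> f0; have -> : fcalc f Zm = Zm *m fcalc (fun z => f z / z) Zm.
  rewrite -[X in _ = X *m _](fcalc_id hZ) fcalcM //; apply: eq_fcalc; first exact: pZm.
  by move=> x _; have [->|x0] := eqVneq x 0; rewrite ?f0 ?mul0r // mulrC divfK.
by rewrite mulmxA /Zm !mulmxA iQ.
Qed.

Lemma cut_fr (f : R -> R) : f 0 = 0 -> fcalc f Zm *m Q = fcalc f Zm.
Proof. by move=> /cut_f /(congr1 adjm); rewrite adjM hQ !fcalc_adj. Qed.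

Lemma cutT_adj : adjm cutT = cutT. Proof. exact: fcalc_adj. Qed.
Lemma cutP_adj : adjm cutP = cutP. Proof. exact: fcalc_adj. Qed.

Let T0 : (if z0 <= 0 then 0^-1 else 0) = 0 :> R.
Proof. by rewrite leNgt z0p. Qed.
Let P0 : (z0 <= 0)%R%:R = 0 :> R.
Proof. by rewrite leNgt z0p. Qed.

Lemma cutQT : Q *m cutT = cutT. Proof. exact: cut_f T0. Qed.
Lemma cutTQ : cutT *m Q = cutT. Proof. exact: cut_fr T0. Qed.

Lemma cutTwT : cutT *m w *m cutT = cutT.
Proof.
have -> : cutT *m w *m cutT = cutT *m Zm *m cutT.
  by rewrite /Zm !mulmxA cutTQ -[_ *m Q *m cutT]mulmxA cutQT.
rewrite -{1}(fcalc_id hZ) !fcalcM //; congr fcalc; apply/funext => z.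
by case: ifP => h; rewrite ?mul0r // mulVf ?nz // mul1r.
Qed.

Lemma cutP_def : Q *m w *m cutT = cutP.
Proof.
have -> : Q *m w *m cutT = Zm *m cutT by rewrite /Zm -[RHS]mulmxA cutQT.
rewrite -{1}(fcalc_id hZ) fcalcM //; congr fcalc; apply/funext => z.
by case: ifP => h; rewrite ?mulr0 // divff ?nz.
Qed.

Lemma cutT_le : lwle cutT (rc z0^-1 *: 1%:M).
Proof.
rewrite -(fcalc_cst hZ) fcalcZ; apply: fcalc_le; first exact: pZm.
move=> z _; rewrite mulr1; case: ifP => h; last by rewrite invr_ge0 ltW.
by rewrite lef_pV2 // posrE (lt_le_trans z0p).
Qed.

Lemma cutP_idem : cutP *m cutP = cutP.
Proof.
rewrite fcalcM //; congr fcalc; apply/funext => z.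
by case: (z0 <= z); rewrite /= ?mulr1 ?mulr0.
Qed.

Lemma cutQP : Q *m cutP = cutP. Proof. exact: cut_f. Qed.
Lemma cutPQ : cutP *m Q = cutP. Proof. exact: cut_fr. Qed.

Definition cutR := Q - cutP.

Lemma cutR_adj : adjm cutR = cutR. Proof. by rewrite adjB hQ cutP_adj. Qed.

Lemma cutR_idem : cutR *m cutR = cutR.
Proof. by rewrite /cutR mulmxBl !mulmxBr iQ cutQP cutPQ cutP_idem subrr subr0. Qed.

Lemma cutRwR : lwle (cutR *m w *m cutR) (rc z0 *: cutR).
Proof.
have RE : cutR = (1%:M - cutP) *m Q by rewrite mulmxBl mul1mx cutPQ.
have RE' : cutR = Q *m (1%:M - cutP) by rewrite mulmxBr mulmx1 cutQP.
have e : cutR *m w *m cutR = fcalc (fun z => (1 + -1 * (z0 <= z)%R%:R) * z * (1 + -1 * (z0 <= z)%R%:R)) Zm.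
  rewrite {1}RE RE' !mulmxA -[_ *m Q *m w *m Q]mulmxA.
  have -> : 1%:M - cutP = fcalc (fun z => 1 + -1 * (z0 <= z)%R%:R) Zm.
    by rewrite -fcalcD -fcalcZ fcalc_cst // rmorphN1 scaleN1r.
  rewrite [X in X *m _](_ : _ = fcalc (fun z => 1 + -1 * (z0 <= z)%R%:R) Zm *m fcalc id Zm).
    by rewrite !fcalcM.
  by rewrite fcalc_id // /Zm !mulmxA.
have h : lwle (cutR *m w *m cutR) (rc z0 *: 1%:M).
  rewrite e -(fcalc_cst hZ) fcalcZ; apply: fcalc_le; first exact: pZm.
  move=> z zp; rewrite mulr1; case: (leP z0 z) => h /=.
    by rewrite mulr1 subrr mul0r mul0r ltW.
  by rewrite mulr0 addr0 mul1r mulr1 ltW.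
have := loewner_conj cutR h; rewrite cutR_adj -scalemxAr mulmx1 -scalemxAl cutR_idem.
by rewrite !mulmxA cutR_idem -[_ *m cutR *m cutR]mulmxA cutR_idem.
Qed.

End Cut.
End OneShot.

(** * Kraus maps and the completely positive order *)

Section Maps.
Context {R : realType} {K : cplx R}.
Local Notation rc := (rc K).

Definition blk r d (X : 'M[K]_(r * d)) i j : 'M[K]_d :=
  \matrix_(k, l) X (i ## k) (j ## l).

(* The action of [id (x) M] on 'C^r (x) 'C^d, block by block. *)
Definition idt r d1 d2 (M : 'M[K]_d1 -> 'M[K]_d2) (X : 'M[K]_(r * d1)) : 'M[K]_(r * d2) :=
  \matrix_(u, v) M (blk X (mxtens_unindex u).1 (mxtens_unindex v).1)
    (mxtens_unindex u).2 (mxtens_unindex v).2.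

Lemma idtE r d1 d2 (M : 'M[K]_d1 -> 'M[K]_d2) (X : 'M[K]_(r * d1)) i j k l :
  idt M X (i ## k) (j ## l) = M (blk X i j) k l.
Proof. by rewrite mxE !mxtens_indexK. Qed.

Definition cpm d1 d2 (M : 'M[K]_d1 -> 'M[K]_d2) :=
  forall r (X : 'M[K]_(r * d1)), psdm X -> psdm (idt M X).

Definition kr e m n (L : 'I_e -> 'M[K]_(m, n)) (X : 'M[K]_n) : 'M[K]_m :=
  \sum_i L i *m X *m adjm (L i).

Lemma blkE r d (X : 'M[K]_(r * d)) i j k l : blk X i j k l = X (i ## k) (j ## l).
Proof. by rewrite mxE. Qed.

Lemma kr1E e m n (L : 'I_e -> 'M[K]_(m, n)) X i j :
  kr L X i j = \sum_x \sum_k \sum_l L x i k * X k l * Num.conj (L x j l).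
Proof.
rewrite summxE; apply: eq_bigr => x _; rewrite mxE exchange_big; apply: eq_bigr => l _.
by rewrite mxE mulr_suml; apply: eq_bigr => k _; rewrite adjE.
Qed.

Lemma tens1_mulE r m n p (L : 'M[K]_(m, n)) (X : 'M[K]_(r * n, p)) i k j :
  ((1%:M *t L) *m X) (i ## k) j = \sum_l L k l * X (i ## l) j.
Proof.
rewrite mxE sum_tens (bigD1 i) //= [X in _ + X]big1 ?addr0 => [|i' ne].
  by apply: eq_bigr => l _; rewrite tensmxE mxE eqxx mul1r.
by rewrite big1 // => l _; rewrite tensmxE mxE eq_sym (negPf ne) !mul0r.
Qed.

Lemma idt_kr r e m n (L : 'I_e -> 'M[K]_(m, n)) (X : 'M[K]_(r * n)) :
  idt (kr L) X = kr (fun x => 1%:M *t L x) X.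
Proof.
apply: tens_matrixP => i k j l; rewrite idtE summxE summxE; apply: eq_bigr => x _.
rewrite -!mulmxA tens1_mulE mxE; apply: eq_bigr => a _; congr (_ * _).
rewrite -[X *m _]adjK adjE adjM adjK tens1_mulE mxE rmorph_sum; apply: eq_bigr => b _.
by rewrite rmorphM /= !adjE conjCK blkE mulrC.
Qed.

Lemma kr_psd e m n (L : 'I_e -> 'M[K]_(m, n)) X : psdm X -> psdm (kr L X).
Proof. by move=> pX; apply: psd_sum => i _; apply: psd_conj. Qed.

Lemma kr_cp e m n (L : 'I_e -> 'M[K]_(m, n)) : cpm (kr L).
Proof. by move=> r X pX; rewrite idt_kr; apply: kr_psd. Qed.

Lemma kr_lin e m n (L : 'I_e -> 'M[K]_(m, n)) c X Y :
  kr L (c *: X + Y) = c *: kr L X + kr L Y.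
Proof.
rewrite scaler_sumr -big_split; apply: eq_bigr => i _ /=.
by rewrite mulmxDr mulmxDl -scalemxAr -scalemxAl.
Qed.

Lemma kr_tr e m n (L : 'I_e -> 'M[K]_(m, n)) X :
  \tr (kr L X) = \tr ((\sum_i adjm (L i) *m L i) *m X).
Proof.
rewrite mulmx_suml !raddf_sum; apply: eq_bigr => i _ /=.
by rewrite mxtrace_mulC mulmxA.
Qed.

Lemma psd_cols n (X : 'M[K]_n) : psdm X ->
  exists y : 'I_n -> 'cV[K]_n, X = \sum_j y j *m adjm (y j).
Proof.
move=> /psd_factor[G ->]; exists (fun j => col j G).
apply/matrixP => i k; rewrite mxE summxE; apply: eq_bigr => j _.
by rewrite [RHS]mxE big_ord1 !adjE !mxE.
Qed.

(** A Gram factor reduces positivity on all inputs to inputs [y y^*], where the Kraus form is a sum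
    of squared moduli. *)
Lemma cp_kraus_le e1 e2 m n (L1 : 'I_e1 -> 'M[K]_(m, n)) (L2 : 'I_e2 -> 'M[K]_(m, n)) (c : R) :
  (forall r (v : 'cV[K]_(r * m)) (y : 'cV[K]_(r * n)),
    \sum_i nsq (adjm v *m (1%:M *t L2 i) *m y) <= c * \sum_i nsq (adjm v *m (1%:M *t L1 i) *m y)) ->
  cpm (fun X => rc c *: kr L1 X - kr L2 X).
Proof.
move=> h r X pX.
have -> : idt (fun X => rc c *: kr L1 X - kr L2 X) X =
    rc c *: kr (fun x => 1%:M *t L1 x) X - kr (fun x => 1%:M *t L2 x) X.
  by rewrite -!idt_kr; apply/matrixP => u v; rewrite !mxE.
split=> [|v].
  by rewrite adjB adjZ conj_rc !(proj1 (kr_psd _ pX)).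
have [y eX] := psd_cols pX.
have q e (L : 'I_e -> 'M[K]_(m, n)) : (adjm v *m kr (fun x => 1%:M *t L x) X *m v) 0 0 =
    rc (\sum_j \sum_i nsq (adjm v *m (1%:M *t L i) *m y j)).
  rewrite rmorph_sum mulmx_sumr mulmx_suml summxE.
  under [RHS]eq_bigr do rewrite rmorph_sum.
  rewrite exchange_big; apply: eq_bigr => i _ /=.
  rewrite eX !mulmx_sumr !mulmx_suml mulmx_sumr mulmx_suml summxE; apply: eq_bigr => j _.
  set b := adjm v *m _ *m y j.
  have -> : adjm v *m ((1%:M *t L i) *m (y j *m adjm (y j)) *m adjm (1%:M *t L i)) *m v = b *m adjm b.
    by rewrite /b !adjM adjK !mulmxA.
  have t0 : \tr (b *m adjm b) = (b *m adjm b) 0 0 by rewrite /mxtrace big_ord1.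
  rewrite /nsq trRC /tre t0 re_real // ger0_real // -t0.
  by apply/psd_tr_ge0/psd_gram'.
rewrite mulmxBr mulmxBl -scalemxAr -scalemxAl.
rewrite [X in 0 <= X]mxE [X in X + _]mxE [X in _ + X]mxE !q -rmorphM -rmorphB rc_ge0 subr_ge0 mulr_sumr.
by apply: ler_sum => j _; apply: h.
Qed.

End Maps.

Section StandardBlocks.
Context {R : realType} {K : cplx R}.
Local Notation rc := (rc K).

(** [jl], [jr] and [js] insert the basis vector [i] as the left factor, as the right factor, and as
    the middle factor [E] of [(A E) B]. *)
Definition jl a M (i : 'I_a) : 'M[K]_(a * M, M) :=
  \matrix_(u, k) (((mxtens_unindex u).1 == i) && ((mxtens_unindex u).2 == k))%:R.
Definition jr M b (i : 'I_b) : 'M[K]_(M * b, M) :=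
  \matrix_(u, k) (((mxtens_unindex u).2 == i) && ((mxtens_unindex u).1 == k))%:R.
Definition js a e b (i : 'I_e) : 'M[K]_((a * e) * b, a * b) := jr a i *t 1%:M.

Lemma jl_sel a M n (i : 'I_a) (X : 'M[K]_(a * M, n)) k c :
  (adjm (jl M i) *m X) k c = X (i ## k) c.
Proof.
rewrite mxE (bigD1 (i ## k)) //= adjE mxE mxtens_indexK /= !eqxx rmorph1 mul1r.
rewrite big1 ?addr0 // => u; case: (mxtens_indexP u) => p q ne.
rewrite adjE mxE mxtens_indexK /=; case: (eqVneq p i) => [pi|]; last by rewrite rmorph0 mul0r.
case: (eqVneq q k) => [qk|]; last by rewrite rmorph0 mul0r.
by rewrite pi qk eqxx in ne.
Qed.

Lemma jr_sel M b n (i : 'I_b) (X : 'M[K]_(M * b, n)) k c :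
  (adjm (jr M i) *m X) k c = X (k ## i) c.
Proof.
rewrite mxE (bigD1 (k ## i)) //= adjE mxE mxtens_indexK /= !eqxx rmorph1 mul1r.
rewrite big1 ?addr0 // => u; case: (mxtens_indexP u) => p q ne.
rewrite adjE mxE mxtens_indexK /=; case: (eqVneq q i) => [pi|]; last by rewrite rmorph0 mul0r.
case: (eqVneq p k) => [qk|]; last by rewrite rmorph0 mul0r.
by rewrite pi qk eqxx in ne.
Qed.

Lemma js_sel a e b n (i : 'I_e) (X : 'M[K]_((a * e) * b, n)) p q c :
  (adjm (js a b i) *m X) (p ## q) c = X ((p ## i) ## q) c.
Proof.
rewrite mxE sum_tens (bigD1 (p ## i)) //= [X in _ + X]big1 ?addr0 => [|u].
  rewrite (bigD1 q) //= adjE tensmxE !mxE mxtens_indexK /= !eqxx mulr1 rmorph1 mul1r.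
  rewrite big1 ?addr0 // => k /negPf ne.
  by rewrite adjE tensmxE [1%:M k q]mxE ne mulr0 rmorph0 mul0r.
case: (mxtens_indexP u) => p' i' ne; apply: big1 => k _.
rewrite adjE tensmxE mxE mxtens_indexK /=.
case: (eqVneq i' i) => [ii|]; last by rewrite !mul0r rmorph0 mul0r.
case: (eqVneq p' p) => [pp|]; last by rewrite mul0r rmorph0 mul0r.
by rewrite ii pp eqxx in ne.
Qed.

Lemma blocks_sel a N M (J : 'I_a -> 'M[K]_(N, M)) (s : 'I_a -> 'I_M -> 'I_N) :
  (forall n (X : 'M[K]_(N, n)) i k c, (adjm (J i) *m X) k c = X (s i k) c) ->
  (forall i j k m, J j (s i k) m = ((i == j) && (k == m))%:R) ->
  (forall u, exists i k, u = s i k) -> blocks J.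
Proof.
move=> sel JE surj; split=> [i j|].
  apply/matrixP => k m; rewrite sel JE mxE; case: (i == j) => /=; first by [].
  by rewrite mul0rn.
apply/matrixP => u v; rewrite summxE.
have [i [k ->]] := surj u; have [j [m ->]] := surj v.
have e x : (J x *m adjm (J x)) (s i k) (s j m) = ((i == x) && (j == x) && (k == m))%:R.
  rewrite mxE (bigD1 k) //= adjE !JE eqxx andbT big1 ?addr0.
    rewrite rmorph_nat -natrM mulnb; congr (_%:R); rewrite -andbA; congr (_ && _).
    by rewrite [m == k]eq_sym; case: (i == x).
  by move=> y /negPf ne; rewrite JE [k == y]eq_sym ne andbF mul0r.
under eq_bigr do rewrite e.
rewrite mxE; have [<-|ne] := eqVneq i j.
  rewrite (bigD1 i) //= eqxx big1 ?addr0 => [|x /negPf ne]; last by rewrite eq_sym ne.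
  suff -> : (s i k == s i m) = (k == m) by [].
  apply/eqP/eqP => [h|->//]; have := JE i i k m.
  by rewrite h JE !eqxx /=; case: eqP => // _ /eqP; rewrite oner_eq0.
rewrite big1 => [|x _]; last first.
  by case: (eqVneq i x) => [<-|] //=; rewrite eq_sym (negPf ne).
suff /negPf-> : s i k != s j m by [].
apply: contra_neq ne => h; have := JE i j k m; have := JE j j m m.
by rewrite -h => ->; rewrite !eqxx /=; case: eqP => // _ /eqP; rewrite oner_eq0.
Qed.

Lemma jl_blocks a M : blocks (@jl a M).
Proof.
apply: (blocks_sel (s := fun i k => i ## k)) => [n X i k c|i j k m|u].
- exact: jl_sel.
- by rewrite mxE mxtens_indexK.
- by case: (mxtens_indexP u) => i k; exists i, k.
Qed.

Lemma jr_blocks M b : blocks (@jr M b).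
Proof.
apply: (blocks_sel (s := fun i k => k ## i)) => [n X i k c|i j k m|u].
- exact: jr_sel.
- by rewrite mxE mxtens_indexK.
- by case: (mxtens_indexP u) => i k; exists k, i.
Qed.

Lemma js_blocks a e b : blocks (@js a e b).
Proof.
split=> [i j|].
  rewrite adj_tens tensmx_mul adj1 mulmx1 (proj1 (jr_blocks a e)).
  case: (i == j).
    by apply: tens_matrixP => k m k' m'; rewrite tensmxE !mxE -natrM mulnb -xpair_eqE (can_eq (@mxtens_indexK _ _)).
  by apply: tens_matrixP => k m k' m'; rewrite tensmxE !mxE !mul0rn mul0r.
under eq_bigr do rewrite adj_tens tensmx_mul adj1 mulmx1.
have -> : \sum_(i < e) (jr a i *m adjm (jr a i)) *t (1%:M : 'M[K]_b) =
   (\sum_(i < e) jr a i *m adjm (jr a i)) *t 1%:M.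
  by apply/matrixP => u v; rewrite summxE [RHS]mxE summxE mulr_suml; apply: eq_bigr => i _; rewrite [LHS]mxE.
rewrite (proj2 (jr_blocks a e)).
by apply: tens_matrixP => k m k' m'; rewrite tensmxE !mxE -natrM mulnb -xpair_eqE (can_eq (@mxtens_indexK _ _)).
Qed.

Lemma ptr_jlE a M (X : 'M[K]_(a * M)) k m :
  ptr (@jl a M) X k m = \sum_i X (i ## k) (i ## m).
Proof.
rewrite summxE; apply: eq_bigr => i _; rewrite -mulmxA jl_sel.
by rewrite -[X *m _]adjK adjE adjM jl_sel adjE conjCK.
Qed.

Lemma ptr_jrE M b (X : 'M[K]_(M * b)) k m :
  ptr (@jr M b) X k m = \sum_i X (k ## i) (m ## i).
Proof.
rewrite summxE; apply: eq_bigr => i _; rewrite -mulmxA jr_sel.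
by rewrite -[X *m _]adjK adjE adjM jr_sel adjE conjCK.
Qed.

Lemma ptr_jsE a e b (X : 'M[K]_((a * e) * b)) k m k' m' :
  ptr (@js a e b) X (k ## m) (k' ## m') = \sum_i X ((k ## i) ## m) ((k' ## i) ## m').
Proof.
rewrite summxE; apply: eq_bigr => i _; rewrite -mulmxA js_sel.
by rewrite -[X *m _]adjK adjE adjM js_sel adjE conjCK.
Qed.

Lemma amp_jlE a M (Y : 'M[K]_M) : amp (@jl a M) Y = 1%:M *t Y.
Proof.
apply: tens_matrixP => i k j m; rewrite summxE tensmxE mxE.
have e x : (jl M x *m Y *m adjm (jl M x)) (i ## k) (j ## m) = ((i == x) && (j == x))%:R * Y k m.
  rewrite mxE (bigD1 m) //= adjE [jl M x _ _]mxE mxtens_indexK /= eqxx andbT rmorph_nat.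
  rewrite big1 ?addr0 => [|y /negPf ne]; last first.
    by rewrite adjE [jl M x (j ## m) _]mxE mxtens_indexK /= [m == y]eq_sym ne andbF rmorph0 mulr0.
  rewrite mxE (bigD1 k) //= [jl M x _ _]mxE mxtens_indexK /= eqxx andbT.
  rewrite big1 ?addr0 => [|y /negPf ne]; last first.
    by rewrite [jl M x _ _]mxE mxtens_indexK /= [k == y]eq_sym ne andbF mul0r.
  by rewrite mulrAC -natrM mulnb.
under eq_bigr do rewrite e.
rewrite -mulr_suml; congr (_ * _); have [<-|ne] := eqVneq i j.
  by rewrite (bigD1 i) //= eqxx big1 ?addr0 // => x /negPf ne; rewrite eq_sym ne.
by rewrite big1 // => x _; case: (eqVneq i x) => [<-|] //=; rewrite eq_sym (negPf ne).
Qed.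

Lemma amp_jrE M b (Y : 'M[K]_M) : amp (@jr M b) Y = Y *t 1%:M.
Proof.
apply: tens_matrixP => k i m j; rewrite summxE tensmxE [X in _ * X]mxE.
have e x : (jr M x *m Y *m adjm (jr M x)) (k ## i) (m ## j) = ((i == x) && (j == x))%:R * Y k m.
  rewrite mxE (bigD1 m) //= adjE [jr M x _ _]mxE mxtens_indexK /= eqxx andbT rmorph_nat.
  rewrite big1 ?addr0 => [|y /negPf ne]; last first.
    by rewrite adjE [jr M x (m ## j) _]mxE mxtens_indexK /= [m == y]eq_sym ne andbF rmorph0 mulr0.
  rewrite mxE (bigD1 k) //= [jr M x _ _]mxE mxtens_indexK /= eqxx andbT.
  rewrite big1 ?addr0 => [|y /negPf ne]; last first.
    by rewrite [jr M x _ _]mxE mxtens_indexK /= [k == y]eq_sym ne andbF mul0r.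
  by rewrite mulrAC -natrM mulnb.
under eq_bigr do rewrite e.
rewrite -mulr_suml mulrC; congr (_ * _); have [<-|ne] := eqVneq i j.
  by rewrite (bigD1 i) //= eqxx big1 ?addr0 // => x /negPf ne; rewrite eq_sym ne.
by rewrite big1 // => x _; case: (eqVneq i x) => [<-|] //=; rewrite eq_sym (negPf ne).
Qed.

End StandardBlocks.

(** * Kraus operators read off a Stinespring isometry *)

Section Dilation.
Context {R : realType} {K : cplx R}.
Local Notation rc := (rc K).
Variables (a e b s : nat) (V : 'M[K]_((a * e) * b, s)).

(* [V] is a Stinespring isometry 'C^s -> A (x) E (x) B; [AEm] is the
   output on AE and [outm] the output on AB. *)
Definition AEm (X : 'M[K]_s) : 'M[K]_(a * e) := ptr (@jr _ _ _ b) (V *m X *m adjm V).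
Definition cutK (P : 'M[K]_(a * e)) (i : 'I_e) : 'M[K]_(a * b, s) :=
  adjm (js a b i) *m (amp (@jr _ _ _ b) P *m V).
Definition outK (i : 'I_e) : 'M[K]_(a * b, s) := adjm (js a b i) *m V.
(** Kraus operators of [R o N]: a basis vector of [AE] is traced out and a fresh basis vector of [A]
    is prepared. *)
Definition replK (k : 'I_(a * (a * e))) : 'M[K]_(a * b, s) :=
  \matrix_(w, l) (((mxtens_unindex w).1 == (mxtens_unindex k).1)%:R *
    V ((mxtens_unindex k).2 ## (mxtens_unindex w).2) l).
Definition cutV (P : 'M[K]_(a * e)) : 'M[K]_s := adjm V *m amp (@jr _ _ _ b) P *m V.

Lemma AEm_psd X : psdm X -> psdm (AEm X).
Proof. by move=> pX; apply/psd_ptr/psd_conj. Qed.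

Lemma AEm_sum I (r : seq I) (Q : pred I) (F : I -> 'M[K]_s) :
  AEm (\sum_(i <- r | Q i) F i) = \sum_(i <- r | Q i) AEm (F i).
Proof.
rewrite /AEm /ptr mulmx_sumr mulmx_suml exchange_big; apply: eq_bigr => i _ /=.
by rewrite mulmx_sumr mulmx_suml.
Qed.

Lemma AEmZ c X : AEm (c *: X) = c *: AEm X.
Proof.
rewrite /AEm /ptr scaler_sumr; apply: eq_bigr => i _ /=.
by rewrite -!scalemxAr -!scalemxAl -!scalemxAr -!scalemxAl.
Qed.

Lemma tr_cutV P X : \tr (cutV P *m X) = \tr (P *m AEm X).
Proof.
rewrite [RHS]mxtrace_mulC /AEm -tr_amp /cutV -!mulmxA mxtrace_mulC !mulmxA.
by rewrite [RHS]mxtrace_mulC !mulmxA.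
Qed.

Lemma tre_cutV P X : tre (cutV P *m X) = tre (P *m AEm X).
Proof. by rewrite /tre tr_cutV. Qed.

Lemma cutV_psd P : psdm P -> psdm (cutV P).
Proof. by move=> pP; apply/psd_conj'/psd_amp. Qed.

Lemma cutV_le1 P : adjm V *m V = 1%:M -> lwle P 1%:M -> lwle (cutV P) 1%:M.
Proof.
move=> iV P1; rewrite /lwle -iV /cutV -[X in adjm V *m X - _]mul1mx mulmxA -mulmxBl -mulmxBr.
rewrite -(amp1 (jr_blocks _ b)) -ampB; exact/psd_conj'/psd_amp.
Qed.

Lemma cutK_gram P Q : \sum_i adjm (cutK P i) *m cutK Q i =
  adjm V *m (adjm (amp (@jr _ _ _ b) P) *m amp (@jr _ _ _ b) Q) *m V.
Proof.
set A := amp _ P; set B := amp _ Q.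
transitivity (\sum_i (adjm V *m adjm A) *m (js a b i *m adjm (js a b i)) *m (B *m V)).
  by apply: eq_bigr => i _; rewrite /cutK !adjM adjK !mulmxA.
by rewrite -mulmx_suml -mulmx_sumr (proj2 (js_blocks a e b)) mulmx1 !mulmxA.
Qed.

Lemma cutK_proj P : adjm P = P -> P *m P = P -> \sum_i adjm (cutK P i) *m cutK P i = cutV P.
Proof. by move=> hP iP; rewrite cutK_gram adj_amp hP (ampM (jr_blocks _ _)) iP. Qed.

(** The overlap of the two Kraus families, from which the fidelity of the cut is estimated. *)
Lemma outK_cutK P : \sum_i adjm (outK i) *m cutK P i = cutV P.
Proof.
have e1 i : outK i = cutK 1%:M i by rewrite /cutK (amp1 (jr_blocks _ _)) mul1mx.
under eq_bigr do rewrite e1.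
by rewrite cutK_gram (amp1 (jr_blocks _ _)) adj1 mul1mx.
Qed.

Lemma outK_ptr X : kr outK X = ptr (@js _ _ _ _ _) (V *m X *m adjm V).
Proof. by apply: eq_bigr => i _; rewrite /outK adjM adjK !mulmxA. Qed.

Lemma replKE X : kr replK X = 1%:M *t ptr (@jl _ _ a b) (kr outK X).
Proof.
apply: tens_matrixP => i k j m; rewrite tensmxE ptr_jlE outK_ptr summxE.
under [X in _ * X]eq_bigr do rewrite ptr_jsE.
have e0 p u : (replK (p ## u) *m X *m adjm (replK (p ## u))) (i ## k) (j ## m) =
   ((i == p) && (j == p))%:R * (V *m X *m adjm V) (u ## k) (u ## m).
  rewrite [in LHS]mxE [in RHS]mxE mulr_sumr; apply: eq_bigr => l _.
  rewrite adjE [replK _ (j ## m) l]mxE !mxtens_indexK /= rmorphM rmorph_nat adjE.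
  rewrite [in LHS]mxE [in RHS]mxE mulr_suml mulrA mulr_sumr mulr_suml; apply: eq_bigr => l' _.
  rewrite [replK _ (i ## k) l']mxE !mxtens_indexK /= -mulnb natrM; ring.
rewrite sum_tens.
transitivity (\sum_p ((i == p) && (j == p))%:R * \sum_u (V *m X *m adjm V) (u ## k) (u ## m)).
  by apply: eq_bigr => p _; rewrite mulr_sumr; apply: eq_bigr => u _; apply: e0.
rewrite -mulr_suml [X in _ * X]sum_tens; congr (_ * _); rewrite mxE.
have [<-|ne] := eqVneq i j.
  by rewrite (bigD1 i) //= eqxx big1 ?addr0 // => x /negPf ne; rewrite eq_sym ne.
by rewrite big1 // => x _; case: (eqVneq i x) => [<-|] //=; rewrite eq_sym (negPf ne).
Qed.

Lemma tens_mul1E m p k n (Q : 'M[K]_(m, p)) (X : 'M[K]_(p * k, n)) i j c :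
  ((Q *t 1%:M) *m X) (i ## j) c = \sum_l Q i l * X (l ## j) c.
Proof.
rewrite mxE sum_tens; apply: eq_bigr => l _.
rewrite (bigD1 j) //= big1 ?addr0 => [|j' ne].
  by rewrite tensmxE [1%:M j j]mxE eqxx mulr1.
by rewrite tensmxE [1%:M j j']mxE eq_sym (negPf ne) mulr0 mul0r.
Qed.

(** [V G] reshaped into an operator from reference and [B] to [AE], which makes it a Gram factor of
    the [AE] output. *)
Definition Omg g (G : 'M[K]_(s, g)) : 'M[K]_(a * e, g * b) :=
  \matrix_(u, w) (V *m G) (u ## (mxtens_unindex w).2) (mxtens_unindex w).1.

Lemma Omg_gram g (G : 'M[K]_(s, g)) : Omg G *m adjm (Omg G) = AEm (G *m adjm G).
Proof.
apply/matrixP => u u'; rewrite ptr_jrE mxE sum_tens exchange_big; apply: eq_bigr => k _.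
rewrite !mulmxA -mulmxA -adjM mxE; apply: eq_bigr => i _.
by rewrite !adjE ![Omg _ _ _]mxE mxtens_indexK.
Qed.

Section Order.
Variables (g : nat) (G : 'M[K]_(s, g)) (G' : 'M[K]_(g, s)) (P : 'M[K]_(a * e)) (c : R).
Hypothesis GG' : G *m G' = 1%:M.
Hypothesis star : forall u : 'I_a -> 'cV[K]_(g * b),
  nsq (\sum_i adjm (jl e i) *m P *m Omg G *m u i) <= c * \sum_i nsq (Omg G *m u i).

Lemma nsq_col m (A : 'cV[K]_m) : nsq A = \sum_i re (Num.conj (A i 0) * A i 0).
Proof.
rewrite /nsq /tre /mxtrace big_ord1 mxE re_sum; apply: eq_bigr => i _.
by rewrite adjE.
Qed.

Lemma nsq_11 (A : 'M[K]_1) : nsq A = re (Num.conj (A 0 0) * A 0 0).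
Proof. by rewrite nsq_col big_ord1. Qed.

(** The right inverse of [G] turns every test pair [v], [y] into vectors [u] on reference and [B],
    so that the bound for the one input [G G^*] covers all inputs and all references. *)
Lemma cut_order : cpm (fun X => rc c *: kr replK X - kr (cutK P) X).
Proof.
apply: cp_kraus_le => r v y.
pose B : 'M[K]_(g * b, r * b) := \matrix_(w, w')
  (((mxtens_unindex w).2 == (mxtens_unindex w').2)%:R *
   \sum_l G' (mxtens_unindex w).1 l * y ((mxtens_unindex w').1 ## l) 0).
pose u0 (i : 'I_a) : 'cV[K]_(r * b) :=
  \col_w Num.conj (v ((mxtens_unindex w).1 ## (i ## (mxtens_unindex w).2)) 0).
pose u i := B *m u0 i.
have OB p w : (Omg G *m B) p w = \sum_l V (p ## (mxtens_unindex w).2) l * y ((mxtens_unindex w).1 ## l) 0.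
  case: (mxtens_indexP w) => i k; rewrite mxtens_indexK /= mxE sum_tens exchange_big (bigD1 k) //= [X in _ + X]big1 ?addr0; last first.
    move=> k' ne; apply: big1 => j _; rewrite [B _ _]mxE !mxtens_indexK /= (negPf ne).
    by rewrite mul0r mulr0.
  rewrite -[V in RHS]mulmx1 -GG' mulmxA.
  transitivity (\sum_i0 \sum_l (V *m G) (p ## k) i0 * G' i0 l * y (i ## l) 0).
    apply: eq_bigr => j _; rewrite [B _ _]mxE [Omg _ _ _]mxE !mxtens_indexK /= eqxx mul1r mulr_sumr.
    by apply: eq_bigr => l _; rewrite mulrA.
  rewrite exchange_big; apply: eq_bigr => l _; rewrite [in RHS]mxE mulr_suml.
  exact: eq_bigr.
have vL (L : 'M[K]_(a * b, s)) : (adjm v *m (1%:M *t L) *m y) 0 0 =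
    \sum_i \sum_j \sum_k Num.conj (v (i ## (j ## k)) 0) * \sum_l L (j ## k) l * y (i ## l) 0.
  rewrite -mulmxA mxE sum_tens; apply: eq_bigr => i _.
  rewrite sum_tens; apply: eq_bigr => j _; apply: eq_bigr => k _.
  by rewrite adjE tens1_mulE.
have x2 i : (adjm v *m (1%:M *t cutK P i) *m y) 0 0 =
    (\sum_j adjm (jl e j) *m P *m Omg G *m u j) i 0.
  rewrite vL exchange_big summxE; apply: eq_bigr => j _ /=.
  rewrite -!mulmxA jl_sel mxE.
  transitivity (\sum_p P (j ## i) p * \sum_i0 \sum_k Num.conj (v (i0 ## (j ## k)) 0) *
      \sum_l V (p ## k) l * y (i0 ## l) 0); last first.
    apply: eq_bigr => p _; congr (_ * _); rewrite /u mulmxA [RHS]mxE sum_tens.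
    apply: eq_bigr => i0 _; apply: eq_bigr => k _.
    by rewrite OB [u0 _ _ _]mxE !mxtens_indexK /= mulrC.
  under [RHS]eq_bigr do rewrite mulr_sumr.
  rewrite [RHS]exchange_big; apply: eq_bigr => i0 _ /=.
  under [RHS]eq_bigr do rewrite mulr_sumr.
  rewrite [RHS]exchange_big; apply: eq_bigr => k _ /=.
  under eq_bigr do rewrite js_sel amp_jrE tens_mul1E mulr_suml.
  rewrite exchange_big mulr_sumr; apply: eq_bigr => p _ /=.
  by rewrite mulrCA !mulr_sumr; apply: eq_bigr => l _; rewrite !mulrA.
have x1 p q : (adjm v *m (1%:M *t replK (p ## q)) *m y) 0 0 = (Omg G *m u p) q 0.
  rewrite vL /u mulmxA [RHS]mxE sum_tens; apply: eq_bigr => i _.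
  rewrite (bigD1 p) //= [X in _ + X]big1 ?addr0 => [|j ne]; last first.
    apply: big1 => k _; rewrite big1 ?mulr0 // => l _.
    by rewrite mxE !mxtens_indexK /= (negPf ne) !mul0r.
  apply: eq_bigr => k _; rewrite OB [u0 _ _ _]mxE !mxtens_indexK /= mulrC; congr (_ * _).
  by apply: eq_bigr => l _; rewrite mxE !mxtens_indexK /= eqxx mul1r.
have := star u; rewrite nsq_col => h.
under eq_bigr do rewrite nsq_11 x2.
apply: le_trans h _; suff -> : \sum_i nsq (Omg G *m u i) =
  \sum_i nsq (adjm v *m (1%:M *t replK i) *m y) by [].
rewrite [RHS]sum_tens; apply: eq_bigr => p _; rewrite nsq_col; apply: eq_bigr => q _.
by rewrite nsq_11 x1.
Qed.

End Order.
End Dilation.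

(** * Spectral bins and the cut *)

Section Binning.
Context {R : realType} {K : cplx R}.
Local Notation rc := (rc K).

Section Bins.
Variables (M : nat) (D : R).
Hypothesis D0 : 0 < D.

(** Bins of logarithmic width [D]. The last one collects everything smaller, including 0, where [ln]
    is a default value; so it has an upper edge but no positive lower one. *)
Definition binz (z : R) : 'I_M.+1 :=
  if z <= 0 then ord_max else inord (minn M (Num.truncn (- ln z / D))).

Lemma binz_le z (x : 'I_M.+1) : z <= 1 -> binz z == x -> z <= expR (- (x%:R * D)).
Proof.
move=> z1; rewrite /binz; case: leP => [z0 _|z0 /eqP <-].
  by apply: le_trans z0 (expR_ge0 _).
rewrite inordK ?ltnS ?geq_minl // -[X in X <= _]lnK ?posrE // ler_expR lerNr.
have h : 0 <= - ln z / D by rewrite divr_ge0 ?(ltW D0) // oppr_ge0 ln_le0.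
rewrite -ler_pdivlMr //; have /andP[h1 _] := truncn_itv h.
by apply: le_trans h1; rewrite ler_nat geq_minr.
Qed.

Lemma binz_gt z (x : 'I_M.+1) : (x < M)%N -> z <= 1 -> binz z == x ->
  expR (- (x.+1%:R * D)) <= z.
Proof.
move=> xM z1; rewrite /binz; case: leP => [z0 /eqP e|z0 /eqP e].
  by rewrite -e ltnn in xM.
have h : 0 <= - ln z / D by rewrite divr_ge0 ?(ltW D0) // oppr_ge0 ln_le0.
have xt : x = Num.truncn (- ln z / D) :> nat.
  move: xM; rewrite -e inordK ?ltnS ?geq_minl // /minn.
  by case: (M < _)%N => //; rewrite ltnn.
rewrite -[X in _ <= X]lnK ?posrE // ler_expR lerNl.
rewrite -ler_pdivrMr // xt; have /andP[_ h1] := truncn_itv h.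
exact: ltW.
Qed.

Section BinProj.
Variables (e : nat) (wE : 'M[K]_e).
Hypothesis sE : is_st wE.

Definition bin (x : 'I_M.+1) : 'M[K]_e := fcalc (fun z => (binz z == x)%:R) wE.

Let hE : adjm wE = wE. Proof. by case: sE => -[]. Qed.

Lemma bin_adj x : adjm (bin x) = bin x. Proof. exact: fcalc_adj. Qed.

Lemma bin_orth x x' : bin x *m bin x' = if x == x' then bin x else 0.
Proof.
rewrite fcalcM //; have [->|ne] := eqVneq x x'.
  by congr fcalc; apply/funext => z; case: (_ == _); rewrite !(mulr1, mulr0).
rewrite (_ : (fun z => _) = fun z => 0 * 0); first by rewrite -fcalcZ rmorph0 scale0r.
apply/funext => z; rewrite mul0r; have [->|] := eqVneq (binz z) x; last by rewrite mul0r.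
by rewrite (negPf ne) mulr0.
Qed.

Lemma fcalc_sum I (r : seq I) (P : pred I) (f : I -> R -> R) n (A : 'M[K]_n) :
  \sum_(i <- r | P i) fcalc (f i) A = fcalc (fun z => \sum_(i <- r | P i) f i z) A.
Proof.
elim: r => [|i r IH].
  rewrite big_nil (_ : (fun z => _) = fun z => 0 * 0); first by rewrite -fcalcZ rmorph0 scale0r.
  by apply/funext => z; rewrite big_nil mul0r.
rewrite big_cons IH; case: ifP => Pi; last first.
  by congr fcalc; apply/funext => z; rewrite big_cons Pi.
by rewrite fcalcD; congr fcalc; apply/funext => z; rewrite big_cons Pi.
Qed.

Lemma bin_sum : \sum_x bin x = 1%:M.
Proof.
rewrite fcalc_sum -(fcalc_cst hE); congr fcalc; apply/funext => z.
by rewrite (bigD1 (binz z)) //= eqxx big1 ?addr0 // => x /negPf; rewrite eq_sym => ->.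
Qed.

Lemma st_fcalc_le f g : (forall z, 0 <= z <= 1 -> f z <= g z) ->
  lwle (fcalc f wE) (fcalc g wE).
Proof.
move=> fg; have [U [d [s d0 d1]]] := st_spec sE.
rewrite !(fcalc_spec _ s) /lwle -mulmxBl -mulmxBr.
have -> : rdiag (fun i => g (d i)) - rdiag (fun i => f (d i)) = rdiag (fun i => g (d i) - f (d i)) :> 'M[K]_e.
  by apply/matrixP => i j; rewrite !mxE -mulrnBl -rmorphB.
apply/psd_conj/psd_rdiag => i; rewrite subr_ge0 fg // d0 -d1 (bigD1 i) //= lerDl.
exact: sumr_ge0.
Qed.

Lemma bin_le x : lwle (bin x *m wE *m bin x) (rc (expR (- (x%:R * D))) *: 1%:M).
Proof.
rewrite -[X in _ *m X *m _](fcalc_id hE) !fcalcM // -(fcalc_cst hE) fcalcZ.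
apply: st_fcalc_le => z /andP[z0 z1]; rewrite mulr1.
case: (boolP (binz z == x)) => [h|_] /=; last by rewrite !mul0r expR_ge0.
by rewrite mul1r mulr1 binz_le.
Qed.

(** Eigenvalues bounded below whose sum is at most 1 are few; the last bin is excluded for want of a
    lower edge. *)
Lemma bin_tre (x : 'I_M.+1) : (x < M)%N -> tre (bin x) <= expR (x.+1%:R * D).
Proof.
move=> xM; rewrite -[X in _ <= X]mulr1 -[X in _ * X](proj2 sE) -trRZ.
apply: loewner_tr.
rewrite -[X in _ *: X](fcalc_id hE) fcalcZ; apply: st_fcalc_le => z /andP[z0 z1].
case: (boolP (binz z == x)) => [h|_] /=; last by rewrite mulr_ge0 // expR_ge0.
rewrite mulrC -ler_pdivrMr; last exact: expR_gt0.
by rewrite div1r -expRN; apply: (binz_gt xM z1 h).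
Qed.

End BinProj.
End Bins.

Section CutProj.
Variables (a e M : nat) (D L : R) (w : 'M[K]_(a * e)).
Hypotheses (D0 : 0 < D) (sw : is_st w).
Local Notation J := (@jl R K a e).
Let wE := ptr J w.
Let sE : is_st wE. Proof. by apply: st_ptr sw; apply: jl_blocks. Qed.
Let hE : adjm wE = wE. Proof. by case: sE => -[]. Qed.
Local Notation Pi := (fun x => bin M D wE x).
Let Q (x : 'I_M.+1) := amp J (bin D wE x).
Let z0 (x : 'I_M.+1) := expR (- (L + x%:R * D)).
Let hQ x : adjm (Q x) = Q x. Proof. by rewrite adj_amp bin_adj. Qed.
Let iQ x : Q x *m Q x = Q x. Proof. by rewrite (ampM (jl_blocks _ _)) bin_orth // eqxx. Qed.
Let z0p x : 0 < z0 x. Proof. exact: expR_gt0. Qed.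
Let pw := proj1 sw.

Definition cut : 'M[K]_(a * e) := \sum_x cutP w (Q x) (z0 x).
Definition rest x := cutR w (Q x) (z0 x).

Lemma QQ x y : Q x *m Q y = if x == y then Q x else 0.
Proof.
rewrite (ampM (jl_blocks _ _)) bin_orth //; case: eqP => // _.
by rewrite /amp big1 // => i _; rewrite mulmx0 mul0mx.
Qed.

Lemma cut_adj : adjm cut = cut.
Proof. by rewrite adj_sum; apply: eq_bigr => x _; apply: cutP_adj. Qed.

Lemma cut_idem : cut *m cut = cut.
Proof.
rewrite {1}/cut mulmx_suml; apply: eq_bigr => x _; rewrite mulmx_sumr.
rewrite (bigD1 x) //= (cutP_idem (z0 x) pw (hQ x)) // big1 ?addr0 // => y yx.
rewrite -(cutPQ pw (hQ x) (iQ x) (z0p x)) -(cutQP pw (hQ y) (iQ y) (z0p y)).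
by rewrite !mulmxA -[_ *m Q x *m Q y]mulmxA QQ eq_sym (negPf yx) mulmx0 mul0mx.
Qed.

Lemma amp_sum (X : finType) (F : X -> 'M[K]_e) : amp J (\sum_x F x) = \sum_x amp J (F x).
Proof.
rewrite /amp exchange_big; apply: eq_bigr => i _ /=.
by rewrite mulmx_sumr mulmx_suml.
Qed.

Lemma sum_rest : \sum_x rest x = 1%:M - cut.
Proof.
rewrite sumrB; congr (_ - _); rewrite /Q -amp_sum bin_sum //.
exact: amp1 (jl_blocks _ _).
Qed.

Lemma cut_star m (Om : 'M[K]_(a * e, m)) p (u : 'I_a -> 'M[K]_(m, p)) :
  w = Om *m adjm Om ->
  nsq (\sum_i adjm (J i) *m cut *m Om *m u i) <=
  (M.+1%:R * expR L) * \sum_i nsq (Om *m u i).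
Proof.
move=> ew.
(* The threshold [z0 x] moves with the bin so that its upper edge divided by [z0 x] is [e^L] for
   every [x]. *)
have -> : M.+1%:R * expR L = \sum_(x < M.+1) expR (- (x%:R * D)) * (z0 x)^-1.
  under eq_bigr do rewrite /z0 [X in _ / X]expRN invrK -expRD addrCA addNr addr0.
  by rewrite sumr_const card_ord mulr_natl.
have -> : cut = \sum_x amp J (bin D wE x) *m (Om *m adjm Om) *m cutT w (Q x) (z0 x).
  by apply: eq_bigr => x _; rewrite -ew; apply/esym/(cutP_def pw (hQ x) (iQ x) (z0p x)).
apply: (star_bound (jl_blocks a e)).
- by move=> x; apply: bin_adj.
- by move=> x y; apply: bin_orth.
- by move=> x; apply: cutT_adj.
- by move=> x; rewrite -ew; apply: cutTwT.
- by move=> x; apply: cutT_le.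
- by move=> x; apply: expR_gt0.
- by move=> x; rewrite -ew; apply: bin_le.
Qed.

Section Overlap.
Variables (S : 'M[K]_(a * e)) (kappa : R).
Hypotheses (sS : is_st S) (k0 : 0 <= kappa) (Sw : lwle S (rc kappa *: w)).

(** On the discarded part [w] is below the threshold, and [S <= kappa w] passes this on to [S]. It
    is effective for bins whose threshold lies below the typical eigenvalues of [S]. *)
Lemma rest_boundA x U P c : spec S U P -> 0 < c ->
  tre (rest x *m S) <= \sum_(k | P k < c) P k + kappa * z0 x / c.
Proof.
move=> s c0; have [pS S1] := sS.
apply: (proj_tre_le s) => //.
- by move=> k; apply: spec_ge0 s.
- by rewrite -(trR_spec id s) fcalc_id ?S1 //; case: pS.
- exact/cutR_adj/hQ.
- exact: (cutR_idem pw (hQ x) (iQ x) (z0p x)).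
- by rewrite mulr_ge0 // ltW.
have hR := cutR_adj w (z0 x) (hQ x).
have h1 := loewner_conj (rest x) Sw; rewrite hR -scalemxAr -scalemxAl in h1.
apply: psd_le_trans h1 _; rewrite rmorphM -scalerA /lwle -scalerBr.
apply: psdZ; first by rewrite rc_ge0.
exact: (cutRwR pw (hQ x) (iQ x) (z0p x)).
Qed.

(** For bins of large eigenvalues: their rank is too small to carry much of a state whose [E]
    marginal has smaller typical eigenvalues. *)
Lemma rest_boundE (x : 'I_M.+1) U P c : (x < M)%N -> spec (ptr J S) U P -> 0 <= c ->
  tre (rest x *m S) <= \sum_(k | c < P k) P k + c * expR (x.+1%:R * D).
Proof.
move=> xM s c0; have [pS S1] := sS.
apply: le_trans (_ : tre (Q x *m S) <= _).
  apply: le_trans (_ : tre (S *m rest x) <= _); first by rewrite trRC.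
  rewrite [X in _ <= X]trRC; apply: le_trRM => //.
  rewrite /lwle /rest /cutR subKr -(cutP_idem (z0 x) pw (hQ x)) -{1}(cutP_adj w (Q x) (z0 x)).
  exact: psd_gram.
rewrite trRC (tre_amp J) trRC; apply: (small_tre_le s) => //.
- by move=> k; apply: spec_ge0 s; apply: psd_ptr.
- have := psd_gram (bin D wE x); rewrite bin_adj bin_orth // eqxx; exact.
- by apply: proj_le1; rewrite ?bin_adj // bin_orth // eqxx.
- exact: bin_tre.
Qed.

End Overlap.
End CutProj.
End Binning.

(** * Equivariance under permutations of the copies *)

Section Equivariance.
Context {R : realType} {K : cplx R}.
Local Notation rc := (rc K).

Definition equiv_mx N N' (f : 'I_N -> 'I_N) (g : 'I_N' -> 'I_N') (A : 'M[K]_(N, N')) :=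
  forall j k, A (f j) (g k) = A j k.

Definition pairf N N' (f : 'I_N -> 'I_N) (g : 'I_N' -> 'I_N') (u : 'I_(N * N')) : 'I_(N * N') :=
  f (mxtens_unindex u).1 ## g (mxtens_unindex u).2.

Lemma pairfE N N' (f : 'I_N -> 'I_N) (g : 'I_N' -> 'I_N') i j :
  pairf f g (i ## j) = f i ## g j.
Proof. by rewrite /pairf mxtens_indexK. Qed.

Lemma pairf_inj N N' (f : 'I_N -> 'I_N) (g : 'I_N' -> 'I_N') :
  injective f -> injective g -> injective (pairf f g).
Proof.
move=> fI gI u v; case: (mxtens_indexP u) => i j; case: (mxtens_indexP v) => k l.
by rewrite !pairfE => /(can_inj (@mxtens_indexK _ _)) [/fI -> /gI ->].
Qed.

Lemma equivM N N' N'' f g h (A : 'M[K]_(N, N')) (B : 'M[K]_(N', N'')) : injective g ->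
  equiv_mx f g A -> equiv_mx g h B -> equiv_mx f h (A *m B).
Proof.
move=> gI eA eB j k; rewrite !mxE (reindex_inj gI).
by apply: eq_bigr => i _; rewrite eA eB.
Qed.

Lemma equiv_adj N N' f g (A : 'M[K]_(N, N')) : equiv_mx f g A -> equiv_mx g f (adjm A).
Proof. by move=> eA j k; rewrite !adjE eA. Qed.

Lemma equiv_sum N N' f g (I : finType) (A : I -> 'M[K]_(N, N')) :
  (forall i, equiv_mx f g (A i)) -> equiv_mx f g (\sum_i A i).
Proof. by move=> eA j k; rewrite !summxE; apply: eq_bigr => i _; apply: eA. Qed.

Lemma equivB N N' f g (A B : 'M[K]_(N, N')) :
  equiv_mx f g A -> equiv_mx f g B -> equiv_mx f g (A - B).
Proof. by move=> eA eB j k; have h := eA j k; have h' := eB j k; rewrite !mxE h h'. Qed.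

Lemma equivZ N N' f g (A : 'M[K]_(N, N')) c : equiv_mx f g A -> equiv_mx f g (c *: A).
Proof. by move=> eA j k; have h := eA j k; rewrite !mxE h. Qed.

Lemma equiv1 N (f : 'I_N -> 'I_N) : injective f -> equiv_mx f f 1%:M.
Proof. by move=> fI j k; rewrite !mxE (inj_eq fI). Qed.

Lemma equiv_fcalc N (f : 'I_N -> 'I_N) h (A : 'M[K]_N) : injective f -> adjm A = A ->
  equiv_mx f f A -> equiv_mx f f (fcalc h A).
Proof. exact: fcalc_inv. Qed.

Lemma equiv_tens N N' M M' f g h k (A : 'M[K]_(N, N')) (B : 'M[K]_(M, M')) :
  equiv_mx f g A -> equiv_mx h k B -> equiv_mx (pairf f h) (pairf g k) (A *t B).
Proof.
move=> eA eB u v; case: (mxtens_indexP u) => i j; case: (mxtens_indexP v) => i' j'.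
by rewrite !pairfE !tensmxE eA eB.
Qed.

Lemma equiv_ptrl N M (f : 'I_N -> 'I_N) (g : 'I_M -> 'I_M) (X : 'M[K]_(N * M)) :
  injective f -> equiv_mx (pairf f g) (pairf f g) X -> equiv_mx g g (ptr (@jl _ _ N M) X).
Proof.
move=> fI eX j k; rewrite !ptr_jlE (reindex_inj fI); apply: eq_bigr => i _.
by rewrite -[RHS]eX !pairfE.
Qed.

Lemma equiv_ptrr N M (f : 'I_N -> 'I_N) (g : 'I_M -> 'I_M) (X : 'M[K]_(N * M)) :
  injective g -> equiv_mx (pairf f g) (pairf f g) X -> equiv_mx f f (ptr (@jr _ _ N M) X).
Proof.
move=> gI eX j k; rewrite !ptr_jrE (reindex_inj gI); apply: eq_bigr => i _.
by rewrite -[RHS]eX !pairfE.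
Qed.

Lemma equiv_cut a e M (D L : R) (w : 'M[K]_(a * e)) f g : injective f -> injective g ->
  is_st w -> equiv_mx (pairf f g) (pairf f g) w ->
  equiv_mx (pairf f g) (pairf f g) (cut M D L w).
Proof.
move=> fI gI sw ew; have pI := pairf_inj fI gI; apply: equiv_sum => x.
set Q := amp _ _.
have eQ : equiv_mx (pairf f g) (pairf f g) Q.
  rewrite /Q amp_jlE; apply: equiv_tens; first exact: equiv1.
  apply: equiv_fcalc => //; last exact: equiv_ptrl ew.
  by case: (st_ptr (jl_blocks a e) sw) => -[].
have hQ : adjm Q = Q by rewrite adj_amp bin_adj.
apply: equiv_fcalc => //.
  by rewrite !adjM hQ (proj1 (proj1 sw)) mulmxA.
exact: (equivM pI (equivM pI eQ ew) eQ).
Qed.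

Lemma equiv_tpow D d D' d' n (l : 'I_D -> 'I_n -> 'I_d) l' (m : 'I_D' -> 'I_n -> 'I_d') m'
  (s : 'S_n) (A : 'M[K]_(d, d')) : labeling l l' -> labeling m m' ->
  equiv_mx (relab l l' s) (relab m m' s) (tpow l m A).
Proof.
move=> hl hm j k; rewrite !mxE [RHS](reindex_inj (@perm_inj _ s)) /=.
by apply: eq_bigr => i _; rewrite (relabE hl) (relabE hm).
Qed.

Lemma relab_lprod D1 d1 D2 d2 n (l1 : 'I_D1 -> 'I_n -> 'I_d1) l1'
  (l2 : 'I_D2 -> 'I_n -> 'I_d2) l2' s :
  relab (lprod l1 l2) (unlprod l1' l2') s = pairf (relab l1 l1' s) (relab l2 l2' s).
Proof.
apply/funext => u; case: (mxtens_indexP u) => i j; rewrite pairfE /relab /unlprod.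
by congr (_ ## _); congr (_ _); apply/funext => m; rewrite lprodE mxtens_indexK.
Qed.

End Equivariance.

Section TpowPtr.
Context {R : realType} {K : cplx R}.
Variables (n D1 d1 D2 d2 : nat) (l1 : 'I_D1 -> 'I_n -> 'I_d1) (l1' : ('I_n -> 'I_d1) -> 'I_D1).
Variables (l2 : 'I_D2 -> 'I_n -> 'I_d2) (l2' : ('I_n -> 'I_d2) -> 'I_D2).

Lemma ptrr_tpow (X : 'M[K]_(d1 * d2)) : labeling l2 l2' ->
  ptr (@jr _ _ D1 D2) (tpow (lprod l1 l2) (lprod l1 l2) X) = tpow l1 l1 (ptr (@jr _ _ d1 d2) X).
Proof.
move=> hl; apply/matrixP => j k; rewrite ptr_jrE mxE.
under [RHS]eq_bigr do rewrite ptr_jrE.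
rewrite -(sum_prod_labeling (fun i u => X (l1 j i ## u) (l1 k i ## u)) hl).
by apply: eq_bigr => u _; rewrite mxE; apply: eq_bigr => i _; rewrite !lprodE.
Qed.

Lemma ptrl_tpow (X : 'M[K]_(d1 * d2)) : labeling l1 l1' ->
  ptr (@jl _ _ D1 D2) (tpow (lprod l1 l2) (lprod l1 l2) X) = tpow l2 l2 (ptr (@jl _ _ d1 d2) X).
Proof.
move=> hl; apply/matrixP => j k; rewrite ptr_jlE mxE.
under [RHS]eq_bigr do rewrite ptr_jlE.
rewrite -(sum_prod_labeling (fun i u => X (u ## l2 j i) (u ## l2 k i)) hl).
by apply: eq_bigr => u _; rewrite mxE; apply: eq_bigr => i _; rewrite !lprodE.
Qed.

End TpowPtr.

Section Numeric.
Context {R : realType}.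

(** Splitting the rate as [(m + 1) q] and raising [x <= expR x] to the power [m + 1] leaves one
    factor [n + 1] to spare, which beats the constant. *)
Lemma poly_expR_small (C : R) (m : nat) (r eta : R) : 0 < r -> 0 < eta ->
  exists n0 : nat, forall n, (n0 <= n)%N -> C * n.+1%:R ^+ m * expR (- (n%:R * r)) <= eta.
Proof.
move=> r0 e0; have [q q0 qE] : exists2 q, 0 < q & m.+1%:R * q = r.
  by exists (r / m.+1%:R); rewrite ?divr_gt0 // mulrCA divff ?mulr1.
pose B := `|C| * expR r / q ^+ m.+1; have B0 : 0 <= B.
  by rewrite divr_ge0 ?exprn_ge0 ?(ltW q0) // mulr_ge0 // expR_ge0.
exists (Num.truncn (B / eta)).+1 => n hn; have n1 : 0 < n.+1%:R :> R by [].
have h1 : B / eta <= n.+1%:R.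
  have /andP[_ h] := truncn_itv (divr_ge0 B0 (ltW e0)).
  by apply: le_trans (ltW h) _; rewrite ler_nat (leq_trans hn).
have h2 : (n.+1%:R * q) ^+ m.+1 <= expR (n.+1%:R * r).
  have -> : expR (n.+1%:R * r) = expR (n.+1%:R * q) ^+ m.+1.
    by rewrite -expRM_natl mulrCA qE.
  rewrite ler_pXn2r ?nnegrE ?expR_ge0 ?mulr_ge0 ?(ltW q0) ?(ltW r0) //.
  by apply: le_trans (expR_ge1Dx _); rewrite lerDr.
have h3 : n.+1%:R ^+ m * q ^+ m.+1 * n.+1%:R <= expR (n%:R * r) * expR r.
  rewrite -expRD; have -> : n%:R * r + r = n.+1%:R * r by rewrite -natr1; ring.
  by apply: le_trans h2; rewrite exprMn (exprSr n.+1%:R) mulrAC.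
rewrite expRN ler_pdivrMr ?expR_gt0 //.
apply: le_trans (_ : `|C| * n.+1%:R ^+ m <= _); first by rewrite ler_wpM2r ?exprn_ge0 ?ler_norm.
rewrite -(ler_pM2r (exprn_gt0 m.+1 q0)) -(ler_pM2r n1).
apply: le_trans (_ : `|C| * (expR (n%:R * r) * expR r) <= _).
  by rewrite -!mulrA ler_wpM2l // !mulrA.
rewrite ler_pdivrMr // in h1.
have -> : `|C| * (expR (n%:R * r) * expR r) = B * q ^+ m.+1 * expR (n%:R * r).
  by rewrite /B divfK ?gt_eqF ?exprn_gt0 //; ring.
have -> : eta * expR (n%:R * r) * q ^+ m.+1 * n.+1%:R = (n.+1%:R * eta) * q ^+ m.+1 * expR (n%:R * r) by ring.
by rewrite ler_wpM2r ?expR_ge0 // ler_wpM2r // exprn_ge0 // ltW.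
Qed.

End Numeric.

(** * The cut of a tensor power *)

Section CutPower.
Context {R : realType} {K : cplx R}.
Local Notation rc := (rc K).

Lemma max_mixed_st d : (0 < d)%N -> is_st (rc d%:R^-1 *: 1%:M : 'M[K]_d).
Proof.
move=> d0; have dp : 0 < d%:R :> R by rewrite ltr0n.
split; first by apply: psdZ; rewrite ?rc_ge0 ?invr_ge0 ?(ltW dp) //; apply: psd1.
by rewrite trRZ /tre mxtrace1 -(rmorph_nat rc) rcK mulVf // gt_eqF.
Qed.

Lemma psd_quad n (A : 'M[K]_n) : adjm A = A ->
  (forall v : 'cV[K]_n, 0 <= tre (adjm v *m A *m v)) -> psdm A.
Proof.
move=> hA h; split=> // v; have := h v; rewrite /tre /mxtrace big_ord1.
set x := (_ *m v) 0 0 => x0; suff xr : x \is Num.real by rewrite -(re_real xr) rc_ge0.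
by apply/CrealP; rewrite /x -adjE !adjM adjK hA mulmxA.
Qed.

Lemma gram_invertible n (A : 'M[K]_n) (c : R) : 0 < c -> lwle (rc c *: 1%:M) A ->
  exists G G' : 'M[K]_n, A = G *m adjm G /\ G *m G' = 1%:M.
Proof.
move=> c0 hc; have hA : adjm A = A.
  have := proj1 hc; rewrite adjB adjZ conj_rc adj1 => /(congr1 (fun X => X + rc c *: 1%:M)).
  by rewrite !subrK.
have [U [d [u eA]]] := spec_exists hA.
have dc i : c <= d i.
  rewrite -subr_ge0; apply: (@psd_rdiagE _ K _ (fun i => d i - c)); have := psd_conj' U hc.
  rewrite mulmxBr mulmxBl eA !mulmxA u mul1mx -scalemxAr mulmx1 -scalemxAl u unitaryVK //.
  suff -> : rdiag (fun i0 => d i0 - c) = rdiag d - rc c *: 1%:M :> 'M[K]_n by [].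
  apply/matrixP => k l; rewrite !mxE.
  by case: (k == l); rewrite ?mulr1n ?mulr0n ?rmorphB ?mulr1 ?mulr0 ?subrr.
have d0 i : 0 < d i by apply: lt_le_trans (dc i).
exists (U *m rdiag (fun i => Num.sqrt (d i))), (rdiag (fun i => (Num.sqrt (d i))^-1) *m adjm U).
split.
  rewrite adjM adj_rdiag mulmxA -[U *m _ *m _]mulmxA rdiagM {1}eA; congr (_ *m _ *m _).
  by apply: eq_rdiag => i; rewrite -expr2 sqr_sqrtr // ltW.
rewrite mulmxA -[U *m _ *m _]mulmxA rdiagM (_ : rdiag _ = 1%:M) ?mulmx1 ?unitaryV //.
rewrite -rdiag1; apply: eq_rdiag => i; rewrite divff // gt_eqF // sqrtr_gt0 //.
Qed.

Section Setup.
Variables (al ep be sd : nat) (V0 : 'M[K]_((al * ep) * be, sd)) (D0 : R).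
Hypotheses (isoV : adjm V0 *m V0 = 1%:M) (sd0 : (0 < sd)%N).
Local Notation HE X := (ent (ptr (@jl R K al ep) X)).
Hypothesis hD : forall X, is_st X -> ent (AEm V0 X) - HE (AEm V0 X) <= D0.

Lemma AEm_st s a e b (V : 'M[K]_((a * e) * b, s)) X :
  adjm V *m V = 1%:M -> is_st X -> is_st (AEm V X).
Proof.
move=> iV [pX X1]; apply: st_ptr; first exact: jr_blocks.
split; first exact: psd_conj.
by rewrite trRC mulmxA iV mul1mx.
Qed.

Section Level.
Variables (n A E B S : nat) (la : 'I_A -> 'I_n -> 'I_al) (le : 'I_E -> 'I_n -> 'I_ep).
Variables (lb : 'I_B -> 'I_n -> 'I_be) (ls : 'I_S -> 'I_n -> 'I_sd).
Variables (la' : ('I_n -> 'I_al) -> 'I_A) (le' : ('I_n -> 'I_ep) -> 'I_E).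
Variables (lb' : ('I_n -> 'I_be) -> 'I_B) (ls' : ('I_n -> 'I_sd) -> 'I_S).
Hypotheses (hla : labeling la la') (hle : labeling le le').
Hypotheses (hlb : labeling lb lb') (hls : labeling ls ls').
Let lae := lprod la le.
Let hlae : labeling lae (unlprod la' le'). Proof. exact: lprod_labeling. Qed.
Let hlaeb : labeling (lprod lae lb) (unlprod (unlprod la' le') lb').
Proof. exact: lprod_labeling. Qed.
Definition Vpow : 'M[K]_((A * E) * B, S) := tpow (lprod lae lb) ls V0.

Lemma Vpow_iso : adjm Vpow *m Vpow = 1%:M.
Proof. by rewrite adj_tpow -(tpowM _ _ _ _ hlaeb) isoV (tpow1 hls). Qed.

Lemma AEm_Vpow X : AEm Vpow (tpow ls ls X) = tpow lae lae (AEm V0 X).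
Proof.
rewrite /AEm adj_tpow -!(tpowM _ _ _ _ hls).
exact: ptrr_tpow hlb.
Qed.

Variables (M : nat) (delta : R).
Hypotheses (n0 : (0 < n)%N) (d0 : 0 < delta) (hM : ep%:R <= M%:R * delta).
Let D := n%:R * delta.
Let L := n%:R * (D0 + 4 * delta).
Let Dp : 0 < D. Proof. by rewrite mulr_gt0 // ltr0n. Qed.
(** The Chernoff rate on [AE], the one on [E] at half the slack, and the exponent left over in the
    two cases of [rest_tpow]. *)
Definition cut_rate := Num.min (Num.min (rate (al * ep) delta) (rate ep (delta / 2))) (delta / 2).

Lemma rest_tpow (w : 'M[K]_(A * E)) (sg : 'M[K]_sd) kappa (x : 'I_M.+1) :
  is_st w -> is_st sg -> 1 <= kappa -> lwle (tpow lae lae (AEm V0 sg)) (rc kappa *: w) ->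
  tre (rest D L w x *m tpow lae lae (AEm V0 sg)) <= (1 + kappa) * expR (- (n%:R * cut_rate)).
Proof.
move=> sw ss k1 Sw; have k0 : 0 <= kappa by apply: le_trans k1.
have sX := AEm_st isoV ss; set X := AEm V0 sg in Sw sX *.
have sT := st_tpow hlae sX; have sXE := st_ptr (jl_blocks al ep) sX.
have [U [p [sU p0 p1]]] := st_spec sX; have [UE [q [sUE q0 q1]]] := st_spec sXE.
have hent := hD ss; rewrite -/X in hent; have np : 0 < n%:R :> R by rewrite ltr0n.
(* The bins are split at the typical eigenvalue of the [E] marginal, with slack [2 delta]. For
   smaller eigenvalues [ent X - D0 <= HE X] and the [4 delta] in [L] leave an exponent of at least
   [delta]. For larger ones the rank of the bin decides, with [delta / 2] to spare, and [hM] shows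
   that the bin is not the last. *)
have [h|h] := leP (HE X - 2 * delta) (x%:R * delta).
  have hb := rest_boundA D L sw sT k0 Sw x (spec_tpow hlae sU) (expR_gt0 (- (n%:R * (ent X + delta)))).
  apply: le_trans hb _.
  rewrite mulrDl mul1r; apply: lerD.
    rewrite (ent_spec sU); apply: le_trans (upper_tail hlae p0 p1 d0) _.
    by rewrite ler_expR lerN2 ler_pM2l // /cut_rate !ge_min lexx.
  rewrite -mulrA ler_wpM2l // -expRN -expRD ler_expR /L /D opprK -mulNr.
  have -> : - n%:R * cut_rate = n%:R * - cut_rate by ring.
  have -> : - (n%:R * (D0 + 4 * delta) + x%:R * (n%:R * delta)) + n%:R * (ent X + delta) =
    n%:R * (ent X - D0 - 3 * delta - x%:R * delta) by ring.
  rewrite ler_pM2l //; have : cut_rate <= delta / 2 by rewrite /cut_rate ge_min lexx orbT.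
  by move: h hent d0; lra.
have xM : (x < M)%N.
  rewrite -(ltr_nat R) -(ltr_pM2r d0); apply: lt_le_trans h _.
  have := ent_ub sXE; move: hM d0; lra.
have sTE : spec (ptr (@jl _ _ A E) (tpow lae lae X)) (tpow le le UE) (fun k => \prod_i q (le k i)).
  by rewrite (ptrl_tpow _ _ hla); apply: spec_tpow hle sUE.
have hb := rest_boundE L Dp sw sT xM sTE (expR_ge0 (- (n%:R * (HE X - delta / 2)))).
apply: le_trans hb _.
rewrite mulrDl mul1r; apply: lerD.
  rewrite (ent_spec sUE); apply: le_trans (lower_tail hle q0 q1 _) _; first by rewrite divr_gt0.
  by rewrite ler_expR lerN2 ler_pM2l // /cut_rate !ge_min lexx orbT.
rewrite -expRD; apply: le_trans (_ : expR (- (n%:R * cut_rate)) <= _); last first.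
  by rewrite ler_peMl ?expR_ge0.
rewrite ler_expR /D -[X in _ <= X]mulrN.
have -> : - (n%:R * (HE X - delta / 2)) + x.+1%:R * (n%:R * delta) =
  n%:R * (x.+1%:R * delta - HE X + delta / 2) by ring.
rewrite ler_pM2l //; have : cut_rate <= delta / 2 by rewrite /cut_rate ge_min lexx orbT.
by move: h d0; rewrite -[x.+1%:R]natr1 mulrDl mul1r; lra.
Qed.

Lemma cut_step : exists P : 'M[K]_(A * E), [/\ adjm P = P, P *m P = P,
  lwle (1%:M - cutV Vpow P)
    (rc (3 * M.+1%:R * (n.+1 ^ (sd * sd))%:R ^+ 6 * expR (- (n%:R * cut_rate))) *: 1%:M) &
  cpm (fun X => rc (M.+1%:R * expR L) *: kr (replK Vpow) X - kr (cutK Vpow P) X)].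
Proof.
have [F [sigma [cF sF hF]]] := @universal_family R K _ _ _ ls ls' hls n0.
pose p : R := (n.+1 ^ (sd * sd))%:R; have p1 : 1 <= p by rewrite ler1n expn_gt0.
have p21 : 1 <= p ^+ 2 by rewrite exprn_ege1.
have cFp : #|F|%:R <= p ^+ 2 by rewrite /p -natrX ler_nat.
(* The maximally mixed state joins the family to make [tau] invertible, as [cut_order] requires. *)
pose fam (o : option F) : 'M[K]_sd :=
  if o is Some k then sigma k else rc sd%:R^-1 *: 1%:M.
have sdp : 0 < sd%:R :> R by rewrite ltr0n.
have s1 := max_mixed_st sd0.
have sfam o : is_st (fam o) by case: o.
pose kappa : R := #|{: option F}|%:R.
have kp : 0 < kappa by rewrite ltr0n card_option.
pose tau : 'M[K]_S := rc kappa^-1 *: \sum_o tpow ls ls (fam o).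
have ptau o : psdm (tpow ls ls (fam o)) by apply: psd_tpow hls _; case: (sfam o).
have stau : is_st tau.
  split; first by apply: psdZ; [rewrite rc_ge0 invr_ge0 ltW | apply: psd_sum => o _].
  rewrite trRZ trR_sum (eq_bigr (fun=> 1)) => [|o _].
    by rewrite sumr_const mulVf // gt_eqF.
  by case: (st_tpow hls (sfam o)).
have [G [G' [eG GG']]] : exists G G' : 'M[K]_S, tau = G *m adjm G /\ G *m G' = 1%:M.
  apply: (@gram_invertible _ _ (kappa^-1 * sd%:R^-1 ^+ n)).
    by rewrite mulr_gt0 ?exprn_gt0 ?invr_gt0.
  rewrite rmorphM -scalerA /lwle -scalerBr; apply: psdZ; first by rewrite rc_ge0 invr_ge0 ltW.
  rewrite (bigD1 None) //= addrAC -[X in psdm X]add0r addrA; apply: psdD; last exact: psd_sum.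
  rewrite add0r (_ : tpow _ _ _ = rc (sd%:R^-1 ^+ n) *: 1%:M) ?subrr; first exact: psd0.
  rewrite -(tpow1 (K := K) hls); apply/matrixP => j k; rewrite !mxE.
  rewrite rmorphXn -[X in _ ^+ X]card_ord -prodr_const -big_split; apply: eq_bigr => i _.
  by rewrite !mxE.
pose w := AEm Vpow tau.
have sw : is_st w by apply: AEm_st => //; apply: Vpow_iso.
have Sw k : lwle (tpow lae lae (AEm V0 (sigma k))) (rc kappa *: w).
  rewrite /w AEmZ scalerA -rmorphM divff ?gt_eqF // rmorph1 scale1r AEm_sum.
  rewrite (bigD1 (Some k)) //= AEm_Vpow /lwle addrAC subrr add0r.
  by apply: psd_sum => o _; apply: AEm_psd.
exists (cut M D L w); split.
- exact: cut_adj.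
- exact: cut_idem.
- set c := _ * expR _; set Z := 1%:M - _.
  have hZ : adjm Z = Z.
    rewrite adjB adj1 /Z; congr (_ - _); apply: proj1; apply: cutV_psd.
    by rewrite -(cut_idem M D L sw) -{1}cut_adj; apply: psd_gram.
  have P1 : lwle (cut M D L w) 1%:M by apply: proj_le1; [apply: cut_adj | apply: cut_idem].
  have pZ : psdm Z by apply: cutV_le1 => //; apply: Vpow_iso.
  have eZ s j k : Z (relab ls ls' s j) (relab ls ls' s k) = Z j k.
    have rI := relab_inj hls (s := s).
    have eV : equiv_mx (pairf (pairf (relab la la' s) (relab le le' s)) (relab lb lb' s))
        (relab ls ls' s) Vpow.
      by rewrite -!relab_lprod; apply: equiv_tpow.
    have fI := relab_inj hla (s := s); have gI := relab_inj hle (s := s).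
    have hI := relab_inj hlb (s := s); have pI := pairf_inj fI gI.
    have etau : equiv_mx (relab ls ls' s) (relab ls ls' s) tau.
      by apply/equivZ/equiv_sum => o; apply: equiv_tpow.
    have eAE X : equiv_mx (relab ls ls' s) (relab ls ls' s) X ->
        equiv_mx (pairf (relab la la' s) (relab le le' s)) (pairf (relab la la' s) (relab le le' s)) (AEm Vpow X).
      move=> eX; apply: equiv_ptrr hI _.
      exact: equivM rI (equivM rI eV eX) (equiv_adj eV).
    apply: (equivB (equiv1 rI)).
    have eP := equiv_cut M D L fI gI sw (eAE _ etau).
    have pI' := pairf_inj pI hI; rewrite /cutV amp_jrE.
    exact: (equivM pI' (equivM pI' (equiv_adj eV) (equiv_tens eP (equiv1 hI))) eV).
  apply: psd_quad => [|v]; first by rewrite adjB adjZ conj_rc adj1 hZ.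
  rewrite mulmxBr mulmxBl trRB subr_ge0 -scalemxAr -scalemxAl trRZ.
  apply: le_trans (hF Z v pZ eZ) _; rewrite -/p mulrAC ler_wpM2r //; first by apply: qf_ge0; apply: psd1.
  have hk k : tre (Z *m tpow ls ls (sigma k)) <=
      M.+1%:R * ((1 + kappa) * expR (- (n%:R * cut_rate))).
    have -> : tre (Z *m tpow ls ls (sigma k)) =
        tre ((1%:M - cut M D L w) *m tpow lae lae (AEm V0 (sigma k))).
      rewrite mulmxBl [in RHS]mulmxBl !trRB mul1mx tre_cutV AEm_Vpow mul1mx; congr (_ - _).
      by rewrite (proj2 (st_tpow hls (sF k))) (proj2 (st_tpow hlae (AEm_st isoV (sF k)))).
    rewrite -(sum_rest M D L sw) mulmx_suml trR_sum.
    have -> : M.+1%:R * ((1 + kappa) * expR (- (n%:R * cut_rate))) =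
        \sum_(x < M.+1) (1 + kappa) * expR (- (n%:R * cut_rate)).
      by rewrite sumr_const card_ord mulr_natl.
    by apply: ler_sum => x _; apply: rest_tpow => //; rewrite ler1n card_option.
  apply: le_trans (_ : p ^+ 2 * (#|F|%:R * (M.+1%:R * ((1 + kappa) * expR (- (n%:R * cut_rate))))) <= _).
    rewrite ler_wpM2l ?exprn_ge0 ?(le_trans _ p1) //.
    by rewrite mulr_natl -sumr_const; apply: ler_sum => k _; apply: hk.
  (* The sixth power of [p] consists of [p^2] from the universal bound, [p^2] from the size of the
     family, and [3 p^2] from [1 + kappa]. *)
  have kb : 1 + kappa <= 3 * p ^+ 2 by rewrite /kappa card_option -[#|F|.+1%:R]natr1; move: cFp p21; lra.
  rewrite /c -/p; set q := expR _; have q0 : 0 <= q := expR_ge0 _.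
  have -> : 3 * M.+1%:R * p ^+ 6 * q = p ^+ 2 * (p ^+ 2 * (M.+1%:R * ((3 * p ^+ 2) * q))) by ring.
  rewrite ler_wpM2l ?exprn_ge0 ?(le_trans _ p1) //.
  apply: ler_pM => //; first by rewrite !mulr_ge0 // addr_ge0 // ltW.
  by rewrite ler_wpM2l // ler_wpM2r.
apply: cut_order GG' _ => u; apply: cut_star => //.
by rewrite Omg_gram -eG.
Qed.

End Level.

Lemma cpm_scale_mono d1 d2 (f g : 'M[K]_d1 -> 'M[K]_d2) (c c' : R) : c <= c' -> cpm f ->
  cpm (fun X => rc c *: f X - g X) -> cpm (fun X => rc c' *: f X - g X).
Proof.
move=> cc' cf cg r X pX.
have -> : idt (fun X => rc c' *: f X - g X) X =
    rc (c' - c) *: idt f X + idt (fun X => rc c *: f X - g X) X.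
  apply: tens_matrixP => i k j l; rewrite idtE.
  have h1 := idtE f X i j k l; have h2 := idtE (fun X => rc c *: f X - g X) X i j k l.
  rewrite [RHS]mxE h2 [X in _ = X + _]mxE h1 !mxE rmorphB; ring.
by apply: psdD; [apply: psdZ; [rewrite rc_ge0 subr_ge0|apply: cf]|apply: cg].
Qed.

(** The fifth [delta] pays for the factor [M + 1], which does not depend on [n]. *)
Lemma cut_asymptotic (delta eta : R) : 0 < delta -> 0 < eta -> exists n0, forall n, (n0 <= n)%N ->
  forall (A E B S : nat) (la : 'I_A -> 'I_n -> 'I_al) (le : 'I_E -> 'I_n -> 'I_ep)
    (lb : 'I_B -> 'I_n -> 'I_be) (ls : 'I_S -> 'I_n -> 'I_sd) la' le' lb' ls',
  labeling la la' -> labeling le le' -> labeling lb lb' -> labeling ls ls' ->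
  exists P : 'M[K]_(A * E), [/\ adjm P = P, P *m P = P,
    lwle (1%:M - cutV (Vpow la le lb ls) P) (rc eta *: 1%:M) &
    cpm (fun X => rc (expR (n%:R * (D0 + 5 * delta))) *: kr (replK (Vpow la le lb ls)) X -
                  kr (cutK (Vpow la le lb ls) P) X)].
Proof.
move=> d0 e0; pose M := (Num.truncn (ep%:R / delta)).+1.
have hM : ep%:R <= M%:R * delta.
  rewrite -ler_pdivrMr //; have /andP[_ /ltW] // := truncn_itv (divr_ge0 (ler0n R ep) (ltW d0)).
have sdp : 0 < sd%:R :> R by rewrite ltr0n.
have s1 := max_mixed_st sd0.
have r0 : 0 < cut_rate delta.
  have sX := AEm_st isoV s1; have [U [p [_ _ p1]]] := st_spec sX.
  have [UE [q [_ _ q1]]] := st_spec (st_ptr (jl_blocks al ep) sX).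
  have d2 : 0 < delta / 2 by rewrite divr_gt0.
  have [h1 _ _] := rate_params p1 d0; have [h2 _ _] := rate_params q1 d2.
  by rewrite /cut_rate !lt_min d2 andbT /rate; apply/andP; split; rewrite !divr_gt0 // mulr_gt0.
have [n1 h1] := poly_expR_small (3 * M.+1%:R) ((sd * sd) * 6) r0 e0.
have [n2 h2] := poly_expR_small M.+1%:R 0 d0 ltr01.
exists (maxn 1 (maxn n1 n2)) => n; rewrite !geq_max => /and3P[np hn1 hn2].
move=> A E B S la le lb ls la' le' lb' ls' hla hle hlb hls.
have [P [hP iP PV PC]] := cut_step hla hle hlb hls np d0 hM.
exists P; split=> //.
  apply: psd_le_trans PV _; rewrite /lwle -scalerBl -rmorphB; apply: psdZ; last exact: psd1.
  by rewrite rc_ge0 subr_ge0; have := h1 n hn1; rewrite exprM natrX.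
apply: cpm_scale_mono PC; last exact: kr_cp.
have := h2 n hn2; rewrite expr0 mulr1 expRN ler_pdivrMr ?expR_gt0 // mul1r => h.
have -> : n%:R * (D0 + 5 * delta) = n%:R * delta + n%:R * (D0 + 4 * delta) by ring.
by rewrite expRD ler_wpM2r // expR_ge0.
Qed.

End Setup.
End CutPower.

Section MiddleBlocks.
Context {R : realType} {K : cplx R}.
Local Notation rc := (rc K).

Lemma amp_sel a N M (J : 'I_a -> 'M[K]_(N, M)) (s : 'I_a -> 'I_M -> 'I_N) :
  (forall i j k m, J j (s i k) m = ((i == j) && (k == m))%:R) ->
  forall Y i j k m, amp J Y (s i k) (s j m) = (i == j)%:R * Y k m.
Proof.
move=> JE Y i j k m.
have e x : (J x *m Y *m adjm (J x)) (s i k) (s j m) = ((i == x) && (j == x))%:R * Y k m.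
  rewrite mxE (bigD1 m) //= adjE JE eqxx andbT rmorph_nat.
  rewrite big1 ?addr0 => [|m' /negPf ne]; last first.
    by rewrite adjE JE [m == m']eq_sym ne andbF rmorph0 mulr0.
  rewrite mxE (bigD1 k) //= JE eqxx andbT big1 ?addr0 => [|k' /negPf ne]; last first.
    by rewrite JE [k == k']eq_sym ne andbF mul0r.
  by rewrite mulrAC -natrM mulnb.
rewrite summxE; under eq_bigr do rewrite e.
rewrite -mulr_suml; congr (_ * _); have [<-|ne] := eqVneq i j.
  by rewrite (bigD1 i) //= eqxx big1 ?addr0 // => x /negPf ne; rewrite eq_sym ne.
by rewrite big1 // => x _; case: (eqVneq i x) => [<-|] //=; rewrite eq_sym (negPf ne).
Qed.

(** Inserts the basis vector [i] of [A] between reference and [B]; [ptr] for these blocks is the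
    marginal on reference and [B]. *)
Definition jm r a b (i : 'I_a) : 'M[K]_(r * (a * b), r * b) := 1%:M *t jl b i.

Lemma jm_sel r a b n (i : 'I_a) (X : 'M[K]_(r * (a * b), n)) p q c :
  (adjm (jm r b i) *m X) (p ## q) c = X (p ## (i ## q)) c.
Proof.
rewrite adj_tens adj1 tens1_mulE.
have := jl_sel i (\matrix_(u, c') X (p ## u) c') q c; rewrite [in RHS]mxE => <-.
by rewrite [RHS]mxE; apply: eq_bigr => l _; congr (_ * _); rewrite mxE.
Qed.

Lemma jmE r a b (i j : 'I_a) p q p' q' :
  jm r b j (p ## (i ## q)) (p' ## q') = ((i == j) && ((p ## q) == (p' ## q')))%:R :> K.
Proof.
rewrite tensmxE !mxE mxtens_indexK /= (can_eq (@mxtens_indexK _ _)) xpair_eqE -natrM mulnb.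
by rewrite andbCA.
Qed.

Lemma jm_blocks r a b : blocks (@jm r a b).
Proof.
apply: (blocks_sel (s := fun i k => (mxtens_unindex k).1 ## (i ## (mxtens_unindex k).2))).
- by move=> n X i k c; case: (mxtens_indexP k) => p q; rewrite jm_sel mxtens_indexK.
- move=> i j k m; case: (mxtens_indexP k) => p q; case: (mxtens_indexP m) => p' q'.
  by rewrite jmE !mxtens_indexK.
- move=> u; case: (mxtens_indexP u) => p v; case: (mxtens_indexP v) => i q.
  by exists i, (p ## q); rewrite mxtens_indexK.
Qed.

Lemma amp_jmE r a b (Y : 'M[K]_(r * b)) p i q p' i' q' :
  amp (@jm r a b) Y (p ## (i ## q)) (p' ## (i' ## q')) = (i == i')%:R * Y (p ## q) (p' ## q').
Proof.
pose s i (k : 'I_(r * b)) : 'I_(r * (a * b)) := (mxtens_unindex k).1 ## (i ## (mxtens_unindex k).2).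
have JE i0 j k m : jm r b j (s i0 k) m = ((i0 == j) && (k == m))%:R :> K.
  rewrite /s; case: (mxtens_indexP k) => u v; case: (mxtens_indexP m) => u' v'.
  by rewrite mxtens_indexK jmE.
by have := amp_sel JE Y i i' (p ## q) (p' ## q'); rewrite /s !mxtens_indexK.
Qed.

Lemma ptr_jmE r a b (X : 'M[K]_(r * (a * b))) p q p' q' :
  ptr (@jm r a b) X (p ## q) (p' ## q') = \sum_i X (p ## (i ## q)) (p' ## (i ## q')).
Proof.
rewrite summxE; apply: eq_bigr => i _; rewrite -mulmxA jm_sel.
by rewrite -[X *m _]adjK adjE adjM jm_sel adjE conjCK.
Qed.

Lemma ptrm_tpow n r a b A0 B0 R0 (lr : 'I_R0 -> 'I_n -> 'I_r) (la : 'I_A0 -> 'I_n -> 'I_a) la'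
  (lb : 'I_B0 -> 'I_n -> 'I_b) (X : 'M[K]_(r * (a * b))) : labeling la la' ->
  ptr (@jm _ _ _) (tpow (lprod lr (lprod la lb)) (lprod lr (lprod la lb)) X) =
  tpow (lprod lr lb) (lprod lr lb) (ptr (@jm _ _ _) X).
Proof.
move=> hl; apply: tens_matrixP => p q p' q'; rewrite ptr_jmE mxE.
under [RHS]eq_bigr do rewrite !lprodE ptr_jmE.
rewrite -(sum_prod_labeling (fun i u => X (lr p i ## (u ## lb q i)) (lr p' i ## (u ## lb q' i))) hl).
by apply: eq_bigr => u _; rewrite mxE; apply: eq_bigr => i _; rewrite !lprodE.
Qed.

End MiddleBlocks.

(** * Relative entropy to an amplified state *)

Section RelativeEntropy.
Context {R : realType} {K : cplx R}.
Local Notation rc := (rc K).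
Variables (a N M : nat) (J : 'I_a -> 'M[K]_(N, M)).
Hypothesis bJ : blocks J.

Lemma tre_ln_ent n (w : 'M[K]_n) : adjm w = w -> tre (w *m fcalc (@ln R) w) = - ent w.
Proof. by move=> hw; rewrite /ent opprK -{1}(fcalc_id hw) fcalcM. Qed.

Lemma tre_ln_amp (w : 'M[K]_N) (z : 'M[K]_M) : adjm w = w -> adjm z = z ->
  tre (w *m (fcalc (@ln R) w - fcalc (@ln R) (amp J z))) =
  - ent w - tre (ptr J w *m fcalc (@ln R) z).
Proof. by move=> hw hz; rewrite mulmxBr trRB tre_ln_ent // fcalc_amp // tre_amp. Qed.

Lemma supp_ptr (w : 'M[K]_N) (z : 'M[K]_M) :
  (forall v : 'cV[K]_N, amp J z *m v = 0 -> w *m v = 0) ->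
  forall v : 'cV[K]_M, z *m v = 0 -> ptr J w *m v = 0.
Proof.
move=> h v zv; rewrite /ptr mulmx_suml big1 // => i _.
by rewrite -mulmxA -mulmxA h ?mulmx0 // mulmxA (amp_J bJ) -mulmxA zv mulmx0.
Qed.

(** The logarithm of [amp J z] sees only the marginal of [w], and by Klein's inequality no [z] does
    better than that marginal. *)
Lemma ent_diff_le (w : 'M[K]_N) (z : 'M[K]_M) : is_st w -> is_st z ->
  (forall v : 'cV[K]_N, amp J z *m v = 0 -> w *m v = 0) ->
  ent (ptr J w) - ent w <= tre (w *m (fcalc (@ln R) w - fcalc (@ln R) (amp J z))).
Proof.
move=> sw sz h; have [[hw _] _] := sw; have [[hz _] _] := sz.
by rewrite tre_ln_amp // addrC lerD2l; apply: klein (st_ptr bJ sw) sz (supp_ptr h).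
Qed.

(** A vector killed by the amplified marginal makes a sum of nonnegative forms of [w] vanish, hence
    each of them. So the relative entropy to the own marginal is finite. *)
Lemma supp_amp_ptr (w : 'M[K]_N) : psdm w ->
  forall v : 'cV[K]_N, amp J (ptr J w) *m v = 0 -> w *m v = 0.
Proof.
move=> pw v hv.
have h1 i : ptr J w *m (adjm (J i) *m v) = 0.
  have := congr1 (mulmx (adjm (J i))) hv; rewrite mulmx0 => <-.
  have [[hz _] _] := (psd_ptr J pw, tt).
  have := congr1 adjm (amp_J bJ (ptr J w) i); rewrite !adjM adj_amp hz => e.
  by rewrite !mulmxA e.
have h2 i : w *m (J i *m (adjm (J i) *m v)) = 0.
  have := h1 i; move: (adjm (J i) *m v) => u hu.
  apply: psd_ker => //.
  have := congr1 (fun x : 'cV_M => (adjm u *m x) 0 0) hu.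
  rewrite mulmx0 [X in _ = X -> _]mxE /ptr mulmx_suml mulmx_sumr summxE => /psumr_eq0P h.
  rewrite adjM -[RHS](h _ i isT) ?mulmxA // => k _.
  have [_ /(_ (J k *m u))] := pw; by rewrite adjM !mulmxA.
rewrite -[v]mul1mx -(proj2 bJ) mulmx_suml mulmx_sumr big1 // => i _.
by rewrite -mulmxA h2.
Qed.

End RelativeEntropy.

(** * Complementary entropies of a purified input *)

Section Purification.
Context {R : realType} {K : cplx R}.
Local Notation rc := (rc K).
Variables (a e b s : nat) (V : 'M[K]_((a * e) * b, s)).

(** The pure state on reference, [A], [E] and [B] is reshaped across RAB|E into [X] and across RB|AE
    into [Y]. Complementary marginals are the two Gram matrices of such a matrix, up to a transpose
    that the entropy ignores. *)
Lemma purified_entropy (sg : 'M[K]_s) : is_st sg -> exists rho : 'M[K]_(s * s),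
  [/\ is_st rho, ent (idt (kr (outK V)) rho) = ent (ptr (@jl _ _ a e) (AEm V sg)) &
    ent (ptr (@jm _ _ s a b) (idt (kr (outK V)) rho)) = ent (AEm V sg)].
Proof.
move=> [psg sg1]; have [G eG] := psd_factor psg.
pose psi : 'cV[K]_(s * s) := \col_u G (mxtens_unindex u).2 (mxtens_unindex u).1.
have psiE i k : psi (i ## k) 0 = G k i by rewrite mxE mxtens_indexK.
pose X : 'M[K]_(s * (a * b), e) := \matrix_(u, x)
  (V *m G) (((mxtens_unindex (mxtens_unindex u).2).1 ## x) ## (mxtens_unindex (mxtens_unindex u).2).2)
    (mxtens_unindex u).1.
have XE i j k x : X (i ## (j ## k)) x = (V *m G) ((j ## x) ## k) i.
  by rewrite mxE !mxtens_indexK.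
pose Y : 'M[K]_(s * b, a * e) := \matrix_(u, v) (V *m G) (v ## (mxtens_unindex u).2) (mxtens_unindex u).1.
have YE i k v : Y (i ## k) v = (V *m G) (v ## k) i by rewrite mxE !mxtens_indexK.
have eW : idt (kr (outK V)) (psi *m adjm psi) = X *m adjm X.
  rewrite idt_kr; apply: tens_matrixP => i u j v; rewrite summxE [RHS]mxE.
  apply: eq_bigr => x _; case: (mxtens_indexP u) => p q; case: (mxtens_indexP v) => p' q'.
  have h i0 j0 k0 : ((1%:M *t outK V x) *m psi) (i0 ## (j0 ## k0)) 0 = X (i0 ## (j0 ## k0)) x.
    rewrite tens1_mulE XE; under eq_bigr do rewrite psiE.
    rewrite -[RHS](@js_sel _ _ a e b _ x) mulmxA [RHS]mxE.
    by apply: eq_bigr => l _.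
  by rewrite !mulmxA -mulmxA -adjM mxE big_ord1 !adjE h h.
have VG : V *m sg *m adjm V = (V *m G) *m adjm (V *m G) by rewrite eG adjM !mulmxA.
have eE : ptr (@jl _ _ a e) (AEm V sg) = (adjm X *m X)^T.
  apply/matrixP => x x'; rewrite ptr_jlE mxE [RHS]mxE sum_tens.
  under eq_bigr do rewrite ptr_jrE.
  under [RHS]eq_bigr do rewrite sum_tens.
  rewrite [RHS]exchange_big; apply: eq_bigr => j _; rewrite [RHS]exchange_big; apply: eq_bigr => k _ /=.
  by rewrite VG mxE; apply: eq_bigr => i _; rewrite !adjE XE XE mulrC.
have eAE : AEm V sg = (adjm Y *m Y)^T.
  apply/matrixP => u u'; rewrite ptr_jrE mxE [RHS]mxE sum_tens [RHS]exchange_big; apply: eq_bigr => k _ /=.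
  by rewrite VG mxE; apply: eq_bigr => i _; rewrite !adjE YE YE mulrC.
have eR : ptr (@jm _ _ s a b) (X *m adjm X) = Y *m adjm Y.
  apply: tens_matrixP => i k i' k'; rewrite ptr_jmE [RHS]mxE sum_tens; apply: eq_bigr => j _.
  by rewrite mxE; apply: eq_bigr => x _; rewrite !adjE !XE !YE.
exists (psi *m adjm psi); rewrite eW; split.
- split; first exact: psd_gram'.
  rewrite trRC -sg1 eG; rewrite /tre; congr re; rewrite /mxtrace big_ord1 mxE sum_tens exchange_big.
  by apply: eq_bigr => k _; rewrite [RHS]mxE; apply: eq_bigr => i _; rewrite !adjE psiE mulrC.
- by rewrite eE ent_tr ?ent_gram //; case: (psd_gram X).
- by rewrite eR eAE ent_tr ?ent_gram //; case: (psd_gram Y).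
Qed.

End Purification.

(** * The converse for tensor powers *)

Section Converse.
Context {R : realType} {K : cplx R}.
Local Notation rc := (rc K).

Lemma upper_tail_st n D d (l : 'I_D -> 'I_n -> 'I_d) l' (w : 'M[K]_d) (delta : R) :
  labeling l l' -> is_st w -> 0 < delta ->
  tre (fcalc (fun x => x * (x < expR (- (n%:R * (ent w + delta))))%R%:R) (tpow l l w)) <=
  expR (- (n%:R * rate d delta)).
Proof.
move=> hl sw d0; have [U [p [s p0 p1]]] := st_spec sw.
rewrite (trR_spec _ (spec_tpow hl s)) (ent_spec s).
apply: le_trans (upper_tail hl p0 p1 d0); rewrite [X in _ <= X]big_mkcond.
by apply: ler_sum => k _; case: ifP; rewrite ?mulr1 ?mulr0.
Qed.

Lemma lower_tail_st n D d (l : 'I_D -> 'I_n -> 'I_d) l' (w : 'M[K]_d) (delta : R) :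
  labeling l l' -> is_st w -> 0 < delta ->
  tre (fcalc (fun x => x * (expR (- (n%:R * (ent w - delta))) < x)%R%:R) (tpow l l w)) <=
  expR (- (n%:R * rate d delta)).
Proof.
move=> hl sw d0; have [U [p [s p0 p1]]] := st_spec sw.
rewrite (trR_spec _ (spec_tpow hl s)) (ent_spec s).
apply: le_trans (lower_tail hl p0 p1 d0); rewrite [X in _ <= X]big_mkcond.
by apply: ler_sum => k _; case: ifP; rewrite ?mulr1 ?mulr0.
Qed.

Lemma st_rate_gt0 d (w : 'M[K]_d) (delta : R) : is_st w -> 0 < delta -> 0 < rate d delta.
Proof.
move=> /st_spec[U [p [_ _ p1]]] d0; have [h _ _] := rate_params p1 d0.
by rewrite /rate divr_gt0 // mulr_gt0.
Qed.

Lemma converse_bound r a b (w : 'M[K]_(r * (a * b))) (delta : R) : is_st w -> 0 < delta ->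
  exists n0, forall n, (n0 <= n)%N ->
  forall R0 A0 B0 (lr : 'I_R0 -> 'I_n -> 'I_r) (la : 'I_A0 -> 'I_n -> 'I_a)
    (lb : 'I_B0 -> 'I_n -> 'I_b) lr' la' lb',
  labeling lr lr' -> labeling la la' -> labeling lb lb' ->
  forall (t : 'M[K]_(R0 * (A0 * B0))) xi (lam : R), is_st t -> is_st xi -> 0 <= lam ->
  lwle t (rc lam *: amp (@jm _ _ _ _ _) xi) ->
  3 / 4 <= sqf (tpow (lprod lr (lprod la lb)) (lprod lr (lprod la lb)) w) t ->
  expR (n%:R * (ent (ptr (@jm _ _ _ _ _) w) - ent w - 2 * delta)) / 4 <= lam.
Proof.
move=> sw d0; set wC := ptr _ w; have sC : is_st wC by apply: st_ptr sw; apply: jm_blocks.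
(* Two tails of 1/64 give [e1 + 2 e2 <= 1/16], whose root 1/4 leaves 1/2 of the root fidelity 3/4;
   squaring it produces the factor 4 in the conclusion. *)
have q0 : 0 < 1 / 64 :> R by rewrite divr_gt0.
have [n1 h1] := poly_expR_small 1 0 (st_rate_gt0 sw d0) q0.
have [n2 h2] := poly_expR_small 1 0 (st_rate_gt0 sC d0) q0.
exists (maxn n1 n2) => n; rewrite geq_max => /andP[hn1 hn2].
move=> R0 A0 B0 lr la lb lr' la' lb' hr ha hb t xi lam st sxi lam0 tle hF.
have hw := lprod_labeling hr (lprod_labeling ha hb); have hC := lprod_labeling hr hb.
have := typical_test_bound (jm_blocks R0 A0 B0) (st_tpow hw sw) st sxi lam0
  (expR_gt0 (- (n%:R * (ent w + delta)))) (expR_ge0 (- (n%:R * (ent wC - delta)))) tle.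
set e1 := tre _; set e2 := tre _ => hb1.
have e1b : e1 <= 1 / 64.
  apply: le_trans (upper_tail_st hw sw d0) _.
  by have := h1 n hn1; rewrite expr0 !mul1r.
have e2b : e2 <= 1 / 64.
  rewrite /e2 (ptrm_tpow _ _ _ ha); apply: le_trans (lower_tail_st hC sC d0) _.
  by have := h2 n hn2; rewrite expr0 !mul1r.
have s4 : Num.sqrt (e1 + 2 * e2) <= 1 / 4.
  have -> : 1 / 4 = Num.sqrt ((1 / 4) ^+ 2) :> R by rewrite sqrtr_sqr ger0_norm.
  by apply: ler_wsqrtr; move: e1b e2b; rewrite expr2; lra.
move: hb1; rewrite -mulrA -expRN -expRD.
have -> : - (n%:R * (ent wC - delta)) - - (n%:R * (ent w + delta)) =
  - (n%:R * (ent wC - ent w - 2 * delta)) by ring.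
set x := n%:R * _; rewrite expRN => hb1.
have : 1 / 4 <= lam / expR x.
  have -> : 1 / 4 = (1 / 2) ^+ 2 :> R by rewrite expr2; field.
  rewrite -[X in _ <= X]sqr_sqrtr ?divr_ge0 ?expR_ge0 // ler_pXn2r ?nnegrE ?sqrtr_ge0 //.
  by move: hb1 s4 hF; lra.
by rewrite ler_pdivlMr ?expR_gt0 // mul1r mulrC.
Qed.

End Converse.

(** * Abstract complex fields and the channel quantities *)

(* The notions of Defs over an arbitrary [cplx R]: over the concrete type
   [complex R] conversion keeps unfolding complex arithmetic.  At [cK R] below
   every one of them is convertible to the original. *)
Section AbstractDefs.
Context {R : realType} {K : cplx R}.
Local Notation rc := (rc K).

Definition is_stateK {d} (rho : 'M[K]_d) : Prop := psdm rho /\ \tr rho = 1.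

Definition spec_decompK {d} (A : 'M[K]_d) (Ul : 'M[K]_d * 'rV[R]_d) : Prop :=
  unitm Ul.1 /\
  A = Ul.1 *m diag_mx (map_mx (fun x => rc x) Ul.2) *m adjm Ul.1.

Definition fun_mxK (f : R -> R) {d} (A : 'M[K]_d) : 'M[K]_d :=
  let Ul := xget (1%:M, 0) (spec_decompK A) in
  Ul.1 *m diag_mx (map_mx (fun x => rc (f x)) Ul.2) *m adjm Ul.1.

Definition supp_leK {d} (rho sigma : 'M[K]_d) : Prop :=
  forall v : 'cV[K]_d, sigma *m v = 0 -> rho *m v = 0.

Definition relentK {d} (rho sigma : 'M[K]_d) : \bar R :=
  if `[< supp_leK rho sigma >] then
    (tre (rho *m (fun_mxK slog2 rho - fun_mxK slog2 sigma)))%:E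
  else +oo%E.

Definition dmaxK {d} (rho sigma : 'M[K]_d) : \bar R :=
  ereal_inf [set (log2 l)%:E | l in [set l : R | 0 < l /\ lwle rho (rc l *: sigma)]].

Definition trnormK {d} (X : 'M[K]_d) : R := tre (fun_mxK Num.sqrt (adjm X *m X)).
Definition fidelityK {d} (rho sigma : 'M[K]_d) : R :=
  (trnormK (fun_mxK Num.sqrt rho *m fun_mxK Num.sqrt sigma)) ^+ 2.

Definition tensor_mapK {a1 a2 b1 b2}
  (M : 'M[K]_a1 -> 'M[K]_a2) (N : 'M[K]_b1 -> 'M[K]_b2) :
  'M[K]_(a1 * b1) -> 'M[K]_(a2 * b2) :=
  fun X => \sum_(i < a1) \sum_(j < a1) \sum_(k < b1) \sum_(l < b1)
     X (mxtens_index (i, k)) (mxtens_index (j, l)) *: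
       (M (delta_mx i j) *t N (delta_mx k l)).

Definition idtensK (r : nat) {d1 d2} (M : 'M[K]_d1 -> 'M[K]_d2) :
  'M[K]_(r * d1) -> 'M[K]_(r * d2) := tensor_mapK (fun X : 'M[K]_r => X) M.

Definition is_linear_mapK {d1 d2} (M : 'M[K]_d1 -> 'M[K]_d2) : Prop :=
  forall (c : K) (X Y : 'M[K]_d1), M (c *: X + Y) = c *: M X + M Y.

Definition compl_posK {d1 d2} (M : 'M[K]_d1 -> 'M[K]_d2) : Prop :=
  forall (r : nat) (X : 'M[K]_(r * d1)), psdm X -> psdm (idtensK M X).

Definition trace_presK {d1 d2} (M : 'M[K]_d1 -> 'M[K]_d2) : Prop :=
  forall X : 'M[K]_d1, \tr (M X) = \tr X.

Definition channelK {d1 d2} (M : 'M[K]_d1 -> 'M[K]_d2) : Prop :=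
  [/\ is_linear_mapK M, compl_posK M & trace_presK M].

Definition chan_divK (D : forall d, 'M[K]_d -> 'M[K]_d -> \bar R)
  {d1 d2} (M M' : 'M[K]_d1 -> 'M[K]_d2) : \bar R :=
  ereal_sup [set x | exists (r : nat) (rho : 'M[K]_(r * d1)),
     is_stateK rho /\ x = D _ (idtensK M rho) (idtensK M' rho)].

Definition pdistK {d1 d2} (M1 M2 : 'M[K]_d1 -> 'M[K]_d2) : \bar R :=
  ereal_sup [set x | exists (r : nat) (rho : 'M[K]_(r * d1)),
     is_stateK rho /\
     x = (Num.sqrt (1 - fidelityK (idtensK M1 rho) (idtensK M2 rho)))%:E].

Definition replacerK (d1 d2 : nat) : 'M[K]_d1 -> 'M[K]_d2 :=
  fun X => \tr X *: 1%:M.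

Definition ptr1K {a b} (Y : 'M[K]_(a * b)) : 'M[K]_b :=
  \matrix_(k, l) \sum_(i < a) Y (mxtens_index (i, k)) (mxtens_index (i, l)).

Definition cond_entK {a' b' a b} (N : 'M[K]_(a' * b') -> 'M[K]_(a * b)) : \bar R :=
  (- ereal_inf [set chan_divK (@relentK) N (tensor_mapK (@replacerK a' a) Q)
                | Q in [set Q : 'M[K]_b' -> 'M[K]_b | channelK Q]])%E.

Definition cond_ent_nsK {a' b' a b} (N : 'M[K]_(a' * b') -> 'M[K]_(a * b)) : \bar R :=
  (- chan_divK (@relentK) N (fun X => (1%:M : 'M[K]_a) *t ptr1K (N X)))%E.

Definition smooth_minentK (eps : R) {a' b' a b}
  (N : 'M[K]_(a' * b') -> 'M[K]_(a * b)) : \bar R :=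
  (- ereal_inf [set x | exists (Q : 'M[K]_b' -> 'M[K]_b)
                       (Nt : 'M[K]_(a' * b') -> 'M[K]_(a * b)),
       [/\ channelK Q, channelK Nt, (pdistK N Nt <= eps%:E)%E &
           x = chan_divK (@dmaxK) Nt (tensor_mapK (@replacerK a' a) Q)]])%E.

Definition no_signalingK {a' b' a b} (N : 'M[K]_(a' * b') -> 'M[K]_(a * b)) : Prop :=
  exists Q : 'M[K]_b' -> 'M[K]_b,
    channelK Q /\ forall X : 'M[K]_(a' * b'), ptr1K (N X) = Q (ptr1K X).

Definition reidxK {m n} (f : 'I_m -> 'I_n) (X : 'M[K]_n) : 'M[K]_m :=
  \matrix_(i, j) X (f i) (f j).

Definition btensK {a1' b1' a1 b1 a2' b2' a2 b2}
  (N1 : 'M[K]_(a1' * b1') -> 'M[K]_(a1 * b1))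
  (N2 : 'M[K]_(a2' * b2') -> 'M[K]_(a2 * b2)) :
  'M[K]_((a1' * a2') * (b1' * b2')) -> 'M[K]_((a1 * a2) * (b1 * b2)) :=
  fun X => reidxK (@swap_mid a1 a2 b1 b2)
             (tensor_mapK N1 N2 (reidxK (@swap_mid a1' b1' a2' b2') X)).

Fixpoint bpowK {a' b' a b} (N : 'M[K]_(a' * b') -> 'M[K]_(a * b)) (n : nat) :
  'M[K]_(dpow a' n * dpow b' n) -> 'M[K]_(dpow a n * dpow b n) :=
  match n return 'M[K]_(dpow a' n * dpow b' n) -> 'M[K]_(dpow a n * dpow b n) with
  | 0 => fun X => X
  | n'.+1 => btensK N (@bpowK a' b' a b N n')
  end.

Definition reg_minentK (eps : R) {a' b' a b}
  (N : 'M[K]_(a' * b') -> 'M[K]_(a * b)) : nat -> \bar R :=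
  fun n => (((n%:R)^-1 : R)%:E * smooth_minentK eps (@bpowK a' b' a b N n))%E.

End AbstractDefs.

(** * The given notions in terms of blocks and functional calculus *)

Section Bridge.
Context {R : realType} {K : cplx R}.
Local Notation rc := (rc K).

Lemma is_stateKP d (rho : 'M[K]_d) : is_stateK rho <-> is_st rho.
Proof.
split=> [[p t]|s]; first by split; rewrite // /tre t re1.
by split; [case: s | apply: st_tr].
Qed.

(** Every spectral decomposition gives the same function, so the choice made by [xget] is
    harmless. *)
Lemma fun_mxKE f d (A : 'M[K]_d) : adjm A = A -> fun_mxK f A = fcalc f A.
Proof.
move=> hA; have dE g (v : 'rV[R]_d) :
    diag_mx (map_mx (fun x => rc (g x)) v) = rdiag (fun i => g (v 0 i)).
  by congr diag_mx; apply/rowP => i; rewrite !mxE.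
have [U [e [u eA]]] := spec_exists hA.
have [] : spec_decompK A (xget (1%:M, 0) (spec_decompK A)).
  apply: (@xgetPex _ (1%:M, 0)); exists (U, \row_i e i); split=> //=.
  by rewrite {1}eA (dE id); congr (_ *m _ *m _); apply: eq_rdiag => i; rewrite mxE.
set Ul := xget _ _; rewrite (dE id) => u' e'.
by rewrite /fun_mxK -/Ul (dE f) (@fcalc_spec _ _ _ A Ul.1 (fun i => Ul.2 0 i)).
Qed.

Lemma fidelityKE d (A B : 'M[K]_d) : psdm A -> psdm B -> fidelityK A B = sqf A B ^+ 2.
Proof.
move=> pA pB; rewrite /fidelityK /trnormK fun_mxKE; last by case: (psd_gram (fun_mxK Num.sqrt A *m fun_mxK Num.sqrt B)).
by rewrite !fun_mxKE //; [case: pB|case: pA].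
Qed.

Lemma slog2E : @slog2 R = fun x => (ln 2)^-1 * ln x.
Proof.
apply/funext => x; rewrite /slog2 /log2 [RHS]mulrC; case: ifP => // /negbT; rewrite -leNgt => x0.
by rewrite ln0 // mul0r.
Qed.

Lemma relentKE d (w z : 'M[K]_d) : adjm w = w -> adjm z = z -> supp_leK w z ->
  relentK w z = ((ln 2)^-1 * tre (w *m (fcalc (@ln R) w - fcalc (@ln R) z)))%:E.
Proof.
move=> hw hz h; rewrite /relentK asboolT // !fun_mxKE // slog2E -!fcalcZ -scalerBr -scalemxAr.
by rewrite trRZ.
Qed.

Lemma tr_delta d (i j : 'I_d) : \tr (delta_mx i j : 'M[K]_d) = (i == j)%:R.
Proof.
rewrite /mxtrace (bigD1 i) //= mxE eqxx /= big1 ?addr0 // => k /negPf ki.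
by rewrite mxE ki.
Qed.

Section Linear.
Variables (d1 d2 : nat) (M : 'M[K]_d1 -> 'M[K]_d2).
Hypothesis linM : is_linear_mapK M.

Lemma linK0 : M 0 = 0.
Proof. by have := linM 1 0 0; rewrite !scale1r addr0 => /(congr1 (fun X => X - M 0)); rewrite addrK subrr. Qed.

Lemma linKD X Y : M (X + Y) = M X + M Y.
Proof. by have := linM 1 X Y; rewrite !scale1r. Qed.

Lemma linKZ c X : M (c *: X) = c *: M X.
Proof. by have := linM c X 0; rewrite linK0 !addr0. Qed.

Lemma linK_sum (I : finType) (F : I -> 'M[K]_d1) : M (\sum_i F i) = \sum_i M (F i).
Proof. exact: (big_morph M linKD linK0). Qed.

Lemma linK_delta X : M X = \sum_i \sum_j X i j *: M (delta_mx i j).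
Proof.
rewrite {1}[X]matrix_sum_delta linK_sum; apply: eq_bigr => i _; rewrite linK_sum.
by apply: eq_bigr => j _; rewrite linKZ.
Qed.

Lemma tensor_mapKE r1 r2 (L : 'M[K]_r1 -> 'M[K]_r2) X i k j l :
  tensor_mapK L M X (i ## k) (j ## l) = \sum_p \sum_q L (delta_mx p q) i j * M (blk X p q) k l.
Proof.
rewrite summxE; apply: eq_bigr => p _; rewrite summxE; apply: eq_bigr => q _.
rewrite linK_delta [in RHS]summxE mulr_sumr summxE; apply: eq_bigr => k' _.
rewrite [in RHS]summxE mulr_sumr summxE; apply: eq_bigr => l' _.
rewrite [in LHS]mxE tensmxE [in RHS]mxE blkE; ring.
Qed.

Lemma idtensKE r X : @idtensK _ _ r _ _ M X = idt M X.
Proof.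
apply: tens_matrixP => i k j l; rewrite tensor_mapKE idtE.
rewrite (bigD1 i) //= [X in _ + X]big1 ?addr0 => [|p /negPf ne]; last first.
  by apply: big1 => q _; rewrite mxE eq_sym ne mul0r.
rewrite (bigD1 j) //= big1 ?addr0 => [|q /negPf ne]; first by rewrite mxE !eqxx mul1r.
by rewrite mxE [j == q]eq_sym ne andbF mul0r.
Qed.

Lemma ptr1KE a b (X : 'M[K]_(a * b)) : ptr1K X = ptr (@jl _ _ a b) X.
Proof. by apply/matrixP => k l; rewrite ptr_jlE mxE. Qed.

Lemma replKE2 r1 r2 X : tensor_mapK (@replacerK R K r1 r2) M X = 1%:M *t M (ptr1K X).
Proof.
apply: tens_matrixP => i k j l; rewrite tensor_mapKE tensmxE.
have -> : ptr1K X = \sum_p blk X p p.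
  by apply/matrixP => u v; rewrite mxE summxE; apply: eq_bigr => p _; rewrite mxE.
rewrite linK_sum summxE mulr_sumr; apply: eq_bigr => p _.
rewrite (bigD1 p) //= big1 ?addr0 => [|q /negPf ne]; rewrite /replacerK tr_delta.
  by rewrite eqxx scale1r.
by rewrite eq_sym ne scale0r mxE mul0r.
Qed.

Lemma lin_repl a r : is_linear_mapK (fun X : 'M[K]_(r * d1) => (1%:M : 'M[K]_a) *t M (ptr1K X)).
Proof.
move=> c X Y; have -> : ptr1K (c *: X + Y) = c *: ptr1K X + ptr1K Y.
  apply/matrixP => k l; rewrite !mxE mulr_sumr -big_split; apply: eq_bigr => i _.
  by rewrite !mxE.
rewrite linM; apply: tens_matrixP => i k j l; rewrite tensmxE !mxE !mxtens_indexK /=; ring.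
Qed.

(* Both sides of this identity are the output of the replacer tensored with
   [M], run on half of a bipartite input. *)
Lemma idt_repl a r m X : idt (fun X : 'M[K]_(r * d1) => (1%:M : 'M[K]_a) *t M (ptr1K X)) X =
  amp (@jm _ _ m a d2) (idt M (ptr (@jm _ _ m r d1) X)).
Proof.
apply: tens_matrixP => p u p' v; rewrite idtE.
case: (mxtens_indexP u) => i k; case: (mxtens_indexP v) => j l.
rewrite tensmxE amp_jmE idtE mxE; congr (_ * M _ _ _).
by apply/matrixP => x y; rewrite !mxE ptr_jmE; apply: eq_bigr => q _; rewrite mxE.
Qed.

(** The Kraus operators are reshaped columns of a Gram factor of the Choi matrix, the image of
    [om om^*] with [om] maximally entangled and unnormalized. *)
Lemma choi_kraus : compl_posK M -> exists L : 'I_(d1 * d2) -> 'M[K]_(d2, d1), forall X, M X = kr L X.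
Proof.
move=> cM; pose om : 'cV[K]_(d1 * d1) := \col_u ((mxtens_unindex u).1 == (mxtens_unindex u).2)%:R.
have := cM d1 _ (psd_gram' om); rewrite idtensKE => /psd_cols[y ey].
exists (fun x => \matrix_(k, i) y x (i ## k) 0) => X.
have eM i j k l : M (delta_mx i j) k l = \sum_x y x (i ## k) 0 * Num.conj (y x (j ## l) 0).
  have := congr1 (fun A : 'M[K]_(d1 * d2) => A (i ## k) (j ## l)) ey; rewrite idtE summxE.
  have -> : blk (om *m adjm om) i j = delta_mx i j.
    apply/matrixP => u v; rewrite !mxE big_ord1 !mxE !mxtens_indexK /= rmorph_nat -natrM mulnb.
    by rewrite [i == u]eq_sym [j == v]eq_sym.
  by move=> ->; apply: eq_bigr => x _; rewrite mxE big_ord1 adjE.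
apply/matrixP => k l; rewrite linK_delta kr1E summxE [RHS]exchange_big /=; apply: eq_bigr => i _.
rewrite summxE [RHS]exchange_big /=; apply: eq_bigr => j _.
rewrite mxE eM mulr_sumr; apply: eq_bigr => x _; rewrite !mxE; ring.
Qed.

Lemma kraus_unital e (L : 'I_e -> 'M[K]_(d2, d1)) : (forall X, M X = kr L X) ->
  trace_presK M -> \sum_x adjm (L x) *m L x = 1%:M.
Proof.
move=> hL tM; set W := \sum_x _; apply/matrixP => i j.
have := tM (delta_mx j i); rewrite hL kr_tr -/W tr_delta mxE eq_sym => <-.
rewrite /mxtrace (bigD1 i) //= big1 ?addr0 => [|k /negPf ne].
  by rewrite mxE (bigD1 j) //= big1 ?addr0 => [|l /negPf ne]; rewrite mxE ?eqxx ?mulr1 // ne mulr0.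
by rewrite mxE big1 // => l _; rewrite mxE ne andbF mulr0.
Qed.

End Linear.
End Bridge.

(** * Tensor powers of channels through their kernels *)

Section Powers.
Context {R : realType} {K : cplx R}.
Local Notation rc := (rc K).

Definition kker e d1 d2 (L : 'I_e -> 'M[K]_(d2, d1)) (s s' : 'I_d1) (y y' : 'I_d2) : K :=
  \sum_x L x y s * Num.conj (L x y' s').

Lemma kr_kmap e d1 d2 (L : 'I_e -> 'M[K]_(d2, d1)) X : kr L X = kmap (kker L) X.
Proof.
apply/matrixP => y y'; rewrite kr1E mxE exchange_big; apply: eq_bigr => s _ /=.
rewrite exchange_big; apply: eq_bigr => s' _; rewrite mulr_sumr; apply: eq_bigr => x _ /=.
by rewrite mulrCA mulrA.
Qed.

Lemma kmap_delta d1 d2 (k : 'I_d1 -> 'I_d1 -> 'I_d2 -> 'I_d2 -> K) s s' y y' :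
  kmap k (delta_mx s s') y y' = k s s' y y'.
Proof.
rewrite mxE (bigD1 s) //= [X in _ + X]big1 ?addr0 => [|u /negPf ne]; last first.
  by apply: big1 => v _; rewrite mxE ne mul0r.
rewrite (bigD1 s') //= big1 ?addr0 => [|u /negPf ne]; first by rewrite mxE !eqxx mul1r.
by rewrite mxE ne andbF mul0r.
Qed.

Lemma kmap_lin d1 d2 (k : 'I_d1 -> 'I_d1 -> 'I_d2 -> 'I_d2 -> K) : is_linear_mapK (kmap k).
Proof.
move=> c X Y; apply/matrixP => y y'; rewrite !mxE mulr_sumr -big_split; apply: eq_bigr => s _ /=.
rewrite mulr_sumr -big_split; apply: eq_bigr => s' _ /=; rewrite !mxE; ring.
Qed.

Section KrausPower.
Variables (n e d1 d2 E D1 D2 : nat) (L : 'I_e -> 'M[K]_(d2, d1)).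
Variables (lx : 'I_E -> 'I_n -> 'I_e) (l : 'I_D1 -> 'I_n -> 'I_d1) (m : 'I_D2 -> 'I_n -> 'I_d2).
Variables (lx' : ('I_n -> 'I_e) -> 'I_E) (l' : ('I_n -> 'I_d1) -> 'I_D1) (m' : ('I_n -> 'I_d2) -> 'I_D2).
Hypotheses (hx : labeling lx lx') (hl : labeling l l') (hm : labeling m m').

Definition krpow (x : 'I_E) : 'M[K]_(D2, D1) := \matrix_(y, s) \prod_i L (lx x i) (m y i) (l s i).

Lemma kker_pow s s' y y' : kker krpow s s' y y' = kpow l m (kker L) s s' y y'.
Proof.
rewrite /kpow /kker -(sum_prod_labeling (fun i x => L x (m y i) (l s i) * Num.conj (L x (m y' i) (l s' i))) hx).
by apply: eq_bigr => x _; rewrite !mxE rmorph_prod -big_split.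
Qed.

Lemma kr_pow X : kr krpow X = kmap (kpow l m (kker L)) X.
Proof.
rewrite kr_kmap; apply/matrixP => y y'; rewrite !mxE; apply: eq_bigr => s _.
by apply: eq_bigr => s' _; rewrite kker_pow.
Qed.

Lemma krpow_unital : \sum_x adjm (L x) *m L x = 1%:M ->
  \sum_x adjm (krpow x) *m krpow x = 1%:M.
Proof.
move=> h; rewrite -(tpow1 (K := K) hl) -h; apply/matrixP => s s'; rewrite summxE mxE.
have -> : \prod_i (\sum_x adjm (L x) *m L x) (l s i) (l s' i) =
    \prod_i \sum_x \sum_y Num.conj (L x y (l s i)) * L x y (l s' i).
  apply: eq_bigr => i _; rewrite summxE; apply: eq_bigr => x _; rewrite mxE.
  by apply: eq_bigr => y _; rewrite adjE.
rewrite -(sum_prod_labeling (fun i x => \sum_y Num.conj (L x y (l s i)) * L x y (l s' i)) hx).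
apply: eq_bigr => x _; rewrite -(sum_prod_labeling (fun i y => Num.conj (L (lx x i) y (l s i)) * L (lx x i) y (l s' i)) hm).
by rewrite mxE; apply: eq_bigr => y _; rewrite !mxE rmorph_prod -big_split.
Qed.

Lemma idt_kmap_tpow r R0 (lr : 'I_R0 -> 'I_n -> 'I_r) k (rho : 'M[K]_(r * d1)) :
  idt (kmap (kpow l m k)) (tpow (lprod lr l) (lprod lr l) rho) =
  tpow (lprod lr m) (lprod lr m) (idt (kmap k) rho).
Proof.
apply: tens_matrixP => p y p' y'; rewrite idtE !mxE.
under [RHS]eq_bigr do rewrite !lprodE idtE mxE.
rewrite -(sum_prod_labeling (fun i s => \sum_s' blk rho (lr p i) (lr p' i) s s' * k s s' (m y i) (m y' i)) hl).
apply: eq_bigr => s _.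
rewrite -(sum_prod_labeling (fun i s' => blk rho (lr p i) (lr p' i) (l s i) s' * k (l s i) s' (m y i) (m y' i)) hl).
apply: eq_bigr => s' _; rewrite !mxE -big_split; apply: eq_bigr => i _ /=.
by rewrite !lprodE mxE.
Qed.

End KrausPower.

Section BipartitePower.
Variables (a' b' a b : nat).

Lemma swap_midE p q r s (i : 'I_p) (j : 'I_q) (k : 'I_r) (l : 'I_s) :
  swap_mid ((i ## j) ## (k ## l)) = (i ## k) ## (j ## l).
Proof. by rewrite /swap_mid !mxtens_indexK. Qed.

Lemma swap_midK p q r s : cancel (@swap_mid p q r s) (@swap_mid p r q s).
Proof.
move=> u; case: (mxtens_indexP u) => v w; case: (mxtens_indexP v) => i j.
by case: (mxtens_indexP w) => k l; rewrite !swap_midE.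
Qed.

Lemma swap_label0 p q n (s : 'I_(p * q)) (t : 'I_(dpow p n * dpow q n)) :
  lprod (@dig p n.+1) (@dig q n.+1) (swap_mid (s ## t)) ord0 = s.
Proof.
case: (mxtens_indexP s) => i j; case: (mxtens_indexP t) => k l.
by rewrite swap_midE lprodE (@digS0 p n) (@digS0 q n).
Qed.

Lemma swap_labelS p q n (s : 'I_(p * q)) (t : 'I_(dpow p n * dpow q n)) i :
  lprod (@dig p n.+1) (@dig q n.+1) (swap_mid (s ## t)) (lift ord0 i) =
  lprod (@dig p n) (@dig q n) t i.
Proof.
case: (mxtens_indexP s) => j j'; case: (mxtens_indexP t) => k l.
by rewrite swap_midE !lprodE (@digSl p n) (@digSl q n).
Qed.

(** By induction: [swap_mid] brings the first letters of the two words together, and on word labels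
    the kernel splits off the factor of that first letter. *)
Lemma bpowKE (N : 'M[K]_(a' * b') -> 'M[K]_(a * b)) k n : (forall X, N X = kmap k X) ->
  forall X, @bpowK R K _ _ _ _ N n X = kmap (kpow (lprod (@dig a' n) (@dig b' n)) (lprod (@dig a n) (@dig b n)) k) X.
Proof.
move=> hN; elim: n => [|n IH] X.
  apply/matrixP => y y'; rewrite mxE !big_ord1 /kpow big_ord0 mulr1.
  by congr (X _ _); [exact: (ord1 (y : 'I_1)) | exact: (ord1 (y' : 'I_1))].
have -> : @bpowK R K _ _ _ _ N n.+1 X = btensK N (@bpowK R K _ _ _ _ N n) X by [].
have lin : is_linear_mapK (@bpowK R K _ _ _ _ N n) by move=> c Y Z; rewrite !IH kmap_lin.
have := @swap_label0 a b n; have := @swap_label0 a' b' n.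
have := @swap_labelS a b n; have := @swap_labelS a' b' n.
move: (lprod (@dig a' n.+1) (@dig b' n.+1)) (lprod (@dig a n.+1) (@dig b n.+1)).
move=> li lo liS loS li0 lo0.
apply/matrixP => u u'; rewrite mxE.
have -> : u = swap_mid (swap_mid u) by rewrite swap_midK.
have -> : u' = swap_mid (swap_mid u') by rewrite swap_midK.
case: (mxtens_indexP (swap_mid u)) => y z; case: (mxtens_indexP (swap_mid u')) => y' z'.
rewrite !swap_midK (tensor_mapKE lin).
rewrite [RHS]mxE (reindex (@swap_mid a' b' (dpow a' n) (dpow b' n))) /=; last first.
  by exists (@swap_mid a' (dpow a' n) b' (dpow b' n)) => v _; rewrite swap_midK.
rewrite [RHS]sum_tens; apply: eq_bigr => s _.
transitivity (\sum_t \sum_s' \sum_t' X (swap_mid (s ## t)) (swap_mid (s' ## t')) *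
    (k s s' y y' * kpow (lprod (@dig a' n) (@dig b' n)) (lprod (@dig a n) (@dig b n)) k t t' z z')).
  rewrite exchange_big; apply: eq_bigr => s' _; rewrite IH hN kmap_delta mxE mulr_sumr.
  apply: eq_bigr => t _; rewrite mulr_sumr; apply: eq_bigr => t' _; rewrite !mxE; ring.
apply: eq_bigr => t _; rewrite [RHS](reindex (@swap_mid a' b' (dpow a' n) (dpow b' n))) /=; last first.
  by exists (@swap_mid a' (dpow a' n) b' (dpow b' n)) => v _; rewrite swap_midK.
rewrite [RHS]sum_tens; apply: eq_bigr => s' _; apply: eq_bigr => t' _; congr (_ * _).
rewrite /kpow big_ord_recl !li0 !lo0; congr (_ * _); apply: eq_bigr => i _.
by rewrite !liS !loS.
Qed.

(** On kernels no-signaling is the identity [hk] for single letters, and it multiplies over the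
    letters. *)
Lemma ptr1_kpow n A0 B0 A1 B1 (la' : 'I_A0 -> 'I_n -> 'I_a') la'' (lb' : 'I_B0 -> 'I_n -> 'I_b')
  (la : 'I_A1 -> 'I_n -> 'I_a) la1 (lb : 'I_B1 -> 'I_n -> 'I_b) kN kQ :
  labeling la' la'' -> labeling la la1 ->
  (forall X : 'M[K]_(a' * b'), ptr1K (kmap kN X : 'M[K]_(a * b)) = kmap kQ (ptr1K X)) ->
  forall X, ptr1K (kmap (kpow (lprod la' lb') (lprod la lb) kN) X) =
    kmap (kpow lb' lb kQ) (ptr1K X).
Proof.
move=> ha' ha h X.
have hk s1 s2 s1' s2' q q' : \sum_p kN (s1 ## s2) (s1' ## s2') (p ## q) (p ## q') =
    (s1 == s1')%:R * kQ s2 s2' q q'.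
  have := congr1 (fun A : 'M[K]_b => A q q') (h (delta_mx (s1 ## s2) (s1' ## s2'))).
  rewrite [LHS]mxE; under eq_bigr do rewrite kmap_delta.
  move=> ->; have -> : ptr1K (delta_mx (s1 ## s2) (s1' ## s2')) = (s1 == s1')%:R *: delta_mx s2 s2' :> 'M[K]_b'.
    apply/matrixP => u v; rewrite !mxE.
    under eq_bigr do rewrite mxE !(can_eq (@mxtens_indexK _ _)) !xpair_eqE.
    rewrite (bigD1 s1) //= eqxx big1 ?addr0 => [|x /negPf ne]; last by rewrite ne.
    by rewrite -natrM mulnb; congr (_%:R); rewrite /= andbCA.
  by rewrite (linKZ (@kmap_lin _ _ kQ)) mxE kmap_delta.
apply/matrixP => q q'; rewrite !mxE.
transitivity (\sum_s \sum_s' X s s' * \prod_i \sum_p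
    kN (lprod la' lb' s i) (lprod la' lb' s' i) (p ## lb q i) (p ## lb q' i)).
  under eq_bigr do rewrite mxE.
  rewrite exchange_big; apply: eq_bigr => s _ /=; rewrite exchange_big; apply: eq_bigr => s' _ /=.
  rewrite -mulr_sumr; congr (_ * _).
  rewrite -(sum_prod_labeling (fun i p => kN (lprod la' lb' s i) (lprod la' lb' s' i) (p ## lb q i) (p ## lb q' i)) ha).
  by apply: eq_bigr => p _; apply: eq_bigr => i _; rewrite !lprodE.
rewrite sum_tens exchange_big; apply: eq_bigr => t _ /=.
under eq_bigr do rewrite sum_tens exchange_big.
rewrite exchange_big; apply: eq_bigr => t' _ /=.
rewrite mxE mulr_suml; apply: eq_bigr => r _.
rewrite (bigD1 r) //= [X in _ + X]big1 ?addr0 => [|r' ne].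
  congr (_ * _); apply: eq_bigr => i _; by rewrite !lprodE hk eqxx mul1r.
have [i ni] : exists i, la' r i != la' r' i.
  apply/existsP; apply: contraR ne; rewrite negb_exists => /forallP hi.
  by apply/eqP; apply: (labeling_inj ha') => i; have := hi i; rewrite negbK => /eqP ->.
by rewrite (bigD1 i) //= !lprodE hk (negPf ni) !mul0r mulr0.
Qed.

End BipartitePower.

Section Stinespring.
Variables (a e b s : nat) (L : 'I_e -> 'M[K]_(a * b, s)).

Definition stine : 'M[K]_((a * e) * b, s) := \matrix_(u, l)
  L (mxtens_unindex (mxtens_unindex u).1).2
    ((mxtens_unindex (mxtens_unindex u).1).1 ## (mxtens_unindex u).2) l.

Lemma outK_stine x : outK stine x = L x.
Proof.
apply/matrixP => u l; case: (mxtens_indexP u) => j k; rewrite js_sel mxE.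
by rewrite !mxtens_indexK.
Qed.

Lemma stine_iso : \sum_x adjm (L x) *m L x = 1%:M -> adjm stine *m stine = 1%:M.
Proof.
move=> <-; have := outK_cutK stine 1%:M; rewrite /cutV (amp1 (jr_blocks _ _)) mulmx1 => <-.
apply: eq_bigr => x _; rewrite /cutK (amp1 (jr_blocks _ _)) mul1mx outK_stine; congr (_ *m _).
exact: outK_stine.
Qed.

End Stinespring.

Lemma outK_Vpow a e b s (V : 'M[K]_((a * e) * b, s)) n A E B S (la : 'I_A -> 'I_n -> 'I_a)
  (le : 'I_E -> 'I_n -> 'I_e) (lb : 'I_B -> 'I_n -> 'I_b) (ls : 'I_S -> 'I_n -> 'I_s) x :
  outK (Vpow V la le lb ls) x = krpow (outK V) le ls (lprod la lb) x.
Proof.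
apply/matrixP => u l; case: (mxtens_indexP u) => j k; rewrite js_sel !mxE.
by apply: eq_bigr => i _; rewrite !lprodE js_sel.
Qed.

End Powers.

(** * The smoothed channel built from a cut *)

Section Candidate.
Context {R : realType} {K : cplx R}.
Local Notation rc := (rc K).

Lemma mxtrace_sub n (A B : 'M[K]_n) : \tr (A - B) = \tr A - \tr B.
Proof. exact: raddfB. Qed.

Lemma fcalc_scale n (A : 'M[K]_n) f c : adjm A = A ->
  fcalc f (rc c *: A) = fcalc (fun x => f (c * x)) A.
Proof.
move=> /spec_exists[U [d [u eA]]]; rewrite (@fcalc_spec _ _ _ A U d) //.
rewrite (@fcalc_spec _ _ _ _ U (fun i => c * d i)) //; split=> //.
rewrite {1}eA scalemxAl scalemxAr; congr (_ *m _ *m _).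
by apply/matrixP => i j; rewrite mxE !rdiagE mulrnAr -rmorphM.
Qed.

(** As [ln 0 = 0], scaling shifts the logarithm only on the support of [z]; the correction by the
    kernel projection [P0] is invisible to [w]. *)
Lemma tre_ln_scale n (w z : 'M[K]_n) c : 0 < c -> psdm z -> tre w = 1 ->
  (forall v : 'cV[K]_n, z *m v = 0 -> w *m v = 0) ->
  tre (w *m fcalc (@ln R) (rc c *: z)) = tre (w *m fcalc (@ln R) z) + ln c.
Proof.
move=> c0 pz w1 h; have hz := proj1 pz.
pose P0 := fcalc (fun x => (x == 0)%:R) z.
have wP : w *m P0 = 0.
  apply/matrixP => i j; have : z *m col j P0 = 0.
    rewrite colE mulmxA -{1}(fcalc_id hz) fcalcM // (_ : (fun x => _) = fun x => 0 * 0).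
      by rewrite -fcalcZ rmorph0 scale0r mul0mx.
    by apply/funext => x; rewrite mul0r; case: eqP => [->|_]; rewrite ?mul0r ?mulr0.
  by move=> /h; rewrite colE mulmxA -colE => /matrixP /(_ i 0); rewrite !mxE.
rewrite fcalc_scale // (_ : fcalc _ z = fcalc (@ln R) z + rc (ln c) *: (1%:M - P0)).
  by rewrite mulmxDr trRD -scalemxAr trRZ mulmxBr wP subr0 mulmx1 w1 mulr1.
rewrite -(fcalc_cst hz) -scaleN1r -(rmorphN1 rc) fcalcZ fcalcD fcalcZ fcalcD.
apply: eq_fcalc => // x x0; have [->|xn] := eqVneq x 0.
  by rewrite mulr0 ln0 // mulr1 subrr mulr0 addr0.
by rewrite mulr0 addr0 mulr1 lnM ?posrE // ?lt_neqAle 1?eq_sym ?xn // addrC.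
Qed.

(** [amp J z] has trace [a], so Klein's inequality for its normalization leaves [- ln a]. This later
    keeps the white-noise term below the main scale [lam]. *)
Lemma relent_amp_ge a n m (J : 'I_a -> 'M[K]_(n, m)) (w : 'M[K]_n) (z : 'M[K]_m) :
  (0 < a)%N -> blocks J -> is_st w -> is_st z ->
  (forall v : 'cV[K]_n, amp J z *m v = 0 -> w *m v = 0) ->
  - ln a%:R <= tre (w *m (fcalc (@ln R) w - fcalc (@ln R) (amp J z))).
Proof.
move=> a0 bJ sw sz h; have ap : 0 < a%:R :> R by rewrite ltr0n.
have pz : psdm (amp J z) by apply: psd_amp; case: sz.
have sx : is_st (rc a%:R^-1 *: amp J z).
  split; first by apply: psdZ; rewrite ?rc_ge0 ?invr_ge0 ?ltW.
  rewrite trRZ -[amp J z]mul1mx tre_amp (_ : ptr J 1%:M = rc a%:R *: 1%:M).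
    by rewrite -scalemxAl mul1mx trRZ (proj2 sz) mulr1 mulVf ?gt_eqF.
  rewrite /ptr (eq_bigr (fun=> 1%:M)) => [|i _]; last by rewrite mulmx1 (proj1 bJ) eqxx.
  by rewrite sumr_const card_ord rmorph_nat scaler_nat.
have := klein sw sx _; rewrite tre_ln_scale ?invr_gt0 //; last by case: sw.
rewrite lnV ?posrE // mulmxBr trRB tre_ln_ent; last by case: sw => -[].
move=> hk; have {hk} : ent w <= - (tre (w *m fcalc (@ln R) (amp J z)) - ln a%:R).
  apply: hk => v; rewrite -scalemxAl => /eqP; rewrite scaler_eq0 => /orP[|/eqP] //; last exact: h.
  by rewrite fmorph_eq0 invr_eq0 gt_eqF.
lra.
Qed.

Lemma idt_lin r d1 d2 (f g : 'M[K]_d1 -> 'M[K]_d2) c (X : 'M[K]_(r * d1)) :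
  idt (fun X => f X + c *: g X) X = idt f X + c *: idt g X.
Proof.
apply: tens_matrixP => i k j l; have h1 := idtE f X i j k l; have h2 := idtE g X i j k l.
by rewrite idtE [in RHS]mxE h1 ![in RHS]mxE !mxE !mxtens_indexK.
Qed.

Lemma cpmD d1 d2 (f g : 'M[K]_d1 -> 'M[K]_d2) c : 0 <= c -> cpm f -> cpm g ->
  cpm (fun X => f X + rc c *: g X).
Proof.
move=> c0 cf cg r X pX; rewrite idt_lin; apply: psdD; first exact: cf.
by apply: psdZ; [rewrite rc_ge0 | apply: cg].
Qed.

Lemma eq_cpm d1 d2 (f g : 'M[K]_d1 -> 'M[K]_d2) : f =1 g -> cpm f -> cpm g.
Proof. by move=> /funext ->. Qed.

Lemma cpm_trace d m (W : 'M[K]_d) : psdm W -> cpm (fun X => \tr (W *m X) *: (1%:M : 'M[K]_m)).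
Proof.
move=> /psd_factor[G eW].
pose L (u : 'I_(m * d)) : 'M[K]_(m, d) := delta_mx (mxtens_unindex u).1 (mxtens_unindex u).2 *m adjm G.
apply: (eq_cpm (f := kr L)) (kr_cp L) => X.
rewrite /kr sum_tens exchange_big /=.
transitivity (\sum_j (adjm G *m X *m G) j j *: (1%:M : 'M[K]_m)).
  apply: eq_bigr => j _.
  have -> : (1%:M : 'M[K]_m) = \sum_i delta_mx i i.
    apply/matrixP => k l; rewrite summxE (bigD1 k) //= big1 ?addr0 => [|i /negPf ne].
      by rewrite !mxE eqxx eq_sym.
    by rewrite mxE eq_sym ne.
  rewrite scaler_sumr; apply: eq_bigr => i _; rewrite /L mxtens_indexK /= adjM adjK.
  have -> : adjm (delta_mx i j : 'M[K]_(m, d)) = delta_mx j i.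
    by apply/matrixP => k l; rewrite adjE !mxE rmorph_nat andbC.
  apply/matrixP => k l; rewrite -!mulmxA [LHS]mxE (bigD1 j) //= big1 ?addr0 => [|p /negPf ne]; last first.
    by rewrite mxE ne andbF mul0r.
  rewrite !mulmxA [X in _ * X]mxE (bigD1 j) //= big1 ?addr0 => [|p /negPf ne]; last first.
    by rewrite [delta_mx j i p l]mxE ne mulr0.
  by rewrite !mxE !eqxx andbT mulrCA -natrM mulnb.
by rewrite -scaler_suml eW -[G *m _ *m X]mulmxA [in RHS]mxtrace_mulC.
Qed.

Lemma channelKI d1 d2 (M : 'M[K]_d1 -> 'M[K]_d2) :
  is_linear_mapK M -> cpm M -> trace_presK M -> channelK M.
Proof. by move=> l c t; split=> // r X pX; rewrite idtensKE //; apply: c. Qed.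

Lemma channelK_st r d1 d2 (M : 'M[K]_d1 -> 'M[K]_d2) (rho : 'M[K]_(r * d1)) :
  channelK M -> is_st rho -> is_st (idt M rho).
Proof.
move=> [l c t] [p t1]; split; first by rewrite -idtensKE //; apply: c.
rewrite -t1 /tre; congr re; rewrite /mxtrace !sum_tens; apply: eq_bigr => i _.
under eq_bigr do rewrite idtE.
by rewrite -/(mxtrace _) t; apply: eq_bigr => k _; rewrite mxE.
Qed.

(** The images of [G] under all Kraus operators side by side: a purification of the output whose
    columns carry the environment and the purifying system of the input. *)
Definition stack e m n p (L : 'I_e -> 'M[K]_(m, n)) (G : 'M[K]_(n, p)) : 'M[K]_(m, e * p) :=
  \matrix_(u, w) (L (mxtens_unindex w).1 *m G) u (mxtens_unindex w).2.

Lemma stackE e m n p (L : 'I_e -> 'M[K]_(m, n)) (G : 'M[K]_(n, p)) u x k :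
  stack L G u (x ## k) = (L x *m G) u k.
Proof. by rewrite mxE mxtens_indexK. Qed.

Lemma stack_gram e m n p (L : 'I_e -> 'M[K]_(m, n)) (G : 'M[K]_(n, p)) :
  stack L G *m adjm (stack L G) = kr L (G *m adjm G).
Proof.
apply/matrixP => u v; rewrite mxE sum_tens summxE; apply: eq_bigr => x _.
rewrite !mulmxA -mulmxA -adjM [RHS]mxE; apply: eq_bigr => k _.
by rewrite !adjE !stackE.
Qed.

Lemma stack_tre e m n p (L L' : 'I_e -> 'M[K]_(m, n)) (G : 'M[K]_(n, p)) :
  tre (adjm (stack L G) *m stack L' G) = tre ((\sum_x adjm (L x) *m L' x) *m (G *m adjm G)).
Proof.
rewrite mulmxA [RHS]trRC mulmxA mulmx_sumr mulmx_suml /tre; congr re.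
rewrite /mxtrace sum_tens exchange_big; apply: eq_bigr => k _; rewrite summxE /=.
apply: eq_bigr => x _; rewrite !mulmxA -mulmxA -adjM [LHS]mxE [RHS]mxE; apply: eq_bigr => u _.
by rewrite !adjE !stackE.
Qed.

Section OneShotCandidate.
Variables (a' b' a e b : nat) (V : 'M[K]_((a * e) * b, a' * b')) (P : 'M[K]_(a * e)).
Variables (Q : 'M[K]_b' -> 'M[K]_b) (lam0 eta eps : R) (N : 'M[K]_(a' * b') -> 'M[K]_(a * b)).
Hypotheses (isoV : adjm V *m V = 1%:M) (hP : adjm P = P) (iP : P *m P = P).
Hypotheses (eN : forall X, N X = kr (outK V) X) (cQ : channelK Q).
Hypotheses (nsQ : forall X, ptr1K (N X) = Q (ptr1K X)) (l0 : 0 < lam0).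
Hypotheses (a0 : (0 < a)%N) (b0 : (0 < b)%N) (eta1 : eta <= 1).
Hypotheses (eps0 : 0 <= eps) (eeps : 2 * eta <= eps ^+ 2).
Hypothesis PV : lwle (1%:M - cutV V P) (rc eta *: 1%:M).
Hypothesis Pl : cpm (fun X => rc lam0 *: kr (replK V) X - kr (cutK V P) X).

Let W : 'M[K]_(a' * b') := 1%:M - cutV V P.
Let pP : psdm P. Proof. by rewrite -iP -{1}hP; apply: psd_gram. Qed.
Let pW : psdm W. Proof. by apply: cutV_le1 => //; apply: proj_le1. Qed.
Let ap : 0 < a%:R :> R. Proof. by rewrite ltr0n. Qed.
Let bp : 0 < b%:R :> R. Proof. by rewrite ltr0n. Qed.
Let ab : R := (a%:R * b%:R)^-1.
Let ab0 : 0 <= ab. Proof. by rewrite invr_ge0 mulr_ge0. Qed.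

(* The second summand restores the trace lost by the cut. *)
Definition cutN (X : 'M[K]_(a' * b')) : 'M[K]_(a * b) :=
  kr (cutK V P) X + rc ab *: (\tr (W *m X) *: 1%:M).

Let lam := lam0 + a%:R^-1.
Let lamp : 0 < lam. Proof. by rewrite addr_gt0 // invr_gt0. Qed.

(** The weights make [lam cutQ] equal to [lam0 Q] plus [1/a] times white noise on [B]; tensored with
    [1_A], the second part covers the white noise of [cutN]. *)
Definition cutQ (X : 'M[K]_b') : 'M[K]_b :=
  rc (lam0 / lam) *: Q X + rc (a%:R^-1 / lam / b%:R) *: (\tr (1%:M *m X) *: 1%:M).

Lemma cutN_channel : channelK cutN.
Proof.
apply: channelKI.
- move=> c X Y; rewrite /cutN kr_lin mulmxDr -scalemxAr mxtraceD mxtraceZ.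
  rewrite !scalerDr !scalerA mulrDr scalerDl (_ : rc ab * (c * _) = c * rc ab * \tr (W *m X)); last by ring.
  by rewrite addrACA.
- by apply: cpmD => //; [apply: kr_cp | apply: cpm_trace].
move=> X; rewrite mxtraceD !mxtraceZ mxtrace1 kr_tr cutK_proj // /W mulmxBl mul1mx mxtrace_sub.
have -> : (a * b)%:R = rc (a%:R * b%:R) by rewrite rmorphM !rmorph_nat natrM.
rewrite mulrCA -rmorphM mulVf ?mulf_neq0 ?gt_eqF // rmorph1 mulr1 addrC subrK //.
Qed.

Lemma cutQ_channel : channelK cutQ.
Proof.
have [lQ cpQ tQ] := cQ; apply: channelKI.
- move=> c X Y; rewrite /cutQ lQ !mul1mx mxtraceD mxtraceZ.
  rewrite !scalerDr !scalerA mulrDr scalerDl [rc (lam0 / lam) * c]mulrC.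
  set q := rc (_ / b%:R); rewrite (_ : q * (c * _) = c * q * \tr X); last by ring.
  by rewrite addrACA.
- apply: cpmD; [|move=> r X pX|by apply: cpm_trace; apply: psd1].
    by rewrite !divr_ge0 ?invr_ge0 // ltW.
  have -> : idt (fun X => rc (lam0 / lam) *: Q X) X = rc (lam0 / lam) *: idt Q X.
    by apply: tens_matrixP => i k j l; rewrite idtE [RHS]mxE idtE mxE.
  apply: psdZ; first by rewrite rc_ge0 divr_ge0 // ltW.
  by rewrite -idtensKE //; apply: cpQ.
move=> X; rewrite mxtraceD !mxtraceZ mxtrace1 tQ mul1mx.
have -> : b%:R = rc b%:R by rewrite rmorph_nat.
rewrite [\tr X * _]mulrC mulrA -rmorphM -mulrDl -rmorphD divfK ?gt_eqF // -mulrDl divff ?gt_eqF //.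
by rewrite rmorph1 mul1r.
Qed.

(** Beyond [Pl] there remains white noise of weight [\tr (cutV V P *m X)], the part of the trace
    that the cut kept. *)
Lemma cutN_le : cpm (fun X => rc lam *: (1%:M *t cutQ (ptr1K X)) - cutN X).
Proof.
apply: (eq_cpm (f := fun X => (rc lam0 *: kr (replK V) X - kr (cutK V P) X) +
   rc ab *: (\tr (cutV V P *m X) *: (1%:M : 'M[K]_(a * b))))); last first.
  by apply: cpmD => //; apply/cpm_trace/cutV_psd.
move=> X; rewrite replKE -ptr1KE -eN nsQ.
have tp : \tr (ptr1K X) = \tr X.
  by rewrite /mxtrace sum_tens exchange_big; apply: eq_bigr => k _; rewrite mxE.
have -> : cutV V P = 1%:M - W by rewrite /W subKr.
apply: tens_matrixP => i k j l; rewrite /cutN mulmxBl mul1mx mxtrace_sub /cutQ mul1mx tp.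
move: (\tr X) (\tr (W *m X)) (Q (ptr1K X)) (kr (cutK V P) X) => t u A B.
have e1 : (1%:M : 'M[K]_(a * b)) (i ## k) (j ## l) = (i == j)%:R * (k == l)%:R.
  by rewrite mxE (can_eq (@mxtens_indexK _ _)) xpair_eqE -natrM mulnb.
rewrite !mxE !mxtens_indexK /=.
rewrite !(can_eq (@mxtens_indexK _ _)) !xpair_eqE -!mulnb !natrM.
have e2 : rc lam * rc (lam0 / lam) = rc lam0 by rewrite -rmorphM mulrC divfK ?gt_eqF.
have e3 : rc lam * rc (a%:R^-1 / lam / b%:R) = rc ab.
  by rewrite -rmorphM (_ : lam * _ = ab) // mulrA [lam * _]mulrC divfK ?gt_eqF // /ab invfM.
transitivity ((i == j)%:R * (rc lam * rc (lam0 / lam) * A k l +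
   rc lam * rc (a%:R^-1 / lam / b%:R) * (t * (k == l)%:R)) - (B (i ## k) (j ## l) +
   rc ab * (u * ((i == j)%:R * (k == l)%:R)))); last by ring.
rewrite e2 e3; ring.
Qed.

(** The purified outputs overlap by at least [1 - eta], and by [sqf_ge_le] the added noise does no
    harm; then [1 - (1 - eta)^2 <= 2 eta <= eps^2]. *)
Lemma cut_pdist : (pdistK N cutN <= eps%:E)%E.
Proof.
apply: ge_ereal_sup => _ [r [rho [/is_stateKP srho ->]]]; rewrite lee_fin.
have lN : is_linear_mapK N by move=> c X Y; rewrite !eN kr_lin.
have [lc _ _] := cutN_channel.
rewrite !idtensKE //; have [prho trho] := srho; have [G eG] := psd_factor prho.
have eW : idt N rho = stack (fun x => 1%:M *t outK V x) G *m adjm (stack (fun x => 1%:M *t outK V x) G).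
  by rewrite stack_gram -eG -idt_kr; congr idt; apply/funext.
have hS : lwle (stack (fun x => 1%:M *t cutK V P x) G *m adjm (stack (fun x => 1%:M *t cutK V P x) G)) (idt cutN rho).
  rewrite stack_gram -eG -idt_kr /lwle /cutN idt_lin addrC addKr.
  by apply: psdZ; [rewrite rc_ge0 | apply: cpm_trace].
have F1 := sqf_ge_le (stack (fun x => 1%:M *t outK V x) G) hS.
rewrite -eW stack_tre -eG in F1.
have F2 : 1 - eta <= sqf (idt N rho) (idt cutN rho).
  apply: le_trans F1; rewrite (eq_bigr (fun x => 1%:M *t (adjm (outK V x) *m cutK V P x))) => [|x _]; last first.
    by rewrite adj_tens tensmx_mul adj1 mul1mx.
  have -> : \sum_x (1%:M : 'M[K]_r) *t (adjm (outK V x) *m cutK V P x) = 1%:M *t cutV V P.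
    rewrite -outK_cutK; apply: tens_matrixP => i k j l; rewrite summxE tensmxE summxE mulr_sumr.
    by apply: eq_bigr => x _; rewrite tensmxE.
  have -> : (1%:M : 'M[K]_r) *t cutV V P = 1%:M - 1%:M *t W.
    apply: tens_matrixP => i k j l; rewrite /W tensmxE !mxE !mxtens_indexK /= (can_eq (@mxtens_indexK _ _)) xpair_eqE -mulnb natrM; ring.
  rewrite mulmxBl mul1mx trRB trho lerD2l lerN2 trRC -[eta]mulr1 -[X in _ <= _ * X]trho -trRZ.
  have -> : rc eta *: rho = rho *m (1%:M *t (rc eta *: 1%:M)).
    rewrite (_ : (1%:M *t _) = rc eta *: 1%:M) ?mulmxA -?scalemxAr ?mulmx1 //.
    apply: tens_matrixP => i k j l; rewrite tensmxE !mxE (can_eq (@mxtens_indexK _ _)) xpair_eqE -mulnb natrM; ring.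
  apply: le_trRM => //.
  have -> : lwle ((1%:M : 'M[K]_r) *t W) (1%:M *t (rc eta *: 1%:M)) = psdm (amp (@jl _ _ r _) (rc eta *: 1%:M - W)).
    by rewrite ampB !amp_jlE.
  exact: psd_amp.
rewrite fidelityKE; [|by rewrite eW; apply: psd_gram'|by case: (channelK_st cutN_channel srho)].
have e1 : 1 - sqf (idt N rho) (idt cutN rho) ^+ 2 <= eps ^+ 2.
  have : (1 - eta) ^+ 2 <= sqf (idt N rho) (idt cutN rho) ^+ 2.
    by rewrite ler_pXn2r ?nnegrE ?subr_ge0 // (le_trans _ F2) // subr_ge0.
  have := sqr_ge0 eta; move: eeps; rewrite !expr2; nra.
by have := ler_wsqrtr e1; rewrite sqrtr_sqr ger0_norm.
Qed.

Lemma smooth_candidate : (- (log2 (lam0 + a%:R^-1))%:E <= smooth_minentK eps N)%E.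
Proof.
rewrite leeN2; apply: le_trans (_ : chan_divK (@dmaxK R K) cutN (tensor_mapK (@replacerK R K a' a) cutQ) <= _)%E.
  apply: ereal_inf_lbound; exists cutQ, cutN; split=> //.
  - exact: cutQ_channel.
  - exact: cutN_channel.
  - exact: cut_pdist.
apply: ge_ereal_sup => _ [r [rho [/is_stateKP [prho _] ->]]].
apply: ereal_inf_lbound; exists lam => //; split=> //.
have [lc _ _] := cutN_channel; have [lQ _ _] := cutQ_channel.
have -> : tensor_mapK (@replacerK R K a' a) cutQ = fun X => 1%:M *t cutQ (ptr1K X).
  by apply/funext => X; rewrite replKE2.
rewrite (idtensKE lc) idtensKE; last exact: lin_repl.
have := cutN_le prho.
have -> : idt (fun X => rc lam *: (1%:M *t cutQ (ptr1K X)) - cutN X) rho =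
  rc lam *: idt (fun X => 1%:M *t cutQ (ptr1K X)) rho - idt cutN rho; last by [].
apply: tens_matrixP => i k j l; have h1 := idtE (fun X => (1%:M : 'M[K]_a) *t cutQ (ptr1K X)) rho i j k l.
have h2 := idtE cutN rho i j k l.
by rewrite idtE !mxE !mxtens_indexK.
Qed.

End OneShotCandidate.
End Candidate.

(** * Asymptotics *)

Section Limits.
Context {R : realType}.
Local Open Scope ereal_scope.

Lemma limn_einf_ge (u : nat -> \bar R) x n0 : (forall n, (n0 <= n)%N -> x <= u n) ->
  x <= limn_einf u.
Proof.
move=> h; rewrite limn_einf_lim; apply: lime_ge; first exact: is_cvg_einfs.
exists n0 => // n /= hn; apply: le_ereal_inf_tmp => _ [k /= hk <-].
by apply: h; apply: leq_trans hk.
Qed.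

Lemma limn_esup_le (u : nat -> \bar R) x n0 : (forall n, (n0 <= n)%N -> u n <= x) ->
  limn_esup u <= x.
Proof.
move=> h; rewrite limn_esup_lim; apply: lime_le; first exact: is_cvg_esups.
exists n0 => // n /= hn; apply: ge_ereal_sup => _ [k /= hk <-].
by apply: h; apply: leq_trans hk.
Qed.

End Limits.

(** * The two rate bounds *)

Section Main.
Context {R : realType} {K : cplx R}.
Local Notation rc := (rc K).

Lemma ln2_gt0 : 0 < ln 2 :> R.
Proof. by apply: ln_gt0; rewrite ltr1n. Qed.

Lemma truncnS_le (x : R) n : 0 <= x -> ((Num.truncn x).+1 <= n)%N -> x <= n%:R.
Proof.
move=> x0 hn; have /andP[_ /ltW h] := truncn_itv x0.
by apply: le_trans h _; rewrite ler_nat.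
Qed.

Lemma dpowE d n : dpow d n = (d ^ n)%N.
Proof. by elim: n => [|n IH] //=; rewrite IH expnS. Qed.

Section Channel.
Variables (a' b' a b : nat) (N : 'M[K]_(a' * b') -> 'M[K]_(a * b)).
Hypotheses (a'0 : (0 < a')%N) (b'0 : (0 < b')%N) (a0 : (0 < a)%N) (b0 : (0 < b)%N).
Hypothesis cN : channelK N.

Let lN : is_linear_mapK N. Proof. by case: cN. Qed.

Lemma kraus_exists d1 d2 (M : 'M[K]_d1 -> 'M[K]_d2) : channelK M ->
  exists e (L : 'I_e -> 'M[K]_(d2, d1)),
    (forall X, M X = kr L X) /\ \sum_x adjm (L x) *m L x = 1%:M.
Proof.
move=> [l c t]; have [L hL] := choi_kraus l c; exists (d1 * d2)%N, L; split=> //.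
exact: kraus_unital hL t.
Qed.

Lemma kr_channel d1 d2 e (L : 'I_e -> 'M[K]_(d2, d1)) :
  \sum_x adjm (L x) *m L x = 1%:M -> channelK (kr L).
Proof.
move=> hL; apply: channelKI; [exact: kr_lin | exact: kr_cp |].
by move=> X; rewrite kr_tr hL mul1mx.
Qed.

Section NonSignaling.
Hypothesis nsN : no_signalingK N.
Variable Q : 'M[K]_b' -> 'M[K]_b.
Hypothesis cQ : channelK Q.

(** A finite divergence excludes the value [+oo] of the relative entropy, which is where the support
    condition comes from. *)
Lemma repl_div_bound (d : \bar R) r (rho : 'M[K]_(r * (a' * b'))) : is_st rho -> (d < +oo)%E ->
  (chan_divK (@relentK R K) N (tensor_mapK (@replacerK R K a' a) Q) <= d)%E ->
  let w := idt N rho in let z := idt Q (ptr (@jm _ _ r a' b') rho) in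
  [/\ is_st w, is_st z, forall v : 'cV[K]_(r * (a * b)), amp (@jm _ _ r a b) z *m v = 0 -> w *m v = 0 &
    (((ln 2)^-1 * tre (w *m (fcalc (@ln R) w - fcalc (@ln R) (amp (@jm _ _ r a b) z))))%:E <= d)%E].
Proof.
move=> srho doo hd w z; have [lQ _ _] := cQ.
have sw : is_st w by apply: channelK_st.
have sz : is_st z by apply: channelK_st => //; apply: st_ptr srho; apply: jm_blocks.
have h : (relentK w (amp (@jm _ _ r a b) z) <= d)%E.
  apply: le_trans hd; apply: ereal_sup_ubound; exists r, rho; split; first exact/is_stateKP.
  have -> : tensor_mapK (@replacerK R K a' a) Q = fun X => 1%:M *t Q (ptr1K X).
    by apply/funext => X; rewrite replKE2.
  by rewrite (idtensKE lN) idtensKE ?idt_repl //; apply: lin_repl.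
have supp : supp_leK w (amp (@jm _ _ r a b) z).
  apply: contrapT => hs; move: h; rewrite /relentK asboolF // => h.
  by have := le_lt_trans h doo; rewrite ltxx.
split=> //; rewrite -relentKE //; first by case: sw => -[].
by rewrite adj_amp; case: sz => -[->].
Qed.

Lemma direct_part (eps : R) : 0 < eps < 1 ->
  (- chan_divK (@relentK R K) N (tensor_mapK (@replacerK R K a' a) Q) <=
   limn_einf (reg_minentK eps N))%E.
Proof.
move=> /andP[e0 e1]; set Dq := chan_divK _ _ _.
have sp : (0 < a' * b')%N by rewrite muln_gt0 a'0.
have [->|Dfin] := eqVneq Dq +oo%E; first by rewrite /= leNye.
have Doo : (Dq < +oo)%E by rewrite ltey.
have hB r (rho : 'M[K]_(r * (a' * b'))) (s : is_st rho) := repl_div_bound s Doo (lexx Dq).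
(* One state with trivial reference shows that the supremum is not [-oo], and it also yields the
   lower bound on [D0]. *)
pose rho0 : 'M[K]_(1 * (a' * b')) := rc (1 * (a' * b'))%:R^-1 *: 1%:M.
have s0 : is_st rho0 by apply: max_mixed_st; rewrite mul1n.
have [d ed] : exists d, Dq = d%:E.
  have [_ _ _] := hB _ _ s0; case: Dq Dfin {Doo hB} => [d _ _|//|_]; first by exists d.
  by rewrite leNgt ltNyr.
rewrite ed in hB *; pose D0 := d * ln 2.
have l2 := ln2_gt0.
have hT r (rho : 'M[K]_(r * (a' * b'))) : is_st rho ->
    tre (idt N rho *m (fcalc (@ln R) (idt N rho) -
      fcalc (@ln R) (amp (@jm _ _ r a b) (idt Q (ptr (@jm _ _ r a' b') rho))))) <= D0.
  by move=> /hB[_ _ _]; rewrite lee_fin mulrC ler_pdivrMr.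
have D0a : - ln a%:R <= D0.
  have [sw sz hs _] := hB _ _ s0; apply: le_trans (hT _ _ s0).
  exact: relent_amp_ge (jm_blocks 1 a b) sw sz hs.
have [e [L [eL uL]]] := kraus_exists cN.
pose V := stine L; have isoV : adjm V *m V = 1%:M by apply: stine_iso.
have oV : outK V = L by apply/funext => x; apply: outK_stine.
have eV : N = kr (outK V) by apply/funext => X; rewrite oV eL.
have hD X : is_st X -> ent (AEm V X) - ent (ptr (@jl _ _ a e) (AEm V X)) <= D0.
  move=> sX; have [rho [srho e1' e2']] := purified_entropy V sX.
  rewrite -e1' -e2' -eV; have [sw sz hs _] := hB _ _ srho.
  exact: le_trans (ent_diff_le (jm_blocks _ _ _) sw sz hs) (hT _ _ srho).
(* [Q] has supplied [D0]; the comparison channel from here on is the marginal channel [Q0] of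
   [N]. *)
have [Q0 [cQ0 nsQ0]] := nsN; have [eq [LQ [eLQ uLQ]]] := kraus_exists cQ0.
apply/lee_subgt0Pr => gam g0.
(* In bits the cut costs [5 delta / ln 2] per copy, and doubling [lam] costs one bit in all, at most
   [n delta]; together this is [gam] per copy. *)
pose c : R := 5 / ln 2 + 1; have c0 : 0 < c by rewrite addr_gt0 // divr_gt0.
pose delta := gam / c; have d0 : 0 < delta by rewrite divr_gt0.
pose eta := eps ^+ 2 / 2; have eta0 : 0 < eta by rewrite divr_gt0 // exprn_gt0.
have [n0 hn0] := cut_asymptotic isoV sp hD d0 eta0.
apply: (@limn_einf_ge _ _ _ (maxn n0 (Num.truncn delta^-1).+1)) => n.
rewrite geq_max => /andP[n0n n1n].
have np : 0 < n%:R :> R by rewrite ltr0n (leq_trans _ n1n).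
have nd : n%:R^-1 <= delta.
  rewrite -[delta]invrK lef_pV2 ?posrE ?invr_gt0 //.
  by apply: truncnS_le n1n; rewrite invr_ge0 ltW.
have dl d1 := dig_labeling d1 n.
have hls := lprod_labeling (dl a') (dl b').
have [P [hP iP PV Pl]] := hn0 n n0n _ _ _ _ _ _ _ _ _ _ _ _ (dl a) (dl e) (dl b) hls.
have eNn X : @bpowK R K _ _ _ _ N n X = kr (outK (Vpow V (@dig a n) (@dig e n) (@dig b n) (lprod (@dig a' n) (@dig b' n)))) X.
  rewrite (@bpowKE _ _ _ _ _ _ N (kker L)) => [|Y]; last by rewrite eL kr_kmap.
  rewrite -(kr_pow L _ _ (dl e)); congr kr; apply/funext => x.
  by rewrite outK_Vpow oV.
have uQn := krpow_unital (dl eq) (dl b') (dl b) uLQ.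
have nsn X : ptr1K (@bpowK R K _ _ _ _ N n X) = kr (krpow LQ (@dig eq n) (@dig b' n) (@dig b n)) (ptr1K X).
  rewrite (@bpowKE _ _ _ _ _ _ N (kker L)) => [|Y]; last by rewrite eL kr_kmap.
  rewrite (kr_pow LQ _ _ (dl eq)); apply: (ptr1_kpow (@dig b' n) (@dig b n) (dl a') (dl a)) => Y.
  by rewrite -!kr_kmap -eL nsQ0 eLQ.
have posd d1 : (0 < d1)%N -> (0 < dpow d1 n)%N by rewrite dpowE expn_gt0 => ->.
have eta1 : eta <= 1 by rewrite /eta expr2; nra.
have eeps : 2 * eta <= eps ^+ 2 by rewrite /eta mulrCA divff ?mulr1.
have := smooth_candidate (Vpow_iso isoV (dl a) (dl e) (dl b) hls) hP iP eNn (kr_channel uQn) nsn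
  (expR_gt0 _) (posd _ a0) (posd _ b0) eta1 (ltW e0) eeps PV Pl.
move=> hs; rewrite /reg_minentK lee_pdivlMl //; apply: le_trans hs.
rewrite -EFinN -EFinB -EFinM -EFinN lee_fin lerNr.
set lam := expR _.
(* The white-noise term is at most [lam], so that adding it at most doubles [lam]. *)
have ila : (dpow a n)%:R^-1 <= lam.
  have ap : 0 < a%:R :> R by rewrite ltr0n.
  rewrite dpowE natrX -[a%:R]lnK ?posrE // -expRM_natl -expRN ler_expR -mulrN ler_pM2l //.
  by apply: le_trans D0a _; rewrite lerDl mulr_ge0 // ltW.
have lamp : 0 < lam by apply: expR_gt0.
have : log2 (lam + (dpow a n)%:R^-1) <= log2 (2 * lam).
  rewrite /log2 ler_pM2r ?invr_gt0 // ler_ln ?posrE ?mulr_gt0 //.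
    by rewrite mulr_natl mulr2n lerD2l.
  by rewrite addr_gt0 // invr_gt0 ltr0n posd.
move/le_trans; apply; rewrite /log2 lnM ?posrE // expRK mulrDl divff ?gt_eqF //.
have -> : n%:R * (D0 + 5 * delta) / ln 2 = n%:R * (d + 5 / ln 2 * delta).
  by rewrite /D0; field; rewrite gt_eqF.
have h1 : 1 <= n%:R * delta by rewrite -ler_pdivrMl // mulr1.
have -> : gam = c * delta by rewrite /delta mulrCA divff ?mulr1 ?gt_eqF.
rewrite /c -mulrN; move: h1; set t := 5 / ln 2.
have -> : n%:R * - (- d - (t + 1) * delta) = n%:R * (d + t * delta) + n%:R * delta by ring.
lra.
Qed.

End NonSignaling.

Lemma lin_ns : is_linear_mapK (fun X => (1%:M : 'M[K]_a) *t ptr1K (N X)).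
Proof.
move=> c X Y; rewrite lN; apply: tens_matrixP => i k j l; rewrite tensmxE !mxE !mxtens_indexK /=.
rewrite mulrCA -mulrDr; congr (_ * _); rewrite mulr_sumr -big_split.
by apply: eq_bigr => p _; rewrite !mxE.
Qed.

Lemma idt_ns r (rho : 'M[K]_(r * (a' * b'))) :
  idt (fun X => (1%:M : 'M[K]_a) *t ptr1K (N X)) rho =
  amp (@jm _ _ r a b) (ptr (@jm _ _ r a b) (idt N rho)).
Proof.
apply: tens_matrixP => p u p' v; rewrite idtE.
case: (mxtens_indexP u) => i k; case: (mxtens_indexP v) => j l.
rewrite tensmxE amp_jmE ptr_jmE mxE; congr (_ * _); rewrite mxE.
by apply: eq_bigr => q _; rewrite idtE.
Qed.

Lemma reg_minent_le (eps gam : R) r (rho : 'M[K]_(r * (a' * b'))) : 0 < eps < 1 / 2 -> 0 < gam ->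
  is_st rho -> exists n0, forall n, (n0 <= n)%N ->
  (reg_minentK eps N n <=
   (- ((ln 2)^-1 * (ent (ptr (@jm _ _ r a b) (idt N rho)) - ent (idt N rho))) + gam)%:E)%E.
Proof.
move=> /andP[e0 e1] g0 srho; have l2 := ln2_gt0.
set w := idt N rho; have sw : is_st w by apply: channelK_st.
set dd := ent _ - ent _.
(* The [2 delta] of the converse amount to [gam / 2] in bits; the factor 4 costs two bits, which
   [ng] keeps below the other half. *)
pose delta := gam * ln 2 / 4; have d0 : 0 < delta by rewrite divr_gt0 // mulr_gt0.
have [n0 hn0] := converse_bound sw d0.
exists (maxn n0 (Num.truncn (4 / gam)).+1) => n; rewrite geq_max => /andP[n0n n1n].
have np : 0 < n%:R :> R by rewrite ltr0n (leq_trans _ n1n).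
have ng : 4 <= n%:R * gam.
  by rewrite -ler_pdivrMr //; apply: truncnS_le n1n; rewrite divr_ge0 // ltW.
rewrite /reg_minentK lee_pdivrMl // leeNl; apply: le_ereal_inf_tmp => _ [Q [M [cQ cM hp ->]]].
have dl d1 := dig_labeling d1 n.
have hls := lprod_labeling (dl a') (dl b').
pose rhon := tpow (lprod (@dig r n) (lprod (@dig a' n) (@dig b' n))) (lprod (@dig r n) (lprod (@dig a' n) (@dig b' n))) rho.
have srn : is_st rhon by apply: st_tpow srho; apply: lprod_labeling (dl r) hls.
have [e [L [eL _]]] := kraus_exists cN.
have eN X : N X = kmap (kker L) X by rewrite eL kr_kmap.
have lNn : is_linear_mapK (@bpowK R K _ _ _ _ N n).
  by move=> c X Y; rewrite !(bpowKE eN) kmap_lin.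
have ew : idt (@bpowK R K _ _ _ _ N n) rhon =
    tpow (lprod (@dig r n) (lprod (@dig a n) (@dig b n))) (lprod (@dig r n) (lprod (@dig a n) (@dig b n))) w.
  rewrite /w; have -> : @bpowK R K _ _ _ _ N n = kmap (kpow (lprod (@dig a' n) (@dig b' n)) (lprod (@dig a n) (@dig b n)) (kker L)).
    by apply/funext => X; apply: bpowKE.
  have -> : N = kmap (kker L) by apply/funext.
  exact: (idt_kmap_tpow _ hls).
have [lM _ _] := cM; have [lQ _ _] := cQ.
have st : is_st (idt M rhon) by apply: channelK_st.
pose xi := idt Q (ptr (@jm _ _ _ _ _) rhon).
have sxi : is_st xi by apply: channelK_st => //; apply: st_ptr srn; apply: jm_blocks.
(* A root fidelity below 3/4 would make the purified distance exceed 1/2, against [eps < 1/2]. *)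
have hF : 3 / 4 <= sqf (tpow (lprod (@dig r n) (lprod (@dig a n) (@dig b n))) (lprod (@dig r n) (lprod (@dig a n) (@dig b n))) w) (idt M rhon).
  rewrite -ew; set F := sqf _ _; have F0 : 0 <= F by apply: trnorm_ge0.
  have : (Num.sqrt (1 - F ^+ 2) <= eps).
    rewrite -lee_fin; apply: le_trans hp; apply: ereal_sup_ubound.
    exists (dpow r n), rhon; split; first exact/is_stateKP.
    rewrite (idtensKE lNn) (idtensKE lM) fidelityKE //; last by case: st.
    by rewrite ew; apply: psd_tpow (lprod_labeling (dl r) (lprod_labeling (dl a) (dl b))) _; case: sw.
  move=> hs; rewrite leNgt; apply/negP => F1.
  have : Num.sqrt (1 / 4) <= Num.sqrt (1 - F ^+ 2) by apply: ler_wsqrtr; rewrite expr2; nra.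
  have -> : 1 / 4 = (1 / 2) ^+ 2 :> R by rewrite expr2; field.
  by rewrite sqrtr_sqr ger0_norm //; move: hs e1; lra.
apply: le_trans (_ : dmaxK (idt M rhon) (amp (@jm _ _ _ _ _) xi) <= _)%E; last first.
  apply: ereal_sup_ubound; exists (dpow r n), rhon; split; first exact/is_stateKP.
  have -> : tensor_mapK (@replacerK R K (dpow a' n) (dpow a n)) Q = fun X => 1%:M *t Q (ptr1K X).
    by apply/funext => X; rewrite replKE2.
  by rewrite (idtensKE lM) idtensKE ?idt_repl //; apply: lin_repl.
apply: le_ereal_inf_tmp => _ [lam [lam0 tle] <-].
have hl := hn0 n n0n _ _ _ _ _ _ _ _ _ (dl r) (dl a) (dl b) _ _ _ st sxi (ltW lam0) tle hF.
rewrite -EFinM -EFinN lee_fin.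
set x := n%:R * (_ - _) in hl.
have hx : log2 (expR x / 4) <= log2 lam.
  by rewrite /log2 ler_pM2r ?invr_gt0 // ler_ln ?posrE // divr_gt0 // expR_gt0.
apply: le_trans hx; rewrite /log2 ln_div ?posrE ?expR_gt0 // expRK mulrBl.
have -> : ln 4 = 2 * ln 2 :> R by rewrite (_ : 4 = 2 * 2) ?lnM ?posrE //; lra.
rewrite mulfK ?gt_eqF //.
have -> : x / ln 2 = n%:R * ((ln 2)^-1 * dd) - n%:R * gam / 2.
  by rewrite /x -/dd /delta; field; rewrite gt_eqF.
have -> : - (n%:R * (- ((ln 2)^-1 * dd) + gam)) = n%:R * ((ln 2)^-1 * dd) - n%:R * gam by ring.
by move: ng; lra.
Qed.

Lemma converse_part : (limsup_0plus (fun eps => limn_esup (reg_minentK eps N)) <= cond_ent_nsK N)%E.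
Proof.
rewrite /cond_ent_nsK leeNr; apply: ge_ereal_sup => _ [r [rho [/is_stateKP srho ->]]].
rewrite leeNr (idtensKE lN) (idtensKE lin_ns) idt_ns.
have sw := channelK_st cN srho; have [pw _] := sw.
have sC := st_ptr (jm_blocks r a b) sw; have [[hC _] _] := sC.
rewrite relentKE; [|by case: pw|by rewrite adj_amp hC|exact: supp_amp_ptr (jm_blocks _ _ _) _ pw].
(* The second argument is built from the own marginal of the output, so the relative entropy is
   exactly a difference of entropies. *)
rewrite tre_ln_amp //; [|exact: jm_blocks|by case: pw].
rewrite tre_ln_ent // (_ : - _ - _ = ent (ptr (@jm _ _ r a b) (idt N rho)) - ent (idt N rho)); last by ring.
rewrite -EFinN.
(* The infimum over neighbourhoods of 0 is estimated by the single one of radius 1/2, in which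
   [reg_minent_le] applies to every [eps]. *)
pose s := [set limn_esup (reg_minentK e N) | e in [set e : R | 0 < e < 1 / 2]].
apply: (@le_trans _ _ (ereal_sup s)).
  by apply: ereal_inf_lbound; exists (1 / 2) => //=; rewrite divr_gt0.
apply: ge_ereal_sup => _ [eps /= he <-]; apply/lee_addgt0Pr => gam g0.
have [n0 hn0] := reg_minent_le he g0 srho.
by rewrite -EFinD; apply: limn_esup_le hn0.
Qed.

Lemma ns_cond_ent_le : no_signalingK N -> (cond_ent_nsK N <= cond_entK N)%E.
Proof.
move=> [Q [cQ hQ]]; have [lQ _ _] := cQ; rewrite leeN2; apply: ereal_inf_lbound.
exists Q; first exact: cQ.
have -> : tensor_mapK (@replacerK R K a' a) Q = fun X => 1%:M *t ptr1K (N X).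
  by apply/funext => X; rewrite (replKE2 lQ) hQ.
reflexivity.
Qed.

Theorem theorem7K :
  (limsup_0plus (fun eps => limn_esup (reg_minentK eps N)) <= cond_ent_nsK N)%E /\
  (no_signalingK N ->
     (limsup_0plus (fun eps => limn_esup (reg_minentK eps N)) <= cond_entK N)%E /\
     (forall eps : R, 0 < eps < 1 ->
        (cond_entK N <= limn_einf (reg_minentK eps N))%E)).
Proof.
split; first exact: converse_part.
move=> ns; split=> [|eps he]; first exact: le_trans converse_part (ns_cond_ent_le ns).
rewrite /cond_entK leeNl; apply: le_ereal_inf_tmp => _ [Q cQ <-].
by rewrite leeNl; apply: direct_part.
Qed.

End Channel.
End Main.

(** * The complex numbers as an instance *)

Section Concrete.
Context (R : realType).
Lemma cK_reD : {morph (@complex.Re R) : x y / x + y}.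
Proof. by case=> a b [c d]. Qed.
Lemma cK_rcK : cancel (real_complex R) (@complex.Re R).
Proof. by []. Qed.
Lemma cK_re_real (x : complex R) : x \is Num.real -> (real_complex R) (complex.Re x) = x.
Proof.
case: x => a b; rewrite realE !lecE /= => /orP[] /andP[/eqP h _]; by rewrite /real_complex_def ?h // -h.
Qed.
Lemma cK_reZ a (x : complex R) : complex.Re (real_complex R a * x) = a * complex.Re x.
Proof. by case: x => b c /=; rewrite mul0r subr0. Qed.
Lemma cK_conj (x : complex R) : complex.Re (Num.conj x) = complex.Re x.
Proof. by case: x. Qed.
Lemma cK_ge0 a : (0 <= real_complex R a) = (0 <= a).
Proof. by rewrite lecE /= eqxx. Qed.
Definition cK : cplx R := @Cplx R (complex R) (real_complex R) (@complex.Re R)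
  cK_reD cK_rcK cK_re_real cK_reZ cK_conj cK_ge0.
End Concrete.

Theorem theorem7 (R : realType) (a' b' a b : nat)
  (N : 'M[complex R]_(a' * b') -> 'M[complex R]_(a * b)) :
  (0 < a')%N -> (0 < b')%N -> (0 < a)%N -> (0 < b)%N ->
  channel N ->
  (limsup_0plus (fun eps => limn_esup (reg_minent eps N)) <= cond_ent_ns N)%E /\
  (no_signaling N ->
     (limsup_0plus (fun eps => limn_esup (reg_minent eps N)) <= cond_ent N)%E /\
     (forall eps : R, 0 < eps < 1 ->
        (cond_ent N <= limn_einf (reg_minent eps N))%E)).
Proof.
move=> a'0 b'0 a0 b0 cN.
have e0 : @reg_minentK R (cK R) = @reg_minent R by [].
have e1 : @cond_entK R (cK R) = @cond_ent R by [].
have e2 : @cond_ent_nsK R (cK R) = @cond_ent_ns R by [].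
have := @theorem7K R (cK R) a' b' a b N a'0 b'0 a0 b0 cN.
by rewrite e0 e1 e2.
Qed.
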